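(* There is an absolute constant $C>0$ such that the following holds. Let $K$ be an $n\times n\times n$ linear tripartite simplicial complex that contains at least $\epsilon n^5$ octahedra. Then there is a subcomplex $L$ of $K$ with at least $\epsilon^{C}n^2$ faces that contains no slit octahedra.
   Context: An $n\times n\times n$ linear tripartite simplicial complex $K$ has three vertices $u,v,w$, a set $X$ of $n$ edges directed $u\to v$, a set $Y$ of $n$ edges directed $v\to w$, a set $Z$ of $n$ edges directed $u\to w$, and a set of triangular faces, each bounded by one edge from each of $X,Y,Z$, such that no two edges lie in more than one common face. Identify each face with its triple $(x,y,z)\in X\times Y\times Z$. A subcomplex is given by a subset of the faces. An octahedron in $K$ is an $8$-tuple of faces $(t_\omega)_{\omega\in\{0,1\}^3}$, $t_\omega=(x_\omega,y_\omega,z_\omega)$, such that $x_\omega=x_{\omega\oplus e_1}$, $y_\omega=y_{\omega\oplus e_2}$ and $z_\omega=z_{\omega\oplus e_3}$ for all $\omega$ (here $e_j$ is the $j$-th unit vector and $\oplus$ is addition mod 2; degeneracies allowed). A slit octahedron is an $8$-tuple of faces $(t_\omega)_{\omega\in\{0,1\}^3}$ satisfying all of these coincidence conditions except for exactly one pair $\{\omega,\omega\oplus e_j\}$, for which the corresponding class-$j$ edges are distinct (equivalently, a copy of the triangulated disc obtained from an octahedron by cutting along one edge, with its two boundary edges mapped to distinct edges). *)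

(* Defs.v *)
From mathcomp Require Import all_boot.

Set Implicit Arguments.
Unset Strict Implicit.
Unset Printing Implicit Defensive.

Section TripartiteComplex.

(* X, Y, Z are the edge classes u -> v, v -> w, u -> w.  A complex, or a
   subcomplex of it, is represented by its set of faces. *)
Variables X Y Z : finType.

Definition face : finType := (X * Y * Z)%type.
Definition edge : finType := (X + Y + Z)%type.

Definition edge_of (j : 'I_3) (f : face) : edge :=
  match val j with
  | 0 => inl (inl f.1.1)
  | 1 => inl (inr f.1.2)
  | _ => inr f.2
  end.

Definition lies_in (e : edge) (f : face) : bool :=
  [exists j : 'I_3, edge_of j f == e].

Definition linear_complex (K : {set face}) : Prop :=
  forall e1 e2 : edge, e1 != e2 ->
    #|[set f in K | lies_in e1 f && lies_in e2 f]| <= 1.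

Definition cube : finType := {ffun 'I_3 -> bool}.

(* w (+) e_j *)
Definition flip (j : 'I_3) (w : cube) : cube := [ffun i => w i (+) (i == j)].

Definition coincide (t : {ffun cube -> face}) (j : 'I_3) (w : cube) : bool :=
  edge_of j (t w) == edge_of j (t (flip j w)).

Definition octahedron (K : {set face}) (t : {ffun cube -> face}) : bool :=
  [forall w, t w \in K] && [forall j, forall w, coincide t j w].

Definition octahedra (K : {set face}) : {set {ffun cube -> face}} :=
  [set t | octahedron K t].

Definition slit_octahedron (K : {set face}) (t : {ffun cube -> face}) : Prop :=
  (forall w, t w \in K) /\
  exists (j : 'I_3) (w : cube),
    ~~ coincide t j w /\
    forall (j' : 'I_3) (w' : cube),
      ~ (j' = j /\ (w' = w \/ w' = flip j w)) -> coincide t j' w'.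

End TripartiteComplex.

(* Main.v *)
Require Import Defs.
From mathcomp Require Import all_boot all_order all_algebra.
From mathcomp Require Import reals exp.
From mathcomp Require Import ring lra zify.

Set Implicit Arguments.
Unset Strict Implicit.
Unset Printing Implicit Defensive.

Import Order.TTheory GRing.Theory Num.Theory.

Local Open Scope ring_scope.

(* Transport the edge classes to one set V of n labels: the faces become a partial
   Latin square T in V^3, in which two labels of a face determine the third. Call a
   configuration popular if it extends in a positive proportion of the conceivable
   ways.

   Let D be a slit octahedron with boundary x, x'. Fill each of its eight faces by an
   octahedron minus a face, then each of the pairs of new faces at the eleven interior
   edges of D by an octahedron minus two faces, and finally replace the four interior
   vertices of D by other centres of the rims of the resulting twelve-face stars. If
   all three steps are popular, then x and x' bound c n^50 discs of one fixed shape;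
   since x and the labels of fifty edges determine such a disc, x' included, only 1/c
   values of x' occur for each x. A proper colouring of this conflict relation then
   selects a positive proportion of the edges, without conflicts.

   Popularity is arranged by dependent random choice. For random s, s' in V and a
   random function r on V, moving the first vertex of a face along the path s, s' (and
   matching the x-labels through r) gives a partial map of faces to triples; keep the
   faces whose image is a face. By Cauchy-Schwarz a positive proportion of octahedra
   survives, whereas unpopular stars and pairs of adjacent faces survive rarely. When
   eps is close to 1 the same fillings are available with proportions close to 1, so
   that fewer than two values of x' are possible. *)

(** * Counting and triangle patterns *)

(** The shape of the filling is dictated by a count of vertices. A triangulated disc with v vertices
    has v - 1 more edges than faces, so once [x] is given, v - 2 further labels can be expected to
    determine it. A filling of a fixed [D] gains one free label for each new vertex, and its 8, 11
    and 4 pieces add 3, 2 and 1 vertices each, 50 in all. The two counts agree only if the disc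
    keeps no vertex of [D] but the two ends of [x]. Different [x'] come with unrelated [D], so a
    vertex inherited from [D] would be a parameter of the disc that is not one of the filling; hence
    the replacement of edges and then of interior vertices. Unpopular configurations have to be
    rarer than the fillings that are left, which are themselves few. The thinning makes their
    proportion smaller than any prescribed [g] and pays for it in the threshold of popularity, which
    is [g] times a power of [eps], not in the density of what is kept. As [eps] tends to 1, so does
    [eps ^+ C]; there no constant factor may be lost, which rules out thinning and colouring. *)

Section Counting.

Variables (R : realFieldType) (W A : finType) (f : W -> A).

Lemma card_fibers (S : {set W}) :
  #|S| = (\sum_a #|[set w in S | f w == a]|)%N.
Proof.
rewrite -sum1_card (partition_big f predT) //=; apply: eq_bigr => a _.
by rewrite -sum1_card; apply: eq_bigl => w; rewrite inE.
Qed.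

Lemma card_le_fibers (S : {set W}) (B : {set A}) (b : R) :
  (forall w, w \in S -> f w \in B) ->
  (forall a, a \in B -> #|[set w in S | f w == a]|%:R <= b) ->
  #|S|%:R <= #|B|%:R * b.
Proof.
move=> fB hb; rewrite card_fibers natr_sum (bigID (mem B)) /=.
rewrite [X in _ + X]big1 ?addr0 => [|a naB].
  rewrite -sum1_card natr_sum mulr_suml.
  by apply: ler_sum => a aB; rewrite mul1r hb.
rewrite (_ : [set _ in _ | _] = set0) ?cards0 //.
apply/setP => w; rewrite !inE; apply/negP => /andP[/fB fwB /eqP fwa].
by rewrite -fwa fwB in naB.
Qed.

Lemma card_ge_fibers (S : {set W}) (B : {set A}) (b : R) :
  (forall a, a \in B -> b <= #|[set w in S | f w == a]|%:R) ->
  #|B|%:R * b <= #|S|%:R.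
Proof.
move=> hb; rewrite card_fibers natr_sum (bigID (mem B)) /=.
apply: (@le_trans _ _ (\sum_(a in B) #|[set w in S | f w == a]|%:R)).
  rewrite -sum1_card natr_sum mulr_suml.
  by apply: ler_sum => a aB; rewrite mul1r hb.
by rewrite lerDl sumr_ge0.
Qed.

(** Cauchy-Schwarz over the fibres of [f]: the pairs with equal image are counted by the sum of the
    squared fibre sizes. *)
Lemma card_sqr_le (S : {set W}) (B : {set A}) :
  (forall w, w \in S -> f w \in B) ->
  (#|S| ^ 2 <= #|B| *
     #|[set w : W * W | [&& w.1 \in S, w.2 \in S & f w.1 == f w.2]]|)%N.
Proof.
move=> fB; pose g a := #|[set w in S | f w == a]|.
have -> : #|S| = (\sum_(a in B) g a)%N.
  rewrite card_fibers (bigID (mem B)) /= [X in (_ + X)%N]big1 ?addn0 // => a naB.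
  apply/eqP; rewrite cards_eq0; apply/eqP/setP => w; rewrite !inE.
  by apply/negP => /andP[/fB fwB /eqP fwa]; rewrite -fwa fwB in naB.
have -> : #|[set w : W * W | [&& w.1 \in S, w.2 \in S & f w.1 == f w.2]]|
    = (\sum_(a in B) g a ^ 2)%N.
  rewrite -sum1_card (partition_big (fun w : W * W => f w.1) (mem B)) /=; last first.
    by move=> w; rewrite inE => /and3P[/fB].
  apply: eq_bigr => a aB; rewrite sum1_card -mulnn /g -cardsX.
  apply: eq_card => -[w w']; rewrite !inE unfold_in inE /=.
  case: (w \in S); case: (w' \in S) => //=; rewrite ?andbF //.
  by rewrite andbC; have [<-|//] := eqVneq (f w) a; rewrite eq_sym.
(* Twice the inequality is the sum of [2 * (g a * g b) <= g a ^ 2 + g b ^ 2] over all pairs [a],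
   [b]. *)
rewrite -(leq_pmul2l (ltn0Sn 1)) expnS expn1 big_distrl /= big_distrr /=.
have -> : (2 * (#|B| * \sum_(a in B) g a ^ 2) =
           \sum_(a in B) \sum_(b in B) (g a ^ 2 + g b ^ 2))%N.
  under [RHS]eq_bigr do rewrite big_split /= sum_nat_const.
  rewrite big_split /= sum_nat_const -big_distrr /=.
  by lia.
apply: leq_sum => a _; rewrite !big_distrr /=; apply: leq_sum => b _.
by rewrite (nat_Cauchy (g a) (g b)).
Qed.

End Counting.

Section Patterns.

Variables (V : finType) (v0 : V).

Definition rel3 := V -> V -> V -> bool.

Implicit Types (T : rel3) (P : seq (nat * nat * nat)) (l : nat -> V).

Definition sub3 T T' := forall x y z, T x y z -> T' x y z.

Definition partial_latin T : Prop :=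
  [/\ forall x y z z', T x y z -> T x y z' -> z = z',
      forall x y y' z, T x y z -> T x y' z -> y = y'
    & forall x x' y z, T x y z -> T x' y z -> x = x'].

(** [rotn 1] brings the y-edges to the first place and [rotn 2] the z-edges, so that edges and stars
    need to be treated for one class only. *)
Definition rot T : rel3 := fun a b c => T c a b.
Definition rotn r T : rel3 := iter r rot T.

Lemma partial_latin_rot T : partial_latin T -> partial_latin (rot T).
Proof. by case=> hz hy hx; split=> *; [apply: hx|apply: hz|apply: hy]; eassumption. Qed.

Lemma partial_latin_rotn r T : partial_latin T -> partial_latin (rotn r T).
Proof. by move=> hT; elim: r => //= r; apply: partial_latin_rot. Qed.

Lemma sub3_rotn r T T' : sub3 T T' -> sub3 (rotn r T) (rotn r T').
Proof. by move=> h; elim: r => //= r IH a b c; apply: IH. Qed.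

Lemma sub3_trans T' T T'' : sub3 T T' -> sub3 T' T'' -> sub3 T T''.
Proof. by move=> h h' x y z /h/h'. Qed.

Lemma partial_latin_sub T T' : sub3 T T' -> partial_latin T' -> partial_latin T.
Proof.
by move=> h [hz hy hx]; split=> *; [apply: hz|apply: hy|apply: hx];
  apply: h; eassumption.
Qed.

Lemma rotn_mod3 r T : rotn r T = rotn (r %% 3) T.
Proof.
rewrite {1}(divn_eq r 3) addnC /rotn iterD; congr (iter _ _ _).
by elim: (r %/ 3)%N => //= m IH; rewrite mulSn iterD IH.
Qed.

Lemma rotnD r r' T : rotn r (rotn r' T) = rotn (r + r') T.
Proof. by rewrite /rotn iterD. Qed.

(* A pattern is a list of triangles whose edges are named by numbers, and a
   labelling [l] of the edges satisfies it in [T] if it maps triangles to faces. *)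
Definition sat T P l := all (fun p => T (l p.1.1) (l p.1.2) (l p.2)) P.

Definition readl (s : seq V) i := nth v0 s i.

Definition rot_index r (p : nat * nat * nat) :=
  iter r (fun p => (p.2, p.1.1, p.1.2)) p.

(* The copy of a pattern for [rotn r T], with edge [i] renamed as [nth 0 m i],
   written as a pattern for [T]. *)
Definition place r P (m : seq nat) :=
  [seq rot_index r (nth 0%N m p.1.1, nth 0%N m p.1.2, nth 0%N m p.2) | p <- P].

Lemma sat_place T r P m l :
  sat T (place r P m) l = sat (rotn r T) P (fun i => l (nth 0%N m i)).
Proof.
rewrite /sat all_map; apply: eq_all => -[[i j] k] /=.
by elim: r T => // r IH T; rewrite /rotn iterSr -[RHS]IH.
Qed.

Lemma sat_sub T T' P l : sub3 T T' -> sat T P l -> sat T' P l.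
Proof. by move=> h; apply: sub_all => p; apply: h. Qed.

Lemma sat_cat T P P' l : sat T (P ++ P') l = sat T P l && sat T P' l.
Proof. exact: all_cat. Qed.

Definition pat_lt m P := all (fun p => [&& p.1.1 < m, p.1.2 < m & p.2 < m]%N) P.

Lemma sat_eq m T P l l' :
  pat_lt m P -> (forall i, (i < m)%N -> l i = l' i) -> sat T P l = sat T P l'.
Proof.
move=> hm hl; apply: eq_in_all => -[[i j] k] /(allP hm) /and3P[/= hi hj hk].
by rewrite !hl.
Qed.

(* The labels that are forced, two edges of a face determining the third. *)
Definition known (k : bitseq) i := nth false k i.
Definition add_known (k : bitseq) i := set_nth false k i true.
Definition learn k (p : nat * nat * nat) :=
  if (1 < known k p.1.1 + known k p.1.2 + known k p.2)%N
  then add_known (add_known (add_known k p.1.1) p.1.2) p.2 else k.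
Definition close P k := iter 20 (fun k => foldl learn k P) k.
Definition mark (s : seq nat) : bitseq := foldl add_known [::] s.
Definition determines P (s s' : seq nat) := all (known (close P (mark s))) s'.

Lemma knownD k i j : known (add_known k i) j = (i == j) || known k j.
Proof. by rewrite /known nth_set_nth /= eq_sym; case: eqP. Qed.

Lemma known_mark s i : known (mark s) i = (i \in s).
Proof.
rewrite /mark; suff H k : known (foldl add_known k s) i = (i \in s) || known k i.
  by rewrite H /known nth_nil orbF.
elim: s k => //= a s IH k; rewrite IH knownD inE eq_sym.
by rewrite orbA [(_ \in _) || _]orbC.
Qed.

(** Labellings that agree on [s] still agree after a face has forced its third label. Any number of
    rounds in [close] would be sound; 20 are enough for the checks made by computation. *)
Lemma determinesP T P s s' l l' :
    partial_latin T -> determines P s s' -> sat T P l -> sat T P l' ->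
    (forall i, i \in s -> l i = l' i) ->
  forall i, i \in s' -> l i = l' i.
Proof.
move=> [hz hy hx] /allP hd hl hl' hs i /hd.
have: forall j, known (mark s) j -> l j = l' j by move=> j; rewrite known_mark; apply: hs.
rewrite /close; elim: 20%N (mark s) i => [|m IH] k i hk; first exact: hk.
rewrite iterSr; apply: IH => {i hd m}.
elim: P k hl hl' hk => //= -[[a b] c] P IH k /andP[/= f hl] /andP[/= f' hl'] hk.
apply: IH => // j; rewrite /learn /=; case: ifP => [h|_]; last exact: hk.
have [ea [eb ec]] : l a = l' a /\ l b = l' b /\ l c = l' c.
  move: h; case ka: (known k a); case kb: (known k b); case kc: (known k c) => //= _;
  rewrite ?(hk _ ka) ?(hk _ kb) ?(hk _ kc) in f *; repeat split => //.
  - exact: hz f f'.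
  - exact: hy f f'.
  - exact: hx f f'.
by rewrite !knownD => /or4P[/eqP<-|/eqP<-|/eqP<-|/hk].
Qed.

Lemma card_tuple_inj (W : finType) (S : {set W}) k (g : W -> k.-tuple V) :
  {in S &, injective g} -> (#|S| <= #|V| ^ k)%N.
Proof.
by move=> /card_in_imset <-; rewrite -card_tuple -cardsT subset_leq_card ?subsetT.
Qed.

Lemma card_determined (W : finType) (S : {set W}) (rd : W -> nat -> V) T P K G I :
    partial_latin T -> determines P (K ++ G) I ->
    {in S, forall w, sat T P (rd w)} ->
    {in S &, forall w w' i, i \in K -> rd w i = rd w' i} ->
    {in S &, forall w w', (forall i, i \in I -> rd w i = rd w' i) -> w = w'} ->
  (#|S| <= #|V| ^ size G)%N.
Proof.
move=> hT hd hP hK hI.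
apply: (@card_tuple_inj _ _ _ (fun w => [tuple rd w (tnth (in_tuple G) i) | i < size G])).
move=> w w' wS w'S /= e; apply: (hI) => // i iI.
apply: (determinesP hT hd (hP _ wS) (hP _ w'S)) iI => j; rewrite mem_cat => /orP[].
  exact: hK.
move=> jG; have /seq_tnthP[q ->] := jG.
by have /(congr1 (fun t => tnth t q)) := e; rewrite !tnth_mktuple.
Qed.

End Patterns.

(** * The disc that fills a slit octahedron *)

Lemma card_ffun_ge (R : realFieldType) k (U : finType) (Q : 'I_k -> {set U}) (b : R) :
  0 <= b -> (forall t, b <= #|Q t|%:R) ->
  b ^+ k <= #|[set A : {ffun 'I_k -> U} | [forall t, A t \in Q t]]|%:R.
Proof.
move=> b0 hb.
have -> : #|[set A : {ffun 'I_k -> U} | [forall t, A t \in Q t]]| =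
    (\prod_(t < k) #|Q t|)%N.
  transitivity #|family (fun t => mem (Q t))|.
    by apply: eq_card => A; rewrite inE; apply/forallP/familyP.
  by rewrite card_family foldrE big_map enumT.
rewrite natr_prod -{1}(card_ord k) -prodr_const.
by apply: ler_prod => t _; rewrite b0 hb.
Qed.

(* Edges of an octahedron with vertices [a_i], [b_j], [c_k] (i, j, k = 0, 1),
   where x_ij = a_i b_j, y_jk = b_j c_k and z_ik = a_i c_k, in the order
   x00 y00 z00 x01 x10 x11 y01 y10 y11 z01 z10 z11. *)
Definition oct_pat : seq (nat * nat * nat) :=
  [:: (0, 1, 2); (0, 6, 9); (3, 7, 2); (3, 8, 9);
      (4, 1, 10); (4, 6, 11); (5, 7, 10); (5, 8, 11)]%N.

(* The octahedron minus the two faces at x00, in the order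
   x00 y00 z00 y01 z01 x01 x10 x11 y10 y11 z10 z11. *)
Definition pair_pat : seq (nat * nat * nat) :=
  [:: (5, 8, 2); (5, 9, 4); (6, 1, 10); (6, 3, 11); (7, 8, 10); (7, 9, 11)]%N.

(* Twelve faces around a vertex of type [a]: the edges at the vertex
   (x and z alternating), then the rim. *)
Definition star_pat : seq (nat * nat * nat) :=
  flatten [seq [:: (2 * i, 12 + 2 * i, 2 * i + 1);
                   ((2 * i + 2) %% 12, 13 + 2 * i, 2 * i + 1)] | i <- iota 0 6]%N.

(* Edges 0-12 are those of the slit octahedron, in the order x00 x01 x10 x11 x11'
   y00 y01 y10 y11 z00 z01 z10 z11; face 4i + 2j + k is a_i b_j c_k, and x11 splits
   into x11 (at c_0) and x11' (at c_1). Edges 13-84 come from an octahedron on each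
   of the eight faces. *)
Definition face_tab : seq (nat * nat * nat) :=
  [:: (0, 5, 9); (0, 6, 10); (1, 7, 9); (1, 8, 10);
      (2, 5, 11); (2, 6, 12); (3, 7, 11); (4, 8, 12)]%N.

(* For each of the edges x00 x01 x10 y00 .. y11 z00 .. z11: the rotation that makes
   it an x-edge, and the five labels of the two new faces at it. Edges 85-161 come
   from an octahedron on each of these pairs of faces. *)
Definition edge_tab : seq (nat * seq nat) :=
  [:: (0, [:: 0; 16; 19; 25; 28]); (0, [:: 1; 34; 37; 43; 46]);
      (0, [:: 2; 52; 55; 61; 64]); (1, [:: 5; 20; 14; 56; 50]);
      (1, [:: 6; 29; 23; 65; 59]); (1, [:: 7; 38; 32; 74; 68]);
      (1, [:: 8; 47; 41; 83; 77]); (2, [:: 9; 13; 17; 31; 35]);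
      (2, [:: 10; 22; 26; 40; 44]); (2, [:: 11; 49; 53; 67; 71]);
      (2, [:: 12; 58; 62; 76; 80])]%N.

(* The new stars at a_0, b_0, c_0, c_1. Edges 162-209 are those of new centres of
   their rims. *)
Definition star_tab : seq (nat * seq nat) :=
  [:: (0, [:: 85; 19; 13; 135; 31; 37; 92; 46; 40; 142; 22; 28;
              88; 18; 139; 140; 36; 95; 96; 45; 147; 146; 27; 89]);
      (1, [:: 106; 14; 16; 86; 25; 23; 113; 59; 61; 100; 52; 50;
              109; 21; 90; 91; 30; 116; 117; 66; 105; 104; 57; 110]);
      (2, [:: 134; 17; 20; 107; 56; 53; 148; 71; 74; 121; 38; 35;
              137; 15; 111; 112; 51; 151; 152; 69; 126; 125; 33; 138]);
      (2, [:: 141; 26; 29; 114; 65; 62; 155; 80; 83; 128; 47; 44;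
              144; 24; 118; 119; 60; 158; 159; 78; 133; 132; 42; 145])]%N.

(* Together with x11 these edges determine, through the new faces only, all edges
   of the final disc, including x11'. *)
Definition disc_gens : seq nat :=
  [:: 15; 21; 34; 42; 51; 54; 58; 66; 69; 70; 72; 79; 89; 95; 97; 98; 102; 103;
      104; 110; 111; 118; 119; 123; 124; 130; 143; 145; 146; 149; 151; 152; 156;
      159; 162; 165; 166; 172; 177; 180; 183; 186; 189; 191; 195; 197; 202; 204;
      206; 207]%N.

Definition ftab t := nth (0, 0, 0)%N face_tab t.
Definition fedges t := [:: (ftab t).1.1; (ftab t).1.2; (ftab t).2].
Definition etab e := nth (0%N, [::]) edge_tab e.
Definition stab v := nth (0%N, [::]) star_tab v.

Definition faces_pat :=
  flatten [seq place 0 (behead oct_pat) (fedges t ++ iota (13 + 9 * t) 9) | t <- iota 0 8].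
Definition edges_pat :=
  flatten [seq place (etab e).1 pair_pat ((etab e).2 ++ iota (85 + 7 * e) 7) | e <- iota 0 11].
Definition centres_pat :=
  flatten [seq place (stab v).1 star_pat (iota (162 + 12 * v) 12 ++ drop 12 (stab v).2)
          | v <- iota 0 4].
Definition disc_pat := faces_pat ++ edges_pat ++ centres_pat.

(* Adds an unknown edge of a face with one known edge until nothing is left to add. *)
Fixpoint gens_rec m (P : seq (nat * nat * nat)) (k : bitseq) : seq nat :=
  if m is m'.+1 then
    let k := foldl learn k P in
    if [seq p <- P | known k p.1.1 + known k p.1.2 + known k p.2 == 1]%N is p :: _ then
      let i := if known k p.1.1 then p.1.2 else p.1.1 in
      i :: gens_rec m' P (add_known k i)
    else [::]
  else [::].
Definition gens P s := gens_rec 40 P (mark s).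

(** The fillings of the eight faces have 24 free labels. Given its edge in [D], a pair of new faces
    uses 2 of them, which leaves 22. With the eleven pairs filled there are 46, of which a star uses
    12 and leaves 34. *)
Definition edge_gens e := gens faces_pat (iota 0 13 ++ (etab e).2).
Definition star_gens v := gens (faces_pat ++ edges_pat) (iota 0 13 ++ (stab v).2).

Lemma edge_gensP e : (e < 11)%N ->
  (size (edge_gens e) == 22%N) &&
  determines faces_pat ((iota 0 13 ++ (etab e).2) ++ edge_gens e) (iota 0 85).
Proof.
have /allP h : all (fun e => (size (edge_gens e) == 22%N) &&
    determines faces_pat ((iota 0 13 ++ (etab e).2) ++ edge_gens e) (iota 0 85))
    (iota 0 11) by vm_compute.
by move=> he; apply: h; rewrite mem_iota.
Qed.

Lemma star_gensP v : (v < 4)%N ->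
  (size (star_gens v) == 34%N) &&
  determines (faces_pat ++ edges_pat) ((iota 0 13 ++ (stab v).2) ++ star_gens v) (iota 0 162).
Proof.
have /allP h : all (fun v => (size (star_gens v) == 34%N) &&
    determines (faces_pat ++ edges_pat) ((iota 0 13 ++ (stab v).2) ++ star_gens v) (iota 0 162))
    (iota 0 4) by vm_compute.
by move=> hv; apply: h; rewrite mem_iota.
Qed.

(** Of the edges of [D] only x11 is given here, so that discs over different slit octahedra can be
    compared. *)
Lemma disc_gens_slit : determines disc_pat (3%N :: disc_gens) [:: 4%N].
Proof. by vm_compute. Qed.

Lemma disc_gens_all : determines disc_pat (iota 0 13 ++ disc_gens) (iota 0 210).
Proof. by vm_compute. Qed.

Lemma stars_in_disc v : (v < 4)%N ->
  all (mem (faces_pat ++ edges_pat)) (place (stab v).1 star_pat (stab v).2).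
Proof.
have /allP h : all (fun v => all (mem (faces_pat ++ edges_pat))
    (place (stab v).1 star_pat (stab v).2)) (iota 0 4) by vm_compute.
by move=> hv; apply: h; rewrite mem_iota.
Qed.

Lemma pairs_in_disc e : (e < 11)%N ->
  all (mem faces_pat) (place (etab e).1 [:: (0, 1, 2); (0, 3, 4)]%N (etab e).2).
Proof.
have /allP h : all (fun e => all (mem faces_pat)
    (place (etab e).1 [:: (0, 1, 2); (0, 3, 4)]%N (etab e).2)) (iota 0 11) by vm_compute.
by move=> hv; apply: h; rewrite mem_iota.
Qed.

Lemma fedges_lt t : (t < 8)%N -> all (fun i => i < 13)%N (fedges t).
Proof. by do 8![case: t => [//|t]]. Qed.

Lemma etab_lt e : (e < 11)%N ->
  (size (etab e).2 == 5%N) && all (fun i => i < 85)%N (etab e).2.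
Proof. by do 11![case: e => [//|e]]. Qed.

Lemma stab_lt v : (v < 4)%N ->
  (size (stab v).2 == 24%N) && all (fun i => i < 162)%N (stab v).2.
Proof. by do 4![case: v => [//|v]]. Qed.

Lemma card_setD_bigcup (R : realFieldType) k (W : finType) (S : {set W})
    (F : 'I_k -> {set W}) (b : R) :
  (forall i, #|F i|%:R <= b) ->
  #|S|%:R - k%:R * b <= #|S :\: \bigcup_i F i|%:R.
Proof.
move=> hb; rewrite -(cardsID (\bigcup_i F i) S) natrD.
rewrite addrAC gerDr subr_le0; apply: (@le_trans _ _ (\sum_i #|F i|%:R)).
  rewrite -natr_sum ler_nat; apply: (leq_trans (subset_leq_card (subsetIr _ _))).
  apply: (big_ind2 (fun (A : {set W}) n => (#|A| <= n)%N)); rewrite ?cards0 // => A m B n hA hB.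
  by apply: leq_trans (leq_add hA hB); rewrite cardsU leq_subr.
rewrite -[X in X%:R * b](card_ord k) mulr_natl -sumr_const.
exact: ler_sum.
Qed.

(** * Counting the fillings of a slit octahedron *)

Section Filling.

Variables (R : realFieldType) (V : finType) (v0 : V).

Implicit Types (T : rel3 V) (rd : nat -> V).

Local Notation N := (#|V|%:R : R).
Local Notation rdl := (readl v0).

Definition face_octs T x y z :=
  [set q : 9.-tuple V | sat T (behead oct_pat) (rdl (x :: y :: z :: q))].
Definition pair_octs T (p : seq V) :=
  [set q : 7.-tuple V | sat T pair_pat (rdl (p ++ q))].
Definition centres T (rim : seq V) :=
  [set q : 12.-tuple V | sat T star_pat (rdl (q ++ rim))].

Definition bad_pairs T T' (b : R) : {set 5.-tuple V} :=
  [set p : 5.-tuple V | sat T' [:: (0, 1, 2); (0, 3, 4)]%N (rdl p)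
    && (#|pair_octs T p|%:R < b * N ^+ 2)].
Definition bad_stars T T' (b : R) : {set 24.-tuple V} :=
  [set s : 24.-tuple V | sat T' star_pat (rdl s) && (#|centres T (drop 12 s)|%:R < b * N)].

Definition lab rd (m : seq nat) k : k.-tuple V := [tuple rd (nth 0%N m i) | i < k].

Lemma nth_lab rd m k i : (i < k)%N -> rdl (lab rd m k) i = rd (nth 0%N m i).
Proof. by move=> ik; rewrite /readl -[i]/(nat_of_ord (Ordinal ik)) -tnth_nth tnth_mktuple. Qed.

Lemma val_lab rd m k : size m = k -> lab rd m k = [seq rd i | i <- m] :> seq V.
Proof.
move=> sm; apply: (@eq_from_nth _ v0); first by rewrite size_tuple size_map sm.
by move=> i; rewrite size_tuple => ik; rewrite (nth_map 0%N) ?sm //; exact: nth_lab.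
Qed.

Lemma nth_labels rd m base k (q : seq V) :
    (forall j, (j < k)%N -> rd (base + j)%N = rdl q j) ->
  forall i, (i < size m + k)%N ->
    rd (nth 0%N (m ++ iota base k) i) = rdl ([seq rd j | j <- m] ++ q) i.
Proof.
move=> hq i hi; rewrite /readl !nth_cat size_map; case: ltnP => him.
  by rewrite (nth_map 0%N).
by rewrite nth_iota ?hq //; lia.
Qed.

Lemma nth_labels_rev rd m base k (q : k.-tuple V) :
    (forall j, (j < k)%N -> rd (base + j)%N = rdl q j) ->
  forall i, (i < k + size m)%N ->
    rd (nth 0%N (iota base k ++ m) i) = rdl (q ++ [seq rd j | j <- m]) i.
Proof.
move=> hq i hi; rewrite /readl !nth_cat size_iota size_tuple; case: ltnP => him.
  by rewrite nth_iota // hq.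
by rewrite (nth_map 0%N) //; lia.
Qed.

Lemma sat_flatten T F k l :
  sat T (flatten [seq F t | t <- iota 0 k]) l = [forall t : 'I_k, sat T (F t) l].
Proof.
apply/idP/forallP => [|h].
  move=> /allP h t; apply/allP => p hp; apply: h; apply/flatten_mapP.
  by exists (t : nat) => //; rewrite mem_iota /= add0n.
apply/allP => p /flatten_mapP[t]; rewrite mem_iota => ht.
exact: (allP (h (Ordinal ht))).
Qed.

Local Notation fillA := {ffun 'I_8 -> 9.-tuple V}.
Local Notation fillB := {ffun 'I_11 -> 7.-tuple V}.
Local Notation fillC := {ffun 'I_4 -> 12.-tuple V}.

Definition rdA (D : seq V) (A : fillA) i :=
  if (i < 13)%N then rdl D i else rdl (A (inord ((i - 13) %/ 9))) ((i - 13) %% 9)%N.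
Definition rdB D A (B : fillB) i :=
  if (i < 85)%N then rdA D A i else rdl (B (inord ((i - 85) %/ 7))) ((i - 85) %% 7)%N.
Definition rdC D A B (C : fillC) i :=
  if (i < 162)%N then rdB D A B i else rdl (C (inord ((i - 162) %/ 12))) ((i - 162) %% 12)%N.

Lemma rdA_slot D A (t : 'I_8) j : (j < 9)%N -> rdA D A (13 + 9 * t + j) = rdl (A t) j.
Proof.
move=> hj; rewrite /rdA (_ : (13 + 9 * t + j < 13)%N = false); last by lia.
have -> : (13 + 9 * t + j - 13 = t * 9 + j)%N by lia.
by rewrite divnMDl // modnMDl divn_small // modn_small // addn0 inord_val.
Qed.

Lemma rdB_slot D A B (t : 'I_11) j : (j < 7)%N -> rdB D A B (85 + 7 * t + j) = rdl (B t) j.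
Proof.
move=> hj; rewrite /rdB (_ : (85 + 7 * t + j < 85)%N = false); last by lia.
have -> : (85 + 7 * t + j - 85 = t * 7 + j)%N by lia.
by rewrite divnMDl // modnMDl divn_small // modn_small // addn0 inord_val.
Qed.

Lemma rdC_slot D A B C (t : 'I_4) j : (j < 12)%N ->
  rdC D A B C (162 + 12 * t + j) = rdl (C t) j.
Proof.
move=> hj; rewrite /rdC (_ : (162 + 12 * t + j < 162)%N = false); last by lia.
have -> : (162 + 12 * t + j - 162 = t * 12 + j)%N by lia.
by rewrite divnMDl // modnMDl divn_small // modn_small // addn0 inord_val.
Qed.

Lemma rdA_inj D A A' :
  (forall i, i \in iota 0 85 -> rdA D A i = rdA D A' i) -> A = A'.
Proof.
move=> h; apply/ffunP => t; apply: (@eq_from_tnth) => j; rewrite !(tnth_nth v0).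
rewrite -[LHS](@rdA_slot D A t j) // -[RHS](@rdA_slot D A' t j) //; apply: h.
by rewrite mem_iota; have := ltn_ord t; have := ltn_ord j; lia.
Qed.

Lemma rdB_inj D A B A' B' :
  (forall i, i \in iota 0 162 -> rdB D A B i = rdB D A' B' i) -> (A, B) = (A', B').
Proof.
move=> h; congr pair.
  apply: (@rdA_inj D) => i hi; have := h i; rewrite /rdB !mem_iota /= add0n in hi *.
  by rewrite hi; apply; lia.
apply/ffunP => t; apply: (@eq_from_tnth) => j; rewrite !(tnth_nth v0).
rewrite -[LHS](@rdB_slot D A B t j) // -[RHS](@rdB_slot D A' B' t j) //; apply: h.
by rewrite mem_iota; have := ltn_ord t; have := ltn_ord j; lia.
Qed.

Lemma rdC_inj D A B C A' B' C' :
  (forall i, i \in iota 0 210 -> rdC D A B C i = rdC D A' B' C' i) ->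
  (A, B, C) = (A', B', C').
Proof.
move=> h; congr pair.
  apply: (@rdB_inj D) => i hi; have := h i; rewrite /rdC !mem_iota /= add0n in hi *.
  by rewrite hi; apply; lia.
apply/ffunP => t; apply: (@eq_from_tnth) => j; rewrite !(tnth_nth v0).
rewrite -[LHS](@rdC_slot D A B C t j) // -[RHS](@rdC_slot D A' B' C' t j) //; apply: h.
by rewrite mem_iota; have := ltn_ord t; have := ltn_ord j; lia.
Qed.

Lemma faces_pat_lt : pat_lt 85 faces_pat.
Proof. by vm_compute. Qed.

Lemma edges_pat_lt : pat_lt 162 edges_pat.
Proof. by vm_compute. Qed.

(** The three steps use larger and larger relations: octahedra on the faces lie in [Tb], those on
    the pairs in [Ta], the new centres in [T0]. The numbers [c], [db], [da] are thresholds of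
    popularity, [e1] and [ea] bound the exceptions. *)
Variables (T0 Ta Tb L : rel3 V) (c db da e1 ea : R).

Definition fill1 (D : seq V) : {set fillA} :=
  [set A : fillA | [forall t : 'I_8, A t \in
    face_octs Tb (rdl D (ftab t).1.1) (rdl D (ftab t).1.2) (rdl D (ftab t).2)]].

Definition bad1 D (e : 'I_11) : {set fillA} :=
  [set A in fill1 D | lab (rdA D A) (etab e).2 5 \in
    bad_pairs (rotn (etab e).1 Ta) (rotn (etab e).1 Tb) db].

Definition good1 D := fill1 D :\: \bigcup_e bad1 D e.

Definition fill2 D : {set fillA * fillB} :=
  [set w : fillA * fillB | (w.1 \in good1 D) && [forall e : 'I_11, w.2 e \in
    pair_octs (rotn (etab e).1 Ta) (lab (rdA D w.1) (etab e).2 5)]].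

Definition bad2 D (v : 'I_4) : {set fillA * fillB} :=
  [set w in fill2 D | lab (rdB D w.1 w.2) (stab v).2 24 \in
    bad_stars (rotn (stab v).1 T0) (rotn (stab v).1 Ta) da].

Definition good2 D := fill2 D :\: \bigcup_v bad2 D v.

Definition fill3 D : {set fillA * fillB * fillC} :=
  [set w : fillA * fillB * fillC | (w.1 \in good2 D) && [forall v : 'I_4, w.2 v \in
    centres (rotn (stab v).1 T0) (drop 12 (lab (rdB D w.1.1 w.1.2) (stab v).2 24))]].

Hypotheses (T0l : partial_latin T0) (sab : sub3 Ta T0) (sbc : sub3 Tb Ta).

Lemma sat_fill1 D A : A \in fill1 D -> sat Tb faces_pat (rdA D A).
Proof.
rewrite inE => /forallP h; rewrite sat_flatten; apply/forallP => t.
rewrite sat_place; have := h t; rewrite inE; apply: etrans; symmetry.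
apply: (@sat_eq _ 12) => // i hi; rewrite (@nth_labels _ _ _ _ (A t)) // => [|j hj]; last by rewrite rdA_slot.
rewrite -[[:: _, _, _ & _]]/([seq rdl D j | j <- fedges t] ++ A t).
congr (rdl (_ ++ _) _); have /allP hf := fedges_lt (ltn_ord t).
by apply/eq_in_map => j /hf hj; rewrite /rdA hj.
Qed.

Lemma sat_fill2 D w : w \in fill2 D -> sat Ta (faces_pat ++ edges_pat) (rdB D w.1 w.2).
Proof.
case: w => A B; rewrite inE => /andP[/setDP[/sat_fill1 h1 _] /forallP h].
rewrite sat_cat; apply/andP; split.
  have := sat_sub sbc h1; apply: etrans; apply: (sat_eq _ faces_pat_lt) => i hi.
  by rewrite /rdB hi.
rewrite sat_flatten; apply/forallP => e.
have /andP[/eqP se /allP he] := etab_lt (ltn_ord e).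
rewrite sat_place; have := h e; rewrite inE; apply: etrans; symmetry.
apply: (@sat_eq _ 12) => // i hi; rewrite (@nth_labels _ _ _ _ (B e)) ?se // => [|j hj]; last by rewrite rdB_slot.
congr (rdl (_ ++ _) _); rewrite val_lab //.
by apply/eq_in_map => j /he hj; rewrite /rdB hj.
Qed.

Lemma sat_fill3 D w : w \in fill3 D -> sat T0 disc_pat (rdC D w.1.1 w.1.2 w.2).
Proof.
case: w => [[A B] C]; rewrite inE => /andP[/setDP[/sat_fill2 h1 _] /forallP h].
rewrite /disc_pat catA sat_cat; apply/andP; split.
  have := sat_sub sab h1; apply: etrans; apply: (@sat_eq _ 162) => [|i hi].
    by vm_compute.
  by rewrite /rdC hi.
rewrite sat_flatten; apply/forallP => v.
have /andP[/eqP sv /allP hv] := stab_lt (ltn_ord v).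
rewrite sat_place; have := h v; rewrite inE; apply: etrans; symmetry.
apply: (@sat_eq _ 24); first by vm_compute.
move=> i hi; rewrite (@nth_labels_rev _ _ _ 12 (C v)) ?size_drop ?sv // => [|j hj]; last by rewrite rdC_slot.
congr (rdl (_ ++ _) _); rewrite val_lab // -map_drop.
by apply/eq_in_map => j /mem_drop /hv hj; rewrite /rdC hj.
Qed.


Lemma nth_mem_lab rd rd' m k i : size m = k -> lab rd m k = lab rd' m k ->
  i \in m -> rd i = rd' i.
Proof.
move=> sm e im; have hi : (index i m < k)%N by rewrite -sm index_mem.
by rewrite -(nth_index 0%N im) -!(nth_lab _ _ hi) e.
Qed.

Hypotheses (c0 : 0 <= c) (db0 : 0 <= db) (da0 : 0 <= da).
Hypothesis octs_ge : forall x y z, L x y z -> c * N ^+ 3 <= #|face_octs Tb x y z|%:R.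
Hypothesis bad_pairs_le : forall r x y z, rotn r L x y z ->
  #|[set p in bad_pairs (rotn r Ta) (rotn r Tb) db | rdl p 0 == x]|%:R <= e1 * N ^+ 2.
Hypothesis bad_stars_le : forall r,
  #|bad_stars (rotn r T0) (rotn r Ta) da|%:R <= ea * N ^+ 12.

Lemma TaP : partial_latin Ta. Proof. exact: partial_latin_sub sab T0l. Qed.
Lemma TbP : partial_latin Tb. Proof. exact: partial_latin_sub sbc TaP. Qed.

Lemma card_fill1 D : sat L face_tab (rdl D) -> (c * N ^+ 3) ^+ 8 <= #|fill1 D|%:R.
Proof.
move=> /allP hD; apply: card_ffun_ge => [|t].
  by rewrite mulr_ge0 ?exprn_ge0 ?ler0n.
apply: octs_ge; apply: (hD (ftab t)); exact: mem_nth.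
Qed.

Lemma edge_in_L D (e : 'I_11) : sat L face_tab (rdl D) ->
  exists y z, rotn (etab e).1 L (rdl D (nth 0%N (etab e).2 0)) y z.
Proof.
have /allP h : all (fun e => has (fun q : nat * nat => rot_index (etab e).1
    (nth 0%N (etab e).2 0, q.1, q.2) \in face_tab)
    [seq (a, b) | a <- iota 0 13, b <- iota 0 13]) (iota 0 11) by vm_compute.
have /h/hasP[[a b] _ hab] : (e : nat) \in iota 0 11 by rewrite mem_iota ltn_ord.
move=> /allP /(_ _ hab) hL; exists (rdl D a), (rdl D b).
have := @sat_place _ L (etab e).1 [:: (0, 1, 2)]%N [:: nth 0%N (etab e).2 0; a; b] (rdl D).
rewrite /sat /= !andbT => <-. exact: hL.
Qed.

Lemma card_bad1 D e : sat L face_tab (rdl D) -> #|bad1 D e|%:R <= e1 * N ^+ 24.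
Proof.
move=> hD; have [y [z /bad_pairs_le hb]] := edge_in_L e hD.
have /andP[/eqP sG hG] := edge_gensP (ltn_ord e).
have /andP[/eqP se /allP he] := etab_lt (ltn_ord e).
have he0 : (nth 0%N (etab e).2 0 < 13)%N.
  suff /allP : all (fun e => nth 0%N (etab e).2 0 < 13)%N (iota 0 11).
    by apply; rewrite mem_iota ltn_ord.
  by vm_compute.
rewrite -[24%N]/(2 + 22)%N exprD mulrA.
pose f A := lab (rdA D A) (etab e).2 5.
apply: (le_trans (@card_le_fibers R _ _ f (bad1 D e) _ (N ^+ 22) _ _) _); last first.
- by apply: ler_wpM2r hb; rewrite exprn_ge0 ?ler0n.
- move=> p _; rewrite -natrX ler_nat -sG.
  apply: (@card_determined _ _ _ (rdA D) Tb _ _ _ _ TbP hG).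
  + by move=> A; rewrite !inE => /andP[/andP[h _] _]; apply: sat_fill1; rewrite inE.
  + move=> A A'; rewrite !inE => /andP[_ /eqP hA] /andP[_ /eqP hA'] i.
    rewrite mem_cat => /orP[|]; first by rewrite mem_iota /= /rdA => ->.
    by apply: (nth_mem_lab se); rewrite -/(f A) hA.
  + by move=> A A' _ _; apply: rdA_inj.
- by move=> A /setIdP[_ hA]; apply/setIdP; split=> //; rewrite nth_lab // /rdA he0.
Qed.

Lemma card_good1 D : sat L face_tab (rdl D) ->
  (c ^+ 8 - 11%:R * e1) * N ^+ 24 <= #|good1 D|%:R.
Proof.
move=> hD; apply: le_trans (card_setD_bigcup _ (fun e => card_bad1 e hD)).
have := card_fill1 hD; rewrite exprMn -exprM /=.
by move: (_%:R) => a h; rewrite mulrBl mulrA lerB.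
Qed.

Lemma card_fill2 D : sat L face_tab (rdl D) ->
  (c ^+ 8 - 11%:R * e1) * db ^+ 11 * N ^+ 46 <= #|fill2 D|%:R.
Proof.
move=> hD; apply: (@le_trans _ _ (#|good1 D|%:R * (db * N ^+ 2) ^+ 11)).
  rewrite exprMn -exprM -[46%N]/(24 + 2 * 11)%N exprD mulrACA.
  by apply: ler_wpM2r (card_good1 hD); rewrite mulr_ge0 ?exprn_ge0 ?ler0n.
apply: (@card_ge_fibers _ _ _ fst) => A hA.
apply: (@le_trans _ _ #|[set B : fillB | [forall e : 'I_11, B e \in
    pair_octs (rotn (etab e).1 Ta) (lab (rdA D A) (etab e).2 5)]]|%:R).
  apply: card_ffun_ge => [|e]; first by rewrite mulr_ge0 ?exprn_ge0 ?ler0n.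
  have /setDP[hA1 hA2] := hA; rewrite leNgt; apply: contra hA2 => hlt.
  apply/bigcupP; exists e => //; rewrite inE hA1 inE hlt andbT.
  have /allP hs := sat_fill1 hA1; have /allP he := pairs_in_disc (ltn_ord e).
  have : sat Tb (place (etab e).1 [:: (0, 1, 2); (0, 3, 4)]%N (etab e).2) (rdA D A).
    by apply/allP => p /he /hs.
  rewrite sat_place; apply: etrans; apply: (@sat_eq _ 5) => // i hi.
  by rewrite nth_lab.
rewrite ler_nat -(card_imset _ (fun B B' (e : (A, B) = (A, B')) => congr1 snd e : B = B')).
apply: subset_leq_card; apply/subsetP => w /imsetP[B]; rewrite inE => hB ->.
by rewrite in_set eqxx andbT /fill2 in_set; apply/andP.
Qed.

(** No edge of a star belongs to [D], so its 12 free labels are free in the filling as well and a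
    global bound on bad stars suffices. The pairs in [bad1] contain a fixed edge of [D]; this is why
    bad pairs have to be bounded for each edge separately. *)
Lemma card_bad2 D v : #|bad2 D v|%:R <= ea * N ^+ 46.
Proof.
have /andP[/eqP sG hG] := star_gensP (ltn_ord v).
have /andP[/eqP sv /allP hv] := stab_lt (ltn_ord v).
rewrite -[46%N]/(12 + 34)%N exprD mulrA.
pose f w := lab (rdB D w.1 w.2) (stab v).2 24.
apply: (le_trans (@card_le_fibers R _ _ f (bad2 D v) _ (N ^+ 34) _ _) _); last first.
- by apply: ler_wpM2r (bad_stars_le (stab v).1); rewrite exprn_ge0 ?ler0n.
- move=> p _; rewrite -natrX ler_nat -sG.
  apply: (@card_determined _ _ _ (fun w => rdB D w.1 w.2) Ta _ _ _ _ TaP hG).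
  + by move=> w; rewrite inE => /andP[/setIdP[h _] _]; apply: sat_fill2.
  + move=> w w'; rewrite !inE => /andP[_ /eqP hw] /andP[_ /eqP hw'] i.
    rewrite mem_cat => /orP[|]; last by apply: (nth_mem_lab sv); rewrite -/(f w) hw.
    rewrite mem_iota /= add0n /rdB /rdA => hi; rewrite hi.
    by rewrite (ltn_trans hi).
  + by move=> [A B] [A' B'] _ _; apply: rdB_inj.
- by move=> w /setIdP[].
Qed.

Lemma card_good2 D : sat L face_tab (rdl D) ->
  ((c ^+ 8 - 11%:R * e1) * db ^+ 11 - 4%:R * ea) * N ^+ 46 <= #|good2 D|%:R.
Proof.
move=> hD; apply: le_trans (card_setD_bigcup _ (card_bad2 D)).
by rewrite mulrBl -[4%:R * ea * _]mulrA lerB // card_fill2.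
Qed.

Lemma card_fill3 D : sat L face_tab (rdl D) ->
  ((c ^+ 8 - 11%:R * e1) * db ^+ 11 - 4%:R * ea) * da ^+ 4 * N ^+ 50 <= #|fill3 D|%:R.
Proof.
move=> hD; apply: (@le_trans _ _ (#|good2 D|%:R * (da * N) ^+ 4)).
  rewrite exprMn -[50%N]/(46 + 4)%N exprD mulrACA.
  by apply: ler_wpM2r (card_good2 hD); rewrite mulr_ge0 ?exprn_ge0 ?ler0n.
apply: (@card_ge_fibers _ _ _ fst) => AB hAB.
apply: (@le_trans _ _ #|[set C : fillC | [forall v : 'I_4, C v \in
    centres (rotn (stab v).1 T0) (drop 12 (lab (rdB D AB.1 AB.2) (stab v).2 24))]]|%:R).
  apply: card_ffun_ge => [|v]; first by rewrite mulr_ge0 ?ler0n.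
  have /setDP[hA1 hA2] := hAB; rewrite leNgt; apply: contra hA2 => hlt.
  apply/bigcupP; exists v => //; rewrite inE hA1 inE hlt andbT.
  have /allP hs := sat_fill2 hA1; have /allP he := stars_in_disc (ltn_ord v).
  have : sat Ta (place (stab v).1 star_pat (stab v).2) (rdB D AB.1 AB.2).
    by apply/allP => p /he /hs.
  rewrite sat_place; apply: etrans; apply: (@sat_eq _ 24); first by vm_compute.
  by move=> i hi; rewrite nth_lab.
rewrite ler_nat -(card_imset _ (fun B B' (e : (AB, B) = (AB, B')) => congr1 snd e : B = B')).
apply: subset_leq_card; apply/subsetP => w /imsetP[B]; rewrite inE => hB ->.
by rewrite in_set eqxx andbT /fill3 in_set; apply/andP.
Qed.

(* The slit octahedra through [x] carry disjoint families of fillings, each a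
   positive proportion of the possible values of the fifty generators. *)
Lemma card_slit (x : V) (S : {set V}) : (0 < #|V|)%N ->
    (forall x', x' \in S -> exists D : 13.-tuple V,
       [/\ sat L face_tab (rdl D), rdl D 3 = x & rdl D 4 = x']) ->
  #|S|%:R * (((c ^+ 8 - 11%:R * e1) * db ^+ 11 - 4%:R * ea) * da ^+ 4) <= 1.
Proof.
move=> V0 hS; set kap := (X in _ * X <= _).
(* One slit octahedron is fixed for each [x'], so that a disc which reveals [x'] also reveals the
   labels of the edges 0 to 12. *)
have /fin_all_exists [D hD] (x' : V) : exists D : 13.-tuple V, x' \in S ->
    [/\ sat L face_tab (rdl D), rdl D 3 = x & rdl D 4 = x'].
  have [/hS[D hD]|_] := boolP (x' \in S); first by exists D.
  by exists [tuple v0 | i < 13].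
pose W := [set w : V * (fillA * fillB * fillC) | (w.1 \in S) && (w.2 \in fill3 (D w.1))].
have NV : 0 < N ^+ 50 by rewrite exprn_gt0 ?ltr0n.
have lo : #|S|%:R * (kap * N ^+ 50) <= #|W|%:R.
  apply: (@card_ge_fibers _ _ _ fst) => x' hx'.
  have [h1 _ _] := hD _ hx'; apply: (le_trans (card_fill3 h1)).
  rewrite ler_nat -(card_imset _ (fun B B' (e : (x', B) = (x', B')) => congr1 snd e : B = B')).
  apply: subset_leq_card; apply/subsetP => w /imsetP[B] hB ->.
  by rewrite in_set eqxx andbT /W in_set; apply/andP.
have up : (#|W| <= #|V| ^ 50)%N.
  pose rd (w : V * (fillA * fillB * fillC)) := rdC (D w.1) w.2.1.1 w.2.1.2 w.2.2.
  apply: (@card_tuple_inj _ _ _ _ (fun w => lab (rd w) disc_gens 50)) => w w' /=.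
  rewrite ![_ \in W]in_set => /andP[wS hw] /andP[wS' hw'] eg.
  have gen i : i \in disc_gens -> rd w i = rd w' i by apply: nth_mem_lab eg.
  have [h1 hx h1'] := hD _ wS; have [h2 hx' h2'] := hD _ wS'.
  have e1' : w.1 = w'.1.
    rewrite -h1' -h2'.
    apply: (@determinesP _ T0 _ _ _ (rd w) (rd w') T0l disc_gens_slit) 4%N _ => //.
    - exact: sat_fill3.
    - exact: sat_fill3.
    - by move=> i; rewrite inE => /orP[/eqP->|/gen //]; exact: etrans hx (esym hx').
  case: w w' e1' wS wS' hw hw' gen {h1 h2 hx hx' h1' h2' eg} => [a [[A B] C]] [a' [[A' B'] C']] /= <-.
  move=> _ _ hw hw' gen; congr pair; apply: (@rdC_inj (D a)).
  apply: (determinesP T0l disc_gens_all (sat_fill3 hw) (sat_fill3 hw')) => i.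
  rewrite mem_cat => /orP[|/gen //]; rewrite mem_iota /= add0n => hi.
  by rewrite /rdC /rdB /rdA hi !(ltn_trans hi).
rewrite -(ler_pM2r NV) mul1r -mulrA; apply: (le_trans lo).
by rewrite -natrX ler_nat.
Qed.

End Filling.

(** * Random thinning *)

Section Stars4.

Variables (R : realFieldType) (V : finType) (v0 : V) (T : rel3 V).
Hypothesis TP : partial_latin T.

Local Notation N := (#|V|%:R : R).
Local Notation rdl := (readl v0).

Definition completions Q (rim : seq V) := [set q : 4.-tuple V | sat T Q (rdl (rim ++ q))].

Lemma card_extend m (S : {set m.-tuple V}) (S' : {set (m + 4).-tuple V})
    (rim : m.-tuple V -> seq V) Q (b : R) :
    (forall u (q : 4.-tuple V), u \in S -> q \in completions Q (rim u) ->
       cat_tuple u q \in S') ->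
    (forall u, u \in S -> b <= #|completions Q (rim u)|%:R) ->
  #|S|%:R * b <= #|S'|%:R.
Proof.
move=> hS' hb; pose f (w : (m + 4).-tuple V) : m.-tuple V := [tuple rdl w i | i < m].
have fK u (q : 4.-tuple V) : f (cat_tuple u q) = u.
  apply: eq_from_tnth => i; rewrite tnth_mktuple (tnth_nth v0) /readl /=.
  by rewrite nth_cat size_tuple ltn_ord.
apply: (@card_ge_fibers R _ _ f) => u uS; apply: (le_trans (hb u uS)).
rewrite ler_nat; have inj : injective (fun q : 4.-tuple V => cat_tuple u q).
  move=> q q' /(congr1 val) /= /eqP; rewrite eqseq_cat // eqxx => /eqP.
  exact: val_inj.
rewrite -(card_imset _ inj); apply: subset_leq_card; apply/subsetP => _ /imsetP[q hq ->].
by rewrite inE fK eqxx andbT hS'.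
Qed.

Definition sub_pat (P : seq (nat * nat * nat)) (s : seq nat) :=
  [seq p <- P | [&& p.1.1 \in s, p.1.2 \in s & p.2 \in s]].

(* Removing the vertex with edges [q] leaves [rest], generated by [G]; the removed
   vertex is one of at most [b] completions of its rim. *)
Lemma card_unpopular m P Q (rim q rest G : seq nat) (b : R) :
    0 <= b -> determines (sub_pat P rest) G rest ->
    determines P (rest ++ q) (iota 0 m) ->
    all (mem P) (place 0 Q (rim ++ q)) -> pat_lt 8 Q ->
    all (mem rest) rim -> size rim = 4%N -> size q = 4%N ->
  #|[set w : m.-tuple V | sat T P (rdl w) &&
      (#|completions Q (lab (rdl w) rim 4)|%:R < b)]|%:R <= N ^+ size G * b.
Proof.
move=> b0 hG hq hQ hQ8 hrim srim sq; set S := [set w | _].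
pose f (w : m.-tuple V) := lab (rdl w) rest (size rest).
pose rd (u : (size rest).-tuple V) i := rdl u (index i rest).
have rdf w i : i \in rest -> rd (f w) i = rdl w i.
  by move=> hi; rewrite /rd nth_lab ?index_mem // nth_index.
apply: (le_trans (@card_le_fibers R _ _ f S (f @: S) b _ _)).
- by move=> w wS; rewrite imset_f.
- move=> _ /imsetP[w1 w1S ->]; have := w1S; rewrite inE => /andP[_ /ltW]; apply: le_trans.
  rewrite ler_nat; pose g (w : m.-tuple V) := lab (rdl w) q 4.
  rewrite -(@card_in_imset _ _ g).
    apply: subset_leq_card; apply/subsetP => _ /imsetP[w /setIdP[wS /eqP fw] ->].
    have /allP hw : sat T P (rdl w) by move: wS; rewrite inE => /andP[].
    rewrite inE; have : sat T (place 0 Q (rim ++ q)) (rdl w).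
      by apply/allP => p /(allP hQ) /hw.
    rewrite sat_place; apply: etrans; apply: (sat_eq _ hQ8) => i hi.
    symmetry; rewrite [RHS]/readl !nth_cat size_tuple srim; case: ltnP => hi4; rewrite -[RHS]/(rdl _ _).
    + have hr : nth 0%N rim i \in rest by apply: (allP hrim); rewrite mem_nth ?srim.
      by rewrite nth_lab // -rdf // fw rdf.
    + by rewrite nth_lab //; lia.
  move=> w w'; rewrite !inE => /andP[/andP[sw _] /eqP fw] /andP[/andP[sw' _] /eqP fw'] eg.
  apply: eq_from_tnth => i; rewrite !(tnth_nth v0).
  have : (i : nat) \in iota 0 m by rewrite mem_iota ltn_ord.
  apply: (determinesP TP hq sw sw') => j; rewrite mem_cat => /orP[jr|].
    by rewrite -rdf // fw -fw' rdf.
  exact: nth_mem_lab eg.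
- apply: ler_wpM2r => //; rewrite -natrX ler_nat.
  apply: (@card_determined _ _ _ rd T (sub_pat P rest) [::] G rest) => //.
  + move=> _ /imsetP[w /setIdP[/allP hw _] ->].
    apply/allP => p; rewrite mem_filter => /andP[/and3P[h1 h2 h3] hp].
    by rewrite !rdf // hw.
  + move=> _ _ /imsetP[w _ ->] /imsetP[w' _ ->] e.
    apply: eq_from_tnth => i; rewrite !tnth_mktuple.
    by have := e _ (mem_nth 0%N (ltn_ord i)); rewrite !rdf ?mem_nth.
Qed.


Lemma lab_cat m k (u : m.-tuple V) (q : seq V) idx : size idx = k -> all (fun i => i < m)%N idx ->
  lab (rdl (u ++ q)) idx k = lab (rdl u) idx k.
Proof.
move=> si /allP hi; apply: eq_from_tnth => i; rewrite !tnth_mktuple /readl nth_cat size_tuple.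
by rewrite hi // mem_nth // si.
Qed.

Lemma sat_extend m (u : m.-tuple V) (q : 4.-tuple V) P Q rim :
    pat_lt m P -> pat_lt 8 Q -> size rim = 4%N -> all (fun i => i < m)%N rim ->
    sat T P (rdl u) -> q \in completions Q (lab (rdl u) rim 4) ->
  sat T (P ++ place 0 Q (rim ++ iota m 4)) (rdl (u ++ q)).
Proof.
move=> hP hQ sr hr hs; rewrite inE => hq; rewrite sat_cat; apply/andP; split.
  move: hs; apply: etrans; apply: (sat_eq _ hP) => i hi.
  by rewrite /readl nth_cat size_tuple hi.
rewrite sat_place; move: hq; apply: etrans; apply: (sat_eq _ hQ) => i hi.
rewrite (@nth_labels _ v0 _ _ _ 4 q) ?sr //; last first.
  by move=> j hj; rewrite /readl nth_cat size_tuple ltnNge leq_addr /= addKn.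
by rewrite -(@val_lab _ v0 _ _ _ sr) lab_cat.
Qed.

Lemma card_le_setU3 (W : finType) (A B C D : {set W}) :
  A \subset B :|: C :|: D -> #|A|%:R <= #|B|%:R + #|C|%:R + #|D|%:R :> R.
Proof.
move=> /subset_leq_card h; rewrite -!natrD ler_nat; apply: (leq_trans h).
apply: (leq_trans (leq_card_setU _ _)); rewrite leq_add2r.
exact: leq_card_setU.
Qed.

(* Centres of a rim y00 y01 y10 y11, resp. z00 z01 z10 z11, resp. x00 x10 x01 x11:
   the rim comes first, then the four edges at the centre. *)
Definition ypat : seq (nat * nat * nat) := [:: (4, 0, 6); (4, 1, 7); (5, 2, 6); (5, 3, 7)]%N.
Definition zpat : seq (nat * nat * nat) := [:: (4, 6, 0); (4, 7, 1); (5, 6, 2); (5, 7, 3)]%N.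
Definition xpat : seq (nat * nat * nat) := [:: (0, 4, 6); (1, 4, 7); (2, 5, 6); (3, 5, 7)]%N.
Definition yrim := [:: 1; 6; 7; 8]%N.
Definition zrim := [:: 2; 9; 10; 11]%N.
Definition xrim0 := [:: 0; 4; 12; 13]%N.
Definition xrim1 := [:: 3; 5; 12; 13]%N.

(* An octahedron with a third centre of its z-rim (edges 12-15), and new centres of
   the two x-rims through it (edges 16-19 and 20-23). *)
Definition apex_pat := oct_pat ++ place 0 zpat (zrim ++ iota 12 4).
Definition cfg_pat := (apex_pat ++ place 0 xpat (xrim0 ++ iota 16 4))
  ++ place 0 xpat (xrim1 ++ iota 20 4).

Definition octs := [set o : 12.-tuple V | sat T oct_pat (rdl o)].
Definition popular Q idx (b : R) (w : seq V) :=
  b <= #|completions Q (lab (rdl w) idx 4)|%:R.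
Definition configs (b : R) :=
  [set w : 24.-tuple V | sat T cfg_pat (rdl w) && popular ypat yrim b w].

Variable eps : R.
Hypothesis (eps_gt0 : 0 < eps) (octs_ge : eps * N ^+ 5 <= #|octs|%:R).

Let th := eps / 4%:R.
Let th' := eps ^+ 2 / 32%:R.

Let th_ge0 : 0 <= th. Proof. by rewrite divr_ge0 ?ltW ?ler0n. Qed.
Let th'_ge0 : 0 <= th'. Proof. by rewrite divr_ge0 ?exprn_ge0 ?ltW ?ler0n. Qed.

(** An octahedron has 5 free labels, each of the three added centres one more. Unpopular y-rims and
    z-rims cost [eps / 4] each, which leaves [eps / 2]; the third centre brings this to
    [eps ^+ 2 / 8], of which unpopular x-rims take half; the last two centres contribute the factor
    [th' ^+ 2]. *)
Lemma card_configs : eps ^+ 6 / 2%:R ^+ 14 * N ^+ 8 <= #|configs (th * N)|%:R.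
Proof.
have N0 : 0 <= N by rewrite ler0n.
have thN : 0 <= th * N by exact: mulr_ge0.
have thN' : 0 <= th' * N by exact: mulr_ge0.
pose C1 := [set o in octs | popular ypat yrim (th * N) o && popular zpat zrim (th * N) o].
pose unpop m P Q idx (b : R) := [set w : m.-tuple V | sat T P (rdl w) &&
      (#|completions Q (lab (rdl w) idx 4)|%:R < b)].
have hC1 : eps / 2%:R * N ^+ 5 <= #|C1|%:R.
  have hsub : octs \subset C1 :|: unpop 12%N oct_pat ypat yrim (th * N)
                           :|: unpop 12%N oct_pat zpat zrim (th * N).
    apply/subsetP => o ho; rewrite [_ \in _ :|: _]in_setU [_ \in _ :|: _]in_setU.
    rewrite [_ \in C1]in_set ho [_ \in unpop _ _ ypat _ _]in_set.
    rewrite [_ \in unpop _ _ zpat _ _]in_set.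
    rewrite !ltNge -!/(popular _ _ _ o); move: ho; rewrite inE => ->.
    by case: (popular ypat _ _ _); case: (popular zpat _ _ _).
  have hy : #|unpop 12%N oct_pat ypat yrim (th * N)|%:R <= N ^+ 4 * (th * N).
    by apply: (@card_unpopular 12 oct_pat ypat yrim [:: 4; 5; 10; 11]%N
      [:: 0; 1; 2; 3; 6; 7; 8; 9]%N [:: 1; 6; 7; 9]%N) => //.
  have hz : #|unpop 12%N oct_pat zpat zrim (th * N)|%:R <= N ^+ 4 * (th * N).
    by apply: (@card_unpopular 12 oct_pat zpat zrim [:: 3; 5; 7; 8]%N
      [:: 0; 1; 2; 4; 6; 9; 10; 11]%N [:: 2; 4; 6; 10]%N) => //.
  have := card_le_setU3 hsub; move: octs_ge hy hz; rewrite /th exprSr.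
  move: (N ^+ 4) (#|C1|%:R) (#|unpop _ _ ypat _ _|%:R) (#|unpop _ _ zpat _ _|%:R).
  by move=> M a b c; lra.
pose S2 := [set w : 16.-tuple V | sat T apex_pat (rdl w) && popular ypat yrim (th * N) w].
have hS2 : #|C1|%:R * (th * N) <= #|S2|%:R.
  apply: (@card_extend 12 _ _ (fun o => lab (rdl o) zrim 4) zpat) => [u q|u].
    rewrite 2!inE => /andP[hu /andP[hy _]] hq; rewrite inE /popular lab_cat //.
    by rewrite -/(popular _ _ _ u) hy andbT sat_extend.
  by rewrite inE => /and3P[].
pose S3 := [set w in S2 | popular xpat xrim0 (th' * N) w && popular xpat xrim1 (th' * N) w].
have hS3 : #|S2|%:R - 2%:R * th' * N ^+ 6 <= #|S3|%:R.
  have hsub : S2 \subset S3 :|: unpop 16%N apex_pat xpat xrim0 (th' * N)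
                           :|: unpop 16%N apex_pat xpat xrim1 (th' * N).
    apply/subsetP => o ho; rewrite [_ \in _ :|: _]in_setU [_ \in _ :|: _]in_setU.
    rewrite [_ \in S3]in_set ho [_ \in unpop _ _ _ xrim0 _]in_set.
    rewrite [_ \in unpop _ _ _ xrim1 _]in_set.
    rewrite !ltNge -!/(popular _ _ _ o); move: ho; rewrite inE => /andP[-> _].
    by case: (popular _ xrim0 _ _); case: (popular _ xrim1 _ _).
  have hx0 : #|unpop 16%N apex_pat xpat xrim0 (th' * N)|%:R <= N ^+ 5 * (th' * N).
    by apply: (@card_unpopular 16 apex_pat xpat xrim0 [:: 1; 14; 2; 10]%N
      [:: 0; 3; 4; 5; 6; 8; 9; 11; 12; 13; 15]%N [:: 4; 8; 9; 11; 15]%N) => //.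
  have hx1 : #|unpop 16%N apex_pat xpat xrim1 (th' * N)|%:R <= N ^+ 5 * (th' * N).
    by apply: (@card_unpopular 16 apex_pat xpat xrim1 [:: 7; 14; 2; 10]%N
      [:: 0; 3; 4; 5; 6; 8; 9; 11; 12; 13; 15]%N [:: 3; 5; 6; 8; 15]%N) => //.
  have := card_le_setU3 hsub; move: hx0 hx1; rewrite [N ^+ 6]exprSr.
  move: (N ^+ 5) (#|S2|%:R) (#|S3|%:R) (#|unpop _ _ _ xrim0 _|%:R) (#|unpop _ _ _ xrim1 _|%:R).
  by move=> M a b c d; lra.
pose S4 := [set w : 20.-tuple V | [&& sat T (apex_pat ++ place 0 xpat (xrim0 ++ iota 16 4)) (rdl w),
   popular ypat yrim (th * N) w & popular xpat xrim1 (th' * N) w]].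
have hS4 : #|S3|%:R * (th' * N) <= #|S4|%:R.
  apply: (@card_extend 16 _ _ (fun o => lab (rdl o) xrim0 4) xpat) => [u q|u]; last first.
    by case/setIdP=> _ /andP[].
  case/setIdP => /setIdP[hu hy] /andP[_ hx1] hq; rewrite inE /popular !lab_cat //.
  by rewrite -!/(popular _ _ _ u) hy hx1 !andbT sat_extend.
have hS5 : #|S4|%:R * (th' * N) <= #|configs (th * N)|%:R.
  apply: (@card_extend 20 _ _ (fun o => lab (rdl o) xrim1 4) xpat) => [u q|u]; last first.
    by rewrite inE => /and3P[].
  rewrite inE => /and3P[hu hy hx1] hq; rewrite inE /popular !lab_cat //.
  by rewrite -!/(popular _ _ _ u) hy andbT sat_extend.
apply: le_trans hS5.
apply: (@le_trans _ _ ((#|C1|%:R * (th * N) - 2%:R * th' * N ^+ 6) * (th' * N) * (th' * N))).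
  have -> : eps ^+ 6 / 2%:R ^+ 14 * N ^+ 8 =
      (eps / 2%:R * N ^+ 5 * (th * N) - 2%:R * th' * N ^+ 6) * (th' * N) * (th' * N).
    by rewrite /th /th'; field.
  by do 2!(apply: ler_wpM2r; first by []); rewrite lerB // ler_wpM2r.
apply: ler_wpM2r => //.
apply: le_trans hS4; apply: ler_wpM2r => //.
by apply: le_trans hS3; rewrite lerB.
Qed.

End Stars4.

Lemma card_ffun_fix (V : finType) (v0 : V) (A B : seq V) : uniq A -> size B = size A ->
  (#|[set r : {ffun V -> V} | [seq r x | x <- A] == B]| * #|V| ^ size A = #|{ffun V -> V}|)%N.
Proof.
move=> uA sB; rewrite card_ffun.
have -> : #|[set r : {ffun V -> V} | [seq r x | x <- A] == B]| =
    #|family (fun x => if x \in A then pred1 (nth v0 B (index x A)) else predT)|.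
  apply: eq_card => r; rewrite inE; apply/eqP/familyP => [<- x|h].
    case: ifP => // xA; rewrite inE; apply/eqP.
    by rewrite (nth_map v0) ?index_mem // nth_index.
  apply: (@eq_from_nth _ v0); rewrite size_map // => i hi.
  have := h (nth v0 A i); rewrite mem_nth // inE index_uniq // => /eqP <-.
  by rewrite (nth_map v0).
rewrite card_family foldrE big_map big_enum /= (bigID (mem A)) /=.
rewrite big1 => [|x ->]; last by rewrite card1.
rewrite mul1n (eq_bigr (fun=> #|V|)) => [|x /negbTE ->]; last by apply: eq_card.
rewrite prod_nat_const -expnD; congr (_ ^ _)%N.
by rewrite -(card_uniqP uA) addnC cardC.
Qed.

(** * Octahedra, stars and pairs under a random move *)

Section Thinning.

Variables (R : realFieldType) (V : finType) (v0 : V) (T : rel3 V).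
Hypothesis TP : partial_latin T.
Hypothesis V_gt0 : (0 < #|V|)%N.

Local Notation N := (#|V|%:R : R).
Local Notation rdl := (readl v0).
Local Notation octs := (octs v0).
Local Notation configs := (configs v0 T).

Let N_gt0 : 0 < N. Proof. by rewrite ltr0n. Qed.

Lemma card_octs_le T' : partial_latin T' -> #|octs T'|%:R <= N ^+ 5.
Proof.
move=> hT'; rewrite -natrX ler_nat.
apply: (@card_determined V _ _ (fun o : 12.-tuple V => rdl o) T' oct_pat [::] [:: 0; 6; 8; 10; 11]%N (iota 0 12)) => //.
  by move=> o; rewrite inE.
move=> o o' _ _ h; apply: eq_from_tnth => i; rewrite !(tnth_nth v0).
by apply: h; rewrite mem_iota ltn_ord.
Qed.

Definition keyidx := yrim ++ [:: 12; 13]%N.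
Definition key (w : 24.-tuple V) := lab (rdl w) keyidx 6.

Definition config_pairs (b : R) : {set 24.-tuple V * 24.-tuple V} :=
  [set w | [&& w.1 \in configs b, w.2 \in configs b & key w.1 == key w.2]].

(** Since the y-rims in [configs] are popular, at most [N ^+ 5 / b] keys occur instead of [N ^+ 6].
    Cauchy-Schwarz over the keys then gives the full order [N ^+ 11]. *)
Lemma card_config_pairs (b c : R) : 0 < b -> 0 <= c ->
  c * N ^+ 8 <= #|configs (b * N)|%:R ->
  b * c ^+ 2 * N ^+ 11 <= #|config_pairs (b * N)|%:R.
Proof.
move=> b0 c0 hc; pose B := [set k : 6.-tuple V | popular v0 T ypat (iota 0 4) (b * N) k].
pose S' := [set u : 10.-tuple V | sat T (place 0 ypat (iota 0 4 ++ iota 6 4)) (rdl u)].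
have hB : #|B|%:R * (b * N) <= N ^+ 6.
  apply: (@le_trans _ _ #|S'|%:R).
    apply: (@card_extend R V v0 T 6 _ _ (fun u => lab (rdl u) (iota 0 4) 4) ypat) => [u q _ hq|u].
      by rewrite in_set; apply: (@sat_extend V v0 T 6 u q [::] ypat (iota 0 4)).
    by rewrite inE.
  rewrite -natrX ler_nat.
  apply: (@card_determined V _ _ (fun u : 10.-tuple V => rdl u) T
    (place 0 ypat (iota 0 4 ++ iota 6 4)) [::] (iota 4 6) (iota 0 10)) => //.
    by move=> u; rewrite inE.
  move=> o o' _ _ h; apply: eq_from_tnth => i; rewrite !(tnth_nth v0).
  by apply: h; rewrite mem_iota ltn_ord.
have hk w : w \in configs (b * N) -> key w \in B.
  rewrite !inE => /andP[_]; rewrite /popular.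
  rewrite (_ : lab (rdl (key w)) (iota 0 4) 4 = lab (rdl w) yrim 4) //.
  apply: eq_from_tnth => i; rewrite !tnth_mktuple nth_iota // nth_lab ?(leq_trans (ltn_ord i)) //.
  by rewrite /keyidx nth_cat ltn_ord.
have := @card_sqr_le _ _ key (configs (b * N)) B hk.
rewrite -(ler_nat R) natrM natrX -/(config_pairs _) => h.
have N6 : 0 < N ^+ 6 by rewrite exprn_gt0.
move: (ler0n R #|config_pairs (b * N)|) hc hB h.
move: (#|config_pairs _|%:R) (#|configs _|%:R) (#|B|%:R) => p m q p0 hc hB h.
rewrite -(ler_pM2r N6) [p * _]mulrC; apply: le_trans (ler_wpM2r p0 hB).
have bN : 0 <= b * N by rewrite mulr_ge0 ?ltW.
rewrite [q * _ * p]mulrAC; apply: le_trans (ler_wpM2r bN h).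
have -> : b * c ^+ 2 * N ^+ 11 * N ^+ 6 = (c * N ^+ 8) ^+ 2 * (b * N) by ring.
apply: ler_wpM2r => //.
have cN : 0 <= c * N ^+ 8 by rewrite mulr_ge0 // exprn_ge0 // ltW.
by rewrite lerXn2r // nnegrE // (le_trans cN).
Qed.

Definition rd2 (w : 24.-tuple V * 24.-tuple V) i :=
  if (i < 24)%N then rdl w.1 i else rdl w.2 (i - 24).

(** The second configuration is numbered from 24 on, except for the key, which it shares with the
    first. *)
Definition ren i := if i \in keyidx then i else (24 + i)%N.

(* Coincidences among the x-edges 0, 3 of the two configurations, with edges that
   generate the pair once the coincidence holds. *)
Definition degen_tab : seq (nat * nat * seq nat) :=
  [:: (0, 3, [:: 7; 8; 9; 12; 18; 19; 21; 33; 42; 45]);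
      (0, 24, [:: 3; 6; 14; 16; 23; 33; 35; 39; 43; 44]);
      (0, 27, [:: 1; 6; 7; 19; 22; 26; 34; 38; 42; 44]);
      (3, 24, [:: 3; 6; 17; 21; 22; 26; 29; 34; 43; 47]);
      (3, 27, [:: 6; 7; 9; 15; 18; 21; 26; 34; 41; 47]);
      (24, 27, [:: 3; 12; 14; 17; 21; 24; 28; 33; 42; 47])]%N.
Definition dtab i := nth (0, 0, [::])%N degen_tab i.

Definition sbst a b (i : nat) := if i == b then a else i.
Definition degen_pat a b :=
  place 0 cfg_pat [seq sbst a b i | i <- iota 0 24] ++
  place 0 cfg_pat [seq sbst a b (ren i) | i <- iota 0 24].

Lemma degen_gensP k : (k < 6)%N -> let: (a, b, G) := dtab k in
  (size G == 10%N) && determines (degen_pat a b) G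
    [seq sbst a b i | i <- iota 0 24 ++ [seq ren i | i <- iota 0 24]].
Proof. by do 6![case: k => [|k]; first by vm_compute]. Qed.

Lemma rd2_key w i : key w.1 = key w.2 -> (i < 24)%N -> rd2 w (ren i) = rdl w.2 i.
Proof.
move=> hk hi; rewrite /ren; case: ifP => hik; rewrite /rd2.
  by rewrite hi; apply: (nth_mem_lab v0 _ hk).
by rewrite (_ : (24 + i < 24)%N = false) ?addKn //; lia.
Qed.

Lemma card_degen b (k : 'I_6) :
  #|[set w in config_pairs b | rd2 w (dtab k).1.1 == rd2 w (dtab k).1.2]|%:R <= N ^+ 10.
Proof.
have := degen_gensP (ltn_ord k); case: (dtab k) => [[a c] G] /andP[/eqP sG hG] /=.
rewrite -natrX ler_nat -[X in (_ <= _ ^ X)%N]sG.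
have hs w i : rd2 w a = rd2 w c -> rd2 w (sbst a c i) = rd2 w i.
  by move=> e; rewrite /sbst; case: eqP => // ->.
apply: (@card_determined V _ _ rd2 T _ [::] G _ TP hG) => //.
  move=> w /setIdP[]; rewrite inE => /and3P[/setIdP[h1 _] /setIdP[h2 _] /eqP hk] /eqP e.
  rewrite sat_cat !sat_place; apply/andP; split.
    move: h1; apply: etrans; apply: (@sat_eq _ 24) => // i hi.
    by rewrite (nth_map 0%N) ?size_iota // nth_iota // hs // /rd2 hi.
  move: h2; apply: etrans; apply: (@sat_eq _ 24) => // i hi.
  by rewrite (nth_map 0%N) ?size_iota // nth_iota // hs // rd2_key.
move=> w w' /setIdP[]; rewrite inE => /and3P[_ _ /eqP hk] /eqP e.
move=> /setIdP[]; rewrite inE => /and3P[_ _ /eqP hk'] /eqP e' h.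
have h1 i : i \in iota 0 24 ++ [seq ren i | i <- iota 0 24] -> rd2 w i = rd2 w' i.
  by move=> hi; rewrite -(hs w) // -(hs w') //; apply: h; apply: map_f.
rewrite [w]surjective_pairing [w']surjective_pairing; congr pair.
  apply: eq_from_tnth => i; rewrite !(tnth_nth v0); have := h1 i.
  by rewrite /rd2 ltn_ord; apply; rewrite mem_cat mem_iota ltn_ord.
apply: eq_from_tnth => i; rewrite !(tnth_nth v0) -!/(rdl _ _) -!rd2_key //.
apply: h1; rewrite mem_cat; apply/orP; right; apply: map_f.
by rewrite mem_iota ltn_ord.
Qed.

Definition xs w := [:: rd2 w 0; rd2 w 3; rd2 w 24; rd2 w 27].
Definition rs w := [:: rd2 w 16; rd2 w 20; rd2 w 40; rd2 w 44].

(** At four distinct x-edges a random function takes four prescribed values with probability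
    [N ^- 4]. *)
Definition nondegen b := [set w in config_pairs b | uniq (xs w)].

Lemma card_nondegen b : #|config_pairs b|%:R - 6%:R * N ^+ 10 <= #|nondegen b|%:R.
Proof.
apply: (le_trans (card_setD_bigcup _ (card_degen b))); rewrite ler_nat.
apply/subset_leq_card/subsetP => w /setDP[hw hd]; apply/setIdP; split=> //.
have ne (k : 'I_6) : rd2 w (dtab k).1.1 != rd2 w (dtab k).1.2.
  by apply: contra hd => e; apply/bigcupP; exists k => //; apply/setIdP.
have := (ne (inord 0), ne (inord 1), ne (inord 2), ne (inord 3), ne (inord 4), ne (inord 5)).
rewrite !inordK //= => -[[[[[h0 h1] h2] h3] h4] h5].
by rewrite !inE !negb_or h0 h1 h2 h3 h4 h5.
Qed.


Local Notation choices := (V * V * {ffun V -> V})%type.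
Implicit Types om : choices.

(* Labels x y z s s' r | x' z' p z1 z1' p1: moving the vertex [a] of the face along
   the path s, s' takes z to z' and, as seen through the edge r, takes x to x'. *)
Definition thin_pat : seq (nat * nat * nat) :=
  [:: (0, 1, 2); (3, 8, 2); (4, 8, 7); (6, 1, 7);
      (0, 5, 9); (3, 11, 9); (4, 11, 10); (6, 5, 10)]%N.

(** The eight triangles of [thin_pat] form an octahedron on the face x y z, in which [om] prescribes
    the edges s, s' and r. *)
Definition thin_lab om x y z (q : 6.-tuple V) :=
  rdl [:: x, y, z, om.1.1, om.1.2, om.2 x & q].

(* The random subcomplex: for random s, s' and a random function r, keep the faces
   whose image under the move is a face. *)
Definition thin om : rel3 V := fun x y z =>
  [exists q : 6.-tuple V, sat T thin_pat (thin_lab om x y z q)].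

Lemma thin_sub om : sub3 (thin om) T.
Proof. by move=> x y z /existsP[q /andP[]]. Qed.

(** On kept faces x' depends on x alone, through [om.2 x] and the path, and z' on z alone. Hence
    kept faces with a common edge have images with a common edge. The default values do not occur
    for edges of kept faces. *)
Definition xhat om x := odflt x [pick a |
  [exists y, exists z, exists q : 6.-tuple V,
    sat T thin_pat (thin_lab om x y z q) && (rdl q 0 == a)]].
Definition zhat om z := odflt z [pick a |
  [exists x, exists y, exists q : 6.-tuple V,
    sat T thin_pat (thin_lab om x y z q) && (rdl q 1 == a)]].

Lemma thin_hat om x y z : thin om x y z -> exists q : 6.-tuple V,
  [/\ sat T thin_pat (thin_lab om x y z q), rdl q 0 = xhat om x & rdl q 1 = zhat om z].
Proof.
case/existsP=> q hq; exists q; split=> //.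
- rewrite /xhat; case: pickP => [a|/(_ (rdl q 0))/idP[]]; last first.
    by apply/existsP; exists y; apply/existsP; exists z; apply/existsP; exists q; rewrite hq eqxx.
  case/existsP=> y' /existsP[z' /existsP[q' /andP[hq' /eqP <-]]] /=.
  apply: (@determinesP V T [:: (0, 5, 9); (3, 11, 9); (4, 11, 10); (6, 5, 10)]%N [:: 0; 3; 4; 5]%N [:: 6%N]
    (thin_lab om x y z q) (thin_lab om x y' z' q') TP _ _ _ _ 6%N) => //.
  + by case/and5P: hq => _ _ _ _.
  + by case/and5P: hq' => _ _ _ _.
  + by move=> i; rewrite !inE => /or4P[] /eqP ->.
- rewrite /zhat; case: pickP => [a|/(_ (rdl q 1))/idP[]]; last first.
    by apply/existsP; exists x; apply/existsP; exists y; apply/existsP; exists q; rewrite hq eqxx.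
  case/existsP=> x' /existsP[y' /existsP[q' /andP[hq' /eqP <-]]] /=.
  apply: (@determinesP V T [:: (3, 8, 2); (4, 8, 7)]%N [:: 2; 3; 4]%N [:: 7%N]
    (thin_lab om x y z q) (thin_lab om x' y' z q') TP _ _ _ _ 7%N) => //.
  + by case/and4P: hq => _ h1 h2 _; rewrite /sat /= h1 h2.
  + by case/and4P: hq' => _ h1 h2 _; rewrite /sat /= h1 h2.
  + by move=> i; rewrite !inE => /or3P[] /eqP ->.
Qed.

Lemma thin_move om x y z : thin om x y z -> T (xhat om x) y (zhat om z).
Proof. by case/thin_hat=> q [/and5P[_ _ _ h _] <- <-]. Qed.

Local Notation F := (#|{ffun V -> V}|%:R : R).

(** The images of the edges at the vertex form another centre of the same rim. This centre, [om.2]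
    and the edge p1 of one of the moves force s and s'. As there are [N ^+ 2 * F] choices, a star
    survives with probability at most its number of centres over [N]. *)
Lemma card_thin_star (s : 24.-tuple V) :
  #|[set om | sat (thin om) star_pat (rdl s)]|%:R
    <= #|centres v0 T (drop 12 s)|%:R * (N * F).
Proof.
pose f om : 12.-tuple V :=
  [tuple (if odd i then zhat om (rdl s i) else xhat om (rdl s i)) | i < 12].
apply: (@card_le_fibers R _ _ f) => [om|].
  rewrite !inE => /allP hs; apply/allP => p hp.
  have /allP /(_ p hp) /and5P[h1 h2 h3 h4 h5] : all (fun p => [&& ~~ odd p.1.1, p.1.1 < 12, 12 <= p.1.2,
    odd p.2 & p.2 < 12]%N) star_pat by vm_compute.
  have := thin_move (hs p hp); rewrite /readl !nth_cat !size_tuple h2 h5 ltnNge h3 /= nth_drop subnKC //.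
  by rewrite -!/(rdl _ _) /readl -!(@tnth_nth 12 _ v0 (f om) (Ordinal _)) ?tnth_mktuple /= (negbTE h1) h4.
move=> u hu.
have hst om : sat (thin om) star_pat (rdl s) -> thin om (rdl s 0) (rdl s 12) (rdl s 1).
  by move=> /allP h; apply: (h (0, 12, 1)%N).
have /fin_all_exists[g hg] om : exists p1 : V, sat (thin om) star_pat (rdl s) ->
    exists q : 6.-tuple V, [/\ sat T thin_pat (thin_lab om (rdl s 0) (rdl s 12) (rdl s 1) q),
      rdl q 0 = xhat om (rdl s 0) & rdl q 5 = p1].
  have [h|_] := boolP (sat (thin om) star_pat (rdl s)); last by exists v0.
  by have [q [h1 h2 h3]] := thin_hat (hst _ h); exists (rdl q 5) => _; exists q.
have hinj : {in [set om in [set om | sat (thin om) star_pat (rdl s)] | f om == u] &,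
    injective (fun om => (g om, om.2))}.
  move=> om om'; rewrite !inE => /andP[/hg[q [h1 h2 h3]] /eqP hf] /andP[/hg[q' [h1' h2' h3']] /eqP hf'].
  move=> [eg er]; have ex : xhat om (rdl s 0) = xhat om' (rdl s 0).
    by have := congr1 (fun t => tnth t ord0) (etrans hf (esym hf')); rewrite !tnth_mktuple.
  have hd i : i \in [:: 3; 4]%N -> thin_lab om (rdl s 0) (rdl s 12) (rdl s 1) q i =
      thin_lab om' (rdl s 0) (rdl s 12) (rdl s 1) q' i.
    apply: (@determinesP V T thin_pat [:: 0; 5; 6; 11]%N [:: 3; 4]%N) => // {}i.
    rewrite !inE => /or4P[] /eqP -> //.
    - by rewrite /thin_lab /readl /= er.
    - by rewrite -[LHS]/(rdl q 0) h2 ex -h2'.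
    - by rewrite -[LHS]/(rdl q 5) h3 eg -h3'.
  case: om om' hd er {hf hf' h1 h2 h3 h1' h2' h3' eg ex} => [[a b] r] [[a' b'] r'] hd /= ->.
  by have := hd 3%N isT; have := hd 4%N isT; rewrite /thin_lab /readl /= => -> ->.
rewrite -natrM ler_nat -card_prod -(card_in_imset hinj).
by rewrite -cardsT subset_leq_card ?subsetT.
Qed.

(** The moves of two kept faces with a common x share s, s' and x', and make up an octahedron minus
    the pair. As s and s' are among its edges, only [om.2] remains free. *)
Lemma card_thin_pair (p : 5.-tuple V) :
  #|[set om | sat (thin om) [:: (0, 1, 2); (0, 3, 4)]%N (rdl p)]|%:R
    <= #|pair_octs v0 T p|%:R * F.
Proof.
have /fin_all_exists[f hf] om : exists u : 7.-tuple V,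
    sat (thin om) [:: (0, 1, 2); (0, 3, 4)]%N (rdl p) ->
    [/\ u \in pair_octs v0 T p, rdl u 0 = om.1.1 & rdl u 2 = om.1.2].
  have [h|_] := boolP (sat _ _ _); last by exists [tuple v0 | i < 7].
  have /and3P[/thin_hat[q [h1 h2 h3]] /thin_hat[q' [h1' h2' h3']] _] := h.
  exists [tuple om.1.1; xhat om (rdl p 0); om.1.2; rdl q 2; rdl q' 2;
            zhat om (rdl p 2); zhat om (rdl p 4)] => _; split=> //.
  rewrite inE -h3 -h3'.
  have /and5P[_ a1 a2 a3 _] := h1; have /and5P[_ b1 b2 b3 _] := h1'.
  move: p h h1 h2 h3 h1' h2' h3' a1 a2 a3 b1 b2 b3.
  case=> [[|x [|y [|z [|y' [|z' [|? ?]]]]]]] //= sp h h1 h2 h3 h1' h2' h3' a1 a2 a3 b1 b2 b3.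
  rewrite /sat /= -{1}h2 -h2'.
  by move: a1 a2 a3 b1 b2 b3; rewrite /thin_lab /readl /= => -> -> -> -> -> ->.
apply: (@card_le_fibers R _ _ f) => [om|u hu]; first by rewrite inE => /hf[].
rewrite ler_nat.
have hinj : {in [set om in [set om | sat (thin om) [:: (0, 1, 2); (0, 3, 4)]%N (rdl p)] | f om == u] &,
    injective (fun om => om.2)}.
  move=> om om'; rewrite !inE => /andP[/hf[_ h1 h2] /eqP e] /andP[/hf[_ h1' h2'] /eqP e'] /= er.
  rewrite e in h1 h2; rewrite e' in h1' h2'.
  by case: om om' h1 h2 h1' h2' er {e e'} => [[a b] r] [[a' b'] r'] /= <- <- <- <- ->.
by rewrite -(card_in_imset hinj) -[X in (_ <= X)%N]cardsT subset_leq_card ?subsetT.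
Qed.


(** The vertices a_0 of the two configurations become the two apices over their common y-rim. *)
Definition oct_of_pair w : 12.-tuple V := lab (rd2 w) [:: 0; 1; 2; 3; 24; 27; 6; 7; 8; 9; 26; 33]%N 12.

(** A configuration testifies that the four faces at its a_0 are kept: a_1 is the moved vertex, the
    third centre of the z-rim carries s and s', and the new centres of the x-rims supply the two
    values of r. *)
Lemma thin_face om (w : 24.-tuple V) i j : sat T cfg_pat (rdl w) ->
    om.1 = (rdl w 12, rdl w 13) -> om.2 (rdl w 0) = rdl w 16 -> om.2 (rdl w 3) = rdl w 20 ->
  thin om (rdl w (if i then 3 else 0)%N)
    (rdl w (if i then (if j then 8 else 7) else (if j then 6 else 1))%N)
    (rdl w (if j then 9 else 2)%N).
Proof.
move=> hw h1 h2 h3; apply/existsP.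
pose m := [seq (if i then c.1 else c.2) | c <-
   [:: (3, 0); (if j then (8, 6) else (7, 1)); (if j then (9, 9) else (2, 2));
       (12, 12); (13, 13); (20, 16); (5, 4); (if j then (11, 11) else (10, 10));
       (if j then (15, 15) else (14, 14)); (22, 18); (23, 19); (21, 17)]]%N.
exists (lab (rdl w) (drop 6 m) 6).
have : sat T (place 0 thin_pat m) (rdl w).
  apply/allP => p hp; apply: (allP hw); move: p hp; apply/allP.
  by rewrite /m; case: (i); case: (j); vm_compute.
rewrite sat_place; apply: etrans; apply: (@sat_eq _ 12) => // k hk.
rewrite /thin_lab h1.
have hr : om.2 (rdl w (if i then 3 else 0)%N) = rdl w (if i then 20 else 16)%N by case: (i).
rewrite hr; do 6?[case: k hk => [_|k hk]; first by rewrite /m; case: (i); case: (j)].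
rewrite /readl /= -/(rdl _ k) nth_lab ?ltnS //.
Qed.


Lemma sum_octs_thin b :
  #|nondegen b|%:R * F <= N ^+ 4 * (\sum_om #|octs (thin om)|)%:R.
Proof.
pose Tri := [set u : choices * 12.-tuple V | sat (thin u.1) oct_pat (rdl u.2)].
have -> : (\sum_om #|octs (thin om)| = #|Tri|)%N.
  rewrite (card_fibers fst Tri); apply: eq_bigr => om _.
  have inj : injective (fun o : 12.-tuple V => (om, o)) by move=> o o' [].
  rewrite -(card_imset _ inj); apply: eq_card => -[om' o]; rewrite !inE /=.
  apply/imsetP/andP => [[o' ho [-> ->]]|[ho /eqP <-]]; first by rewrite inE in ho.
  by exists o; rewrite ?inE.
pose Z := [set u : (24.-tuple V * 24.-tuple V) * {ffun V -> V} |
   (u.1 \in nondegen b) && ([seq u.2 x | x <- xs u.1] == rs u.1)].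
have hZ : #|nondegen b|%:R * (F / N ^+ 4) <= #|Z|%:R.
  apply: (@card_ge_fibers R _ _ fst) => w hw; have /setIdP[_ uw] := hw.
  have := card_ffun_fix v0 uw (erefl : size (rs w) = size (xs w)).
  rewrite [size _]/= => /(congr1 (fun n => n%:R : R)); rewrite natrM natrX => <-.
  rewrite mulfK ?expf_neq0 ?gt_eqF // ler_nat.
  have inj : injective (fun r : {ffun V -> V} => (w, r)) by move=> r r' [].
  rewrite -(card_imset _ inj); apply/subset_leq_card/subsetP => _ /imsetP[r hr ->].
  by rewrite in_set eqxx andbT /Z in_set hw; rewrite inE in hr.
have hTri : (#|Z| <= #|Tri|)%N.
  pose g (u : (24.-tuple V * 24.-tuple V) * {ffun V -> V}) : choices * 12.-tuple V :=
    (rdl u.1.1 12, rdl u.1.1 13, u.2, oct_of_pair u.1).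
  have key12 w : w \in nondegen b -> (rdl w.2 12, rdl w.2 13) = (rdl w.1 12, rdl w.1 13).
    case/setIdP; rewrite inE => /and3P[_ _ /eqP hk] _.
    by congr pair; symmetry; apply: (nth_mem_lab v0 _ hk).
  have hsat w : w \in nondegen b -> sat T cfg_pat (rdl w.1) /\ sat T cfg_pat (rdl w.2).
    by case/setIdP; rewrite inE => /and3P[/setIdP[h1 _] /setIdP[h2 _] _] _.
  have hY w i : w \in nondegen b -> i \in yrim -> rdl w.2 i = rdl w.1 i.
    case/setIdP; rewrite inE => /and3P[_ _ /eqP hk] _ hi; symmetry.
    by apply: (nth_mem_lab v0 _ hk); rewrite // mem_cat hi.
  (* From the x-edges, [r] recovers one edge at each new centre of an x-rim; with s, s' and the
     octahedron this determines both configurations. *)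
  have ginj : {in Z &, injective g}.
    move=> [w r] [w' r'].
    rewrite ![_ \in Z]in_set => /andP[/= hw /eqP hr] /andP[/= hw' /eqP hr'].
    move=> eg; have e12 : rdl w.1 12 = rdl w'.1 12 := congr1 (fun t => t.1.1.1) eg.
    have e13 : rdl w.1 13 = rdl w'.1 13 := congr1 (fun t => t.1.1.2) eg.
    have er : r = r' := congr1 (fun t => t.1.2) eg.
    have eo : oct_of_pair w = oct_of_pair w' := congr1 snd eg.
    rewrite -{}er {r' eg} in hr' *; congr pair.
    have eo' i : i \in [:: 0; 1; 2; 3; 24; 27; 6; 7; 8; 9; 26; 33]%N -> rd2 w i = rd2 w' i.
      exact: (nth_mem_lab v0 _ eo).
    have [e0 e3 e24 e27] : [/\ rd2 w 0 = rd2 w' 0, rd2 w 3 = rd2 w' 3,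
      rd2 w 24 = rd2 w' 24 & rd2 w 27 = rd2 w' 27] by split; apply: eo'.
    move: hr hr'; rewrite /xs /rs /= -e0 -e3 -e24 -e27 => -> [e16 e20 e40 e44].
    have [s1 s2] := hsat _ hw; have [s1' s2'] := hsat _ hw'.
    pose L12 := [:: 0; 1; 2; 3; 6; 7; 8; 9; 12; 13; 16; 20]%N.
    have det : determines cfg_pat L12 (iota 0 24) by vm_compute.
    have E1 : all (fun k => rdl w.1 k == rdl w'.1 k) L12.
      rewrite /L12; apply/and5P; split; [apply/eqP; exact: (eo' 0%N)|apply/eqP; exact: (eo' 1%N)
        |apply/eqP; exact: (eo' 2%N)|apply/eqP; exact: (eo' 3%N)|].
      apply/and5P; split; [apply/eqP; exact: (eo' 6%N)|apply/eqP; exact: (eo' 7%N)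
        |apply/eqP; exact: (eo' 8%N)|apply/eqP; exact: (eo' 9%N)|].
      by apply/and5P; split; [apply/eqP|apply/eqP|apply/eqP; exact: e16|apply/eqP; exact: e20|].
    have E2 : all (fun k => rdl w.2 k == rdl w'.2 k) L12.
      have k12 u (hu : u \in nondegen b) : rdl u.2 12 = rdl u.1 12 := congr1 fst (key12 u hu).
      have k13 u (hu : u \in nondegen b) : rdl u.2 13 = rdl u.1 13 := congr1 snd (key12 u hu).
      have EY i : i \in yrim -> i \in [:: 0; 1; 2; 3; 24; 27; 6; 7; 8; 9; 26; 33]%N -> (i < 24)%N ->
          rdl w.2 i == rdl w'.2 i.
        by move=> hi hi' h24; rewrite (hY _ _ hw hi) (hY _ _ hw' hi); have := eo' i hi'; rewrite /rd2 h24 => ->.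
      rewrite /L12; apply/and5P; split; [apply/eqP; exact: (eo' 24%N)|exact: EY
        |apply/eqP; exact: (eo' 26%N)|apply/eqP; exact: (eo' 27%N)|].
      apply/and5P; split; [exact: EY|exact: EY|exact: EY|apply/eqP; exact: (eo' 33%N)|].
      apply/and5P; split; [by rewrite (k12 _ hw) (k12 _ hw') e12|by rewrite (k13 _ hw) (k13 _ hw') e13
        |apply/eqP; exact: e40|apply/eqP; exact: e44|by []].
    rewrite [w]surjective_pairing [w']surjective_pairing; congr pair; apply: eq_from_tnth => i;
      rewrite !(tnth_nth v0); have hi : (i : nat) \in iota 0 24 by rewrite mem_iota ltn_ord.
    - by apply: (determinesP TP det s1 s1' _ hi) => k /(allP E1) /eqP.
    - by apply: (determinesP TP det s2 s2' _ hi) => k /(allP E2) /eqP.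
  rewrite -(card_in_imset ginj); apply/subset_leq_card/subsetP => _ /imsetP[[w r] + ->].
  rewrite [_ \in Z]in_set => /andP[/= hw /eqP /=]; rewrite /xs /rs => -[r0 r3 r24 r27].
  rewrite in_set.
  have [s1 s2] := hsat _ hw; pose om : choices := (rdl w.1 12, rdl w.1 13, r).
  have f1 i j := @thin_face om w.1 i j s1 erefl r0 r3.
  have f2 i j := @thin_face om w.2 i j s2 (esym (key12 _ hw)) r24 r27.
  have g2 i j : thin om (rdl w.2 (if i then 3 else 0)%N)
      (rdl w.1 (if i then (if j then 8 else 7) else (if j then 6 else 1))%N)
      (rdl w.2 (if j then 9 else 2)%N).
    by rewrite -(hY _ _ hw); [exact: f2|case: (i); case: (j)].
  change (sat (thin om) oct_pat (rdl (oct_of_pair w))).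
  suff : sat (thin om) (place 0 oct_pat [:: 0; 1; 2; 3; 24; 27; 6; 7; 8; 9; 26; 33]%N) (rd2 w).
    rewrite sat_place; apply: etrans; apply: (@sat_eq _ 12) => // i hi.
    by rewrite nth_lab.
  apply/and5P; split; last (apply/and5P; split; last by []); rewrite /rd2 /=.
  - exact: (f1 false false).
  - exact: (f1 false true).
  - exact: (f1 true false).
  - exact: (f1 true true).
  - exact: (g2 false false).
  - exact: (g2 false true).
  - exact: (g2 true false).
  - exact: (g2 true true).
have N4 : 0 < N ^+ 4 by rewrite exprn_gt0.
have : #|nondegen b|%:R * (F / N ^+ 4) <= #|Tri|%:R by apply: le_trans hZ _; rewrite ler_nat.
by rewrite mulrA ler_pdivrMr // [_ * N ^+ 4]mulrC.
Qed.


Lemma sum_bad_thin k P (bad : pred (k.-tuple V)) (m b : R) : 0 <= b ->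
    #|[set s : k.-tuple V | sat T P (rdl s)]|%:R <= m ->
    (forall s : k.-tuple V, bad s -> #|[set om | sat (thin om) P (rdl s)]|%:R <= b) ->
  (\sum_om #|[set s : k.-tuple V | sat (thin om) P (rdl s) && bad s]|)%:R <= m * b.
Proof.
move=> b0 hm hb; pose S := [set u : choices * k.-tuple V | sat (thin u.1) P (rdl u.2) && bad u.2].
have -> : (\sum_om #|[set s : k.-tuple V | sat (thin om) P (rdl s) && bad s]| = #|S|)%N.
  rewrite (card_fibers fst S); apply: eq_bigr => om _.
  have inj : injective (fun o : k.-tuple V => (om, o)) by move=> o o' [].
  rewrite -(card_imset _ inj); apply: eq_card => -[om' o].
  rewrite [RHS]in_set [(_, _) \in S]in_set.
  apply/imsetP/andP => [[o' + [-> ->]]|[ho /eqP /= <-]]; first by rewrite inE.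
  by exists o; rewrite ?inE.
apply: le_trans (ler_wpM2r b0 hm).
apply: (@card_le_fibers R _ _ snd) => [[om s]|s _].
  by rewrite [_ \in S]in_set => /andP[h _]; rewrite inE; apply: sat_sub h; apply: thin_sub.
have [/hb hs|hs] := boolP (bad s); last first.
  rewrite (_ : [set _ in _ | _] = set0) ?cards0 //; apply/setP => -[om s'].
  rewrite !inE; apply/negP => /andP[/andP[_ h] /eqP e].
  by rewrite -e h in hs.
have inj : {in [set w in S | w.2 == s] &, injective (fun w : choices * k.-tuple V => w.1)}.
  by move=> [u1 u2] [u1' u2'] /setIdP[_ /eqP /= ->] /setIdP[_ /eqP /= ->] /= ->.
rewrite -(card_in_imset inj); apply: le_trans hs.
rewrite ler_nat; apply/subset_leq_card/subsetP => _ /imsetP[[u1 u2] /setIdP[+ /eqP e] ->].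
by rewrite [_ \in S]in_set => /andP[h _]; rewrite inE -e.
Qed.

Lemma card_stars : #|[set s : 24.-tuple V | sat T star_pat (rdl s)]|%:R <= N ^+ 12.
Proof.
rewrite -natrX ler_nat.
apply: (@card_determined V _ _ (fun o : 24.-tuple V => rdl o) T star_pat [::] (iota 0 12) (iota 0 24)) => //.
  by move=> o; rewrite inE.
move=> o o' _ _ h; apply: eq_from_tnth => i; rewrite !(tnth_nth v0).
by apply: h; rewrite mem_iota ltn_ord.
Qed.

Lemma card_pairs :
  #|[set s : 5.-tuple V | sat T [:: (0, 1, 2); (0, 3, 4)]%N (rdl s)]|%:R <= N ^+ 3.
Proof.
rewrite -natrX ler_nat.
apply: (@card_determined V _ _ (fun o : 5.-tuple V => rdl o) T
  [:: (0, 1, 2); (0, 3, 4)]%N [::] [:: 0; 1; 3]%N (iota 0 5)) => //.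
  by move=> o; rewrite inE.
move=> o o' _ _ h; apply: eq_from_tnth => i; rewrite !(tnth_nth v0).
by apply: h; rewrite mem_iota ltn_ord.
Qed.

Let NF_ge0 : 0 <= N ^+ 2 * F. Proof. by rewrite mulr_ge0 ?exprn_ge0 ?ler0n. Qed.

Lemma sum_bad_stars d : 0 <= d ->
  (\sum_om #|bad_stars v0 T (thin om) d|)%:R <= N ^+ 12 * (d * (N ^+ 2 * F)).
Proof.
move=> d0; apply: (@sum_bad_thin 24 star_pat
    (fun s => #|centres v0 T (drop 12 s)|%:R < d * N)); rewrite ?mulr_ge0 ?card_stars // => s hlt.
apply: (le_trans (card_thin_star s)); have -> : d * (N ^+ 2 * F) = d * N * (N * F) by ring.
by apply: ler_wpM2r (ltW hlt); rewrite mulr_ge0 ?ler0n.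
Qed.

Lemma sum_bad_pairs d : 0 <= d ->
  (\sum_om #|bad_pairs v0 T (thin om) d|)%:R <= N ^+ 3 * (d * (N ^+ 2 * F)).
Proof.
move=> d0; apply: (@sum_bad_thin 5 [:: (0, 1, 2); (0, 3, 4)]%N
    (fun p => #|pair_octs v0 T p|%:R < d * N ^+ 2)); rewrite ?mulr_ge0 ?card_pairs // => s hlt.
apply: (le_trans (card_thin_pair s)); rewrite [d * _]mulrA.
by apply: ler_wpM2r (ltW hlt); rewrite ler0n.
Qed.

Lemma exists_thinning eps d : 0 < eps -> 0 < d ->
    eps * N ^+ 5 <= #|octs T|%:R -> 12%:R <= eps ^+ 13 / 2%:R ^+ 30 * N ->
  exists T', [/\ sub3 T' T, eps ^+ 13 / 2%:R ^+ 32 * N ^+ 5 <= #|octs T'|%:R,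
    #|bad_stars v0 T T' d|%:R <= d * 2%:R ^+ 33 / eps ^+ 13 * N ^+ 12
    & #|bad_pairs v0 T T' d|%:R <= d * 2%:R ^+ 33 / eps ^+ 13 * N ^+ 3].
Proof.
move=> e0 d0 hoct hN; pose c := eps ^+ 13 / 2%:R ^+ 31.
have c0 : 0 < c by rewrite divr_gt0 ?exprn_gt0.
have l0 : 0 < c / (4%:R * d) by rewrite divr_gt0 // mulr_gt0 // ltr0n.
have hF : 0 < F by rewrite ltr0n card_ffun expn_gt0 V_gt0.
(* [c] is half the constant [eps / 4 * (eps ^+ 6 / 2 ^+ 14) ^+ 2] of the configuration pairs; the
   other half absorbs the [6 * N ^+ 10] degenerate pairs because [N] is large. *)
have lo : c * N ^+ 5 * (N ^+ 2 * F) <= (\sum_om #|octs (thin om)|)%:R.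
  have := card_configs TP e0 hoct => /(card_config_pairs (divr_gt0 e0 (ltr0Sn _ 3))) hp.
  have {}hp := le_trans (lerB (hp _) (lexx _)) (card_nondegen _).
  have {}hp : 2%:R * c * N ^+ 11 - 6%:R * N ^+ 10 <= #|nondegen (eps / 4%:R * N)|%:R.
    apply: le_trans (hp _); last by rewrite divr_ge0 ?exprn_ge0 ?ltW.
    rewrite lerB // (_ : 2%:R * c = eps / 4%:R * (eps ^+ 6 / 2%:R ^+ 14) ^+ 2) //.
    by rewrite /c; field.
  have := sum_octs_thin (eps / 4%:R * N).
  rewrite -ler_pdivrMl ?exprn_gt0 //; apply: le_trans.
  rewrite ler_pdivlMl ?exprn_gt0 //; apply: le_trans (ler_wpM2r (ltW hF) hp).
  rewrite [X in _ <= X * _](_ : _ = N ^+ 10 * (2%:R * c * N - 6%:R)); last by ring.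
  rewrite [X in X <= _](_ : _ = N ^+ 10 * (c * N) * F); last by ring.
  apply: (ler_wpM2r (ltW hF)); apply: ler_wpM2l; first by rewrite exprn_ge0 ?ltW.
  have : 12%:R <= 2%:R * c * N.
    by rewrite (_ : 2%:R * c = eps ^+ 13 / 2%:R ^+ 30) // /c; field.
  by lra.
(* On average the first term is at least [c] and each penalty at most [c / 4], so some [om] reaches
   [c / 2]. The first term never exceeds 1, so each penalty is then at most 1 as well. *)
pose f om : R := #|octs (thin om)|%:R / N ^+ 5
   - c / (4%:R * d) * (#|bad_stars v0 T (thin om) d|%:R / N ^+ 12)
   - c / (4%:R * d) * (#|bad_pairs v0 T (thin om) d|%:R / N ^+ 3).
have [om hom] : exists om, c / 2%:R <= f om.
  apply/existsP; apply: contraT; rewrite negb_exists => /forallP hlt.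
  have card_om : #|{: choices}|%:R = N ^+ 2 * F :> R by rewrite !card_prod !natrM expr2.
  have hs : \sum_om f om < \sum_(om : choices) c / 2%:R.
    apply: ltr_sum => [|om _]; last by rewrite ltNge.
    by apply/hasP; exists (v0, v0, [ffun=> v0]); rewrite ?mem_index_enum.
  suff : \sum_(om : choices) c / 2%:R <= \sum_om f om by rewrite leNgt hs.
  rewrite sumr_const -[_ *+ _]mulr_natr card_om.
  rewrite !sumrB -!mulr_sumr -!mulr_suml -!natr_sum.
  have h1 := sum_bad_stars (ltW d0); have h2 := sum_bad_pairs (ltW d0).
  have k5 : c * (N ^+ 2 * F) <= (\sum_om #|octs (thin om)|)%:R / N ^+ 5.
    by rewrite ler_pdivlMr ?exprn_gt0 // mulrAC.
  have k12 : (\sum_om #|bad_stars v0 T (thin om) d|)%:R / N ^+ 12 <= d * (N ^+ 2 * F).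
    by rewrite ler_pdivrMr ?exprn_gt0 // mulrC.
  have k3 : (\sum_om #|bad_pairs v0 T (thin om) d|)%:R / N ^+ 3 <= d * (N ^+ 2 * F).
    by rewrite ler_pdivrMr ?exprn_gt0 // mulrC.
  have := ler_wpM2l (ltW l0) k12; have := ler_wpM2l (ltW l0) k3; have e4 : c / (4%:R * d) * (d * (N ^+ 2 * F)) = c / 4%:R * (N ^+ 2 * F).
    by field; rewrite gt_eqF.
  rewrite e4; move: k5.
  move: (N ^+ 2 * F) (_ / N ^+ 5) (_ * (_ / N ^+ 12)) (_ * (_ / N ^+ 3)) => a b1 b2 b3.
  by lra.
exists (thin om); have hTo := partial_latin_sub (@thin_sub om) TP.
have a1 : #|octs (thin om)|%:R / N ^+ 5 <= 1.
  by rewrite ler_pdivrMr ?exprn_gt0 // mul1r card_octs_le.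
have b2 : 0 <= #|bad_stars v0 T (thin om) d|%:R / N ^+ 12 by rewrite divr_ge0 ?exprn_ge0 ?ler0n.
have b3 : 0 <= #|bad_pairs v0 T (thin om) d|%:R / N ^+ 3 by rewrite divr_ge0 ?exprn_ge0 ?ler0n.
have b2' := mulr_ge0 (ltW l0) b2; have b3' := mulr_ge0 (ltW l0) b3.
have e33 : d * 2%:R ^+ 33 / eps ^+ 13 = (c / (4%:R * d))^-1.
  by rewrite /c; field; rewrite !gt_eqF.
split; first exact: thin_sub.
- rewrite -ler_pdivlMr ?exprn_gt0 //.
  have -> : eps ^+ 13 / 2%:R ^+ 32 = c / 2%:R by rewrite /c; field.
  by move: hom; rewrite /f; lra.
- rewrite -ler_pdivrMr ?exprn_gt0 // e33 -[X in _ <= X]mul1r ler_pdivlMr // mulrC.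
  by move: hom; rewrite /f; lra.
- rewrite -ler_pdivrMr ?exprn_gt0 // e33 -[X in _ <= X]mul1r ler_pdivlMr // mulrC.
  by move: hom; rewrite /f; lra.
Qed.

End Thinning.

(** * Selecting the faces *)

Section Selection.

Variables (R : realFieldType) (V : finType) (v0 : V).
Hypothesis V_gt0 : (0 < #|V|)%N.

Implicit Types T L : rel3 V.

Local Notation N := (#|V|%:R : R).
Local Notation rdl := (readl v0).
Local Notation octs := (octs v0).
Local Notation face_octs := (face_octs v0).
Local Notation bad_pairs := (bad_pairs v0).
Local Notation bad_stars := (bad_stars v0).

Let N_gt0 : 0 < N. Proof. by rewrite ltr0n. Qed.

Lemma eq_mem_sat T P P' l : P =i P' -> sat T P l = sat T P' l.
Proof. by move=> h; apply/allP/allP => hl p; [rewrite -h|rewrite h]; apply: hl. Qed.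

Lemma perm_lab k (s : seq nat) : perm_eq s (iota 0 k) ->
  injective (fun q : k.-tuple V => lab (rdl q) s k).
Proof.
move=> hs q q' e; have ss : size s = k by rewrite (perm_size hs) size_iota.
apply: eq_from_tnth => i; rewrite !(tnth_nth v0); apply: (nth_mem_lab v0 ss e).
by rewrite (perm_mem hs) mem_iota ltn_ord.
Qed.

(** [s] renames the edges of an octahedron under the cyclic shift of the vertex classes. *)
Lemma octs_rot_le T : (#|octs (rot T)| <= #|octs T|)%N.
Proof.
pose s := [:: 2; 0; 1; 10; 9; 11; 3; 4; 5; 7; 6; 8]%N.
have hs : perm_eq s (iota 0 12) by [].
rewrite -(card_imset _ (perm_lab hs)).
apply/subset_leq_card/subsetP => _ /imsetP[o ho ->]; move: ho; rewrite !inE => ho.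
have : sat T (place 1 oct_pat (iota 0 12)) (rdl o).
  rewrite sat_place; move: ho; apply: etrans; apply: (@sat_eq _ 12) => // i hi.
  by rewrite nth_iota.
rewrite (@eq_mem_sat _ _ (place 0 oct_pat s)); last by apply: perm_mem; vm_compute.
rewrite sat_place; apply: etrans; apply: (@sat_eq _ 12) => // i hi.
by rewrite nth_lab.
Qed.

Lemma octs_rot T : #|octs (rot T)| = #|octs T|.
Proof.
apply/eqP; rewrite eqn_leq octs_rot_le /=.
exact: leq_trans (octs_rot_le (rot (rot T))) (octs_rot_le (rot T)).
Qed.

Lemma octs_rotn r T : #|octs (rotn r T)| = #|octs T|.
Proof. by elim: r => //= r IH; rewrite octs_rot. Qed.

Lemma face_octs_rot_le T a b c :
  (#|face_octs (rot T) a b c| <= #|face_octs T c a b|)%N.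
Proof.
pose s := [:: 7; 6; 8; 0; 1; 2; 4; 3; 5]%N.
have hs : perm_eq s (iota 0 9) by [].
rewrite -(card_imset _ (perm_lab hs)).
apply/subset_leq_card/subsetP => _ /imsetP[o ho ->]; move: ho; rewrite !inE => ho.
pose s' := [:: 2; 0; 1; 10; 9; 11; 3; 4; 5; 7; 6; 8]%N.
have : sat T (place 1 (behead oct_pat) (iota 0 12)) (rdl [:: a, b, c & o]).
  rewrite sat_place; move: ho; apply: etrans; apply: (@sat_eq _ 12) => // i hi.
  by rewrite nth_iota.
rewrite (@eq_mem_sat _ _ (place 0 (behead oct_pat) s')); last by apply: perm_mem; vm_compute.
rewrite sat_place; apply: etrans; apply: (@sat_eq _ 12) => // i hi.
do 3?[case: i hi => [//|i] hi].
rewrite -[LHS]/(rdl (lab (rdl o) s 9) i) nth_lab //.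
by do 9?[case: i hi => [//|i] hi].
Qed.

Lemma face_octs_rot T a b c : #|face_octs (rot T) a b c| = #|face_octs T c a b|.
Proof.
apply/eqP; rewrite eqn_leq face_octs_rot_le /=.
exact: leq_trans (face_octs_rot_le (rot (rot T)) c a b) (face_octs_rot_le (rot T) b c a).
Qed.

Lemma face_octs_rotn T L (b : R) : (forall x y z, L x y z -> b <= #|face_octs T x y z|%:R) ->
  forall r x y z, rotn r L x y z -> b <= #|face_octs (rotn r T) x y z|%:R.
Proof.
by move=> h; elim=> // r IH x y z /IH; rewrite -[rotn r.+1 T]/(rot (rotn r T)) face_octs_rot.
Qed.

Definition faces L := [set t : V * V * V | L t.1.1 t.1.2 t.2].

Lemma card_faces L : partial_latin L -> #|faces L|%:R <= N ^+ 2.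
Proof.
move=> [hL _ _]; rewrite expr2 -natrM ler_nat -card_prod.
rewrite -(@card_in_imset _ _ (fun t : V * V * V => t.1)); first exact: max_card.
move=> [[x y] z] [[x' y'] z']; rewrite !inE /= => h h' [ex ey].
by rewrite -ex -ey in h' *; rewrite (hL _ _ _ _ h h').
Qed.

Variables (Ta Tb : rel3 V) (c db e1 eta : R).
Hypotheses (TbP : partial_latin Tb) (c_ge0 : 0 <= c) (e1_gt0 : 0 < e1).
Hypothesis bad_pairs_le : forall r,
  #|bad_pairs (rotn r Ta) (rotn r Tb) db|%:R <= eta * N ^+ 3.

Definition bad_edge r x :=
  e1 * N ^+ 2 < #|[set p in bad_pairs (rotn r Ta) (rotn r Tb) db | rdl p 0 == x]|%:R.

Definition select : rel3 V := fun x y z =>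
  [&& Tb x y z, c * N ^+ 3 <= #|face_octs Tb x y z|%:R,
      ~~ bad_edge 0 x, ~~ bad_edge 1 y & ~~ bad_edge 2 z].

Lemma select_edge r x y z : rotn r select x y z ->
  #|[set p in bad_pairs (rotn r Ta) (rotn r Tb) db | rdl p 0 == x]|%:R <= e1 * N ^+ 2.
Proof.
rewrite (rotn_mod3 r select) (rotn_mod3 r Ta) (rotn_mod3 r Tb).
have : (r %% 3 < 3)%N by rewrite ltn_pmod.
case: (r %% 3)%N => [|[|[|//]]] _ /and5P[_ _ h0 h1 h2]; rewrite leNgt;
  [exact: h0|exact: h1|exact: h2].
Qed.

Lemma card_bad_edges r : #|[set x | bad_edge r x]|%:R <= eta / e1 * N.
Proof.
have := @card_ge_fibers R _ _ (fun p : 5.-tuple V => rdl p 0)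
  (bad_pairs (rotn r Ta) (rotn r Tb) db) [set x | bad_edge r x] (e1 * N ^+ 2).
have h x : x \in [set x | bad_edge r x] -> e1 * N ^+ 2 <=
    #|[set p in bad_pairs (rotn r Ta) (rotn r Tb) db | rdl p 0 == x]|%:R.
  by rewrite inE => /ltW.
move=> /(_ h) {}h; have N2 : 0 < e1 * N ^+ 2 by rewrite mulr_gt0 ?exprn_gt0.
rewrite -(ler_pM2r N2); apply: le_trans h (le_trans (bad_pairs_le r) _).
rewrite (_ : eta / e1 * N * (e1 * N ^+ 2) = eta * N ^+ 3) //.
by field; rewrite gt_eqF.
Qed.

Lemma card_octs_edge r (S : {set V}) : (r < 3)%N ->
  #|[set o in octs Tb | rdl o r \in S]|%:R <= #|S|%:R * N ^+ 4.
Proof.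
move=> hr; apply: (@card_le_fibers R _ _ (fun o : 12.-tuple V => rdl o r)) => [o|x _].
  by case/setIdP.
rewrite -natrX ler_nat.
pose G := [:: (if r == 0 then 1 else 0); 3; 4; 6]%N.
rewrite -[X in (_ <= _ ^ X)%N]/(size G).
apply: (@card_determined V _ _ (fun o : 12.-tuple V => rdl o) Tb oct_pat [:: r] G (iota 0 12)) => //.
- by case: r hr @G => [|[|[|//]]].
- by move=> o; rewrite !inE => /andP[/andP[]].
- move=> o o'; rewrite !inE => /andP[_ /eqP h] /andP[_ /eqP h'] i.
  by rewrite inE => /eqP ->; rewrite h h'.
- move=> o o' _ _ h; apply: eq_from_tnth => i; rewrite !(tnth_nth v0).
  by apply: h; rewrite mem_iota ltn_ord.
Qed.

Lemma card_octs_face t : Tb t.1.1 t.1.2 t.2 ->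
  (#|[set o in octs Tb | (rdl o 0, rdl o 1, rdl o 2) == t]| <= #|face_octs Tb t.1.1 t.1.2 t.2|)%N.
Proof.
case: t => [[x y] z] /= hT; pose f (o : 12.-tuple V) := lab (rdl o) (iota 3 9) 9.
rewrite -(@card_in_imset _ _ f).
  apply/subset_leq_card/subsetP => _ /imsetP[o /setIdP[ho /eqP[h0 h1 h2]] ->].
  rewrite inE; move: ho; rewrite inE => /andP[_]; apply: etrans.
  apply: (@sat_eq _ 12) => // i hi; case: i hi => [|[|[|i hi]]]; rewrite -?h0 -?h1 -?h2 //.
  by rewrite -[LHS]/(rdl (f o) i) nth_lab // nth_iota.
move=> o o' /setIdP[_ /eqP h] /setIdP[_ /eqP h'] e; have hh := etrans h (esym h').
apply: eq_from_tnth => i; rewrite !(tnth_nth v0).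
case: (ltnP i 3) => hi.
  case: i hi => [[|[|[|i]]]] //= _ _; [exact (congr1 (fun t : V * V * V => t.1.1) hh)
    |exact (congr1 (fun t : V * V * V => t.1.2) hh)|exact (congr1 snd hh)].
by apply: (nth_mem_lab v0 _ e); rewrite // mem_iota hi ltn_ord.
Qed.

Lemma card_face_octs_le x y z : #|face_octs Tb x y z|%:R <= N ^+ 3.
Proof.
rewrite -natrX ler_nat.
apply: (@card_determined V _ _ (fun q : 9.-tuple V => rdl [:: x, y, z & q]) Tb (behead oct_pat)
   (iota 0 3) [:: 3; 4; 6]%N (iota 0 12)) => //.
- by move=> o; rewrite inE.
- by move=> o o' _ _ i; rewrite mem_iota; case: i => [|[|[|]]].
- move=> o o' _ _ h; apply: eq_from_tnth => i; rewrite !(tnth_nth v0).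
  by apply: (h i.+3); rewrite mem_iota; have := ltn_ord i; lia.
Qed.

(** Octahedra are sorted by their face x00 y00 z00: it is selected, or lies in few octahedra, or has
    a bad edge. The factor [N ^+ 2 - #|faces select|] instead of [N ^+ 2] matters when [c] is close
    to 1. *)
Lemma card_octs_select : #|octs Tb|%:R <= #|faces select|%:R * N ^+ 3
  + (N ^+ 2 - #|faces select|%:R) * (c * N ^+ 3) + 3%:R * (eta / e1) * N ^+ 5.
Proof.
pose fc (o : 12.-tuple V) := (rdl o 0, rdl o 1, rdl o 2).
pose OL := [set o in octs Tb | fc o \in faces select].
pose weak := [set t in faces Tb :\: faces select | #|face_octs Tb t.1.1 t.1.2 t.2|%:R < c * N ^+ 3].
pose O9 := [set o in octs Tb | fc o \in weak].
pose Ob := \bigcup_(r < 3) [set o in octs Tb | rdl o r \in [set x | bad_edge r x]].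
have octTb o : o \in octs Tb -> Tb (fc o).1.1 (fc o).1.2 (fc o).2.
  by rewrite inE => /andP[].
have hsub : octs Tb \subset OL :|: O9 :|: Ob.
  apply/subsetP => o ho; rewrite !in_setU; have [//|/= hL] := boolP (o \in OL).
  have [//|/= h9] := boolP (o \in O9).
  have hs : fc o \notin faces select by move: hL; rewrite inE ho.
  have hw : c * N ^+ 3 <= #|face_octs Tb (fc o).1.1 (fc o).1.2 (fc o).2|%:R.
    by move: h9; rewrite /O9 /weak inE ho inE inE hs inE (octTb _ ho) /= -leNgt.
  apply/bigcupP; move: hs; rewrite inE /select octTb //= hw /= !negb_and !negbK.
  by case/or3P=> hb; [exists (inord 0)|exists (inord 1)|exists (inord 2)] => //;
    rewrite inE ho inE inordK.
have hOL : #|OL|%:R <= #|faces select|%:R * N ^+ 3.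
  apply: (@card_le_fibers R _ _ fc) => [o /setIdP[]//|t ht].
  have [hT _] : Tb t.1.1 t.1.2 t.2 /\ true by move: ht; rewrite inE => /andP[].
  apply: le_trans (card_face_octs_le t.1.1 t.1.2 t.2); rewrite ler_nat.
  apply: leq_trans (card_octs_face hT); apply/subset_leq_card/subsetP => o.
  by case/setIdP=> /setIdP[ho _] e; apply/setIdP.
have hO9 : #|O9|%:R <= (N ^+ 2 - #|faces select|%:R) * (c * N ^+ 3).
  apply: (@le_trans _ _ (#|weak|%:R * (c * N ^+ 3))).
    apply: (@card_le_fibers R _ _ fc) => [o /setIdP[]//|t /setIdP[/setDP[hT _] /ltW]].
    apply: le_trans; rewrite ler_nat; rewrite inE in hT.
    apply: leq_trans (card_octs_face hT); apply/subset_leq_card/subsetP => o.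
    by case/setIdP=> /setIdP[ho _] e; apply/setIdP.
  apply: ler_wpM2r; first by rewrite mulr_ge0 // exprn_ge0 // ltW.
  rewrite lerBrDr; apply: le_trans (card_faces TbP); rewrite -natrD ler_nat.
  have hsT : faces select \subset faces Tb.
    by apply/subsetP => t; rewrite !inE => /andP[].
  rewrite -(cardsID (faces select) (faces Tb)) addnC (setIidPr hsT) leq_add2l.
  by apply/subset_leq_card/subsetP => t /setIdP[].
have hOb : #|Ob|%:R <= 3%:R * (eta / e1) * N ^+ 5.
  apply: (@le_trans _ _ (\sum_(r < 3) #|[set o in octs Tb | rdl o r \in [set x | bad_edge r x]]|%:R)).
    rewrite -natr_sum ler_nat /Ob.
    apply: (big_ind2 (fun (A : {set 12.-tuple V}) n => (#|A| <= n)%N)); rewrite ?cards0 // => A m B n hA hB.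
    by apply: leq_trans (leq_add hA hB); rewrite cardsU leq_subr.
  apply: (@le_trans _ _ (\sum_(r < 3) (eta / e1 * N * N ^+ 4))).
    apply: ler_sum => r _; apply: (le_trans (card_octs_edge _ (ltn_ord r))).
    by apply: ler_wpM2r (card_bad_edges r); rewrite exprn_ge0 // ltW.
  rewrite sumr_const card_ord -mulr_natl le_eqVlt; apply/orP; left; apply/eqP; ring.
have := @card_le_setU3 R _ _ _ _ _ hsub; move: hOL hO9 hOb.
move: (_ * N ^+ 3) (_ * (c * _)) (_ * N ^+ 5) => a b d.
by lra.
Qed.

End Selection.

(** * Removing slits by colouring *)

Section Sparsify.

Variables (R : realFieldType) (V : finType) (v0 : V).

Implicit Types L : rel3 V.

Local Notation rdl := (readl v0).

(* The two edges of a slit, x11 and x11'. *)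
Definition slit L x x' := [exists D : 13.-tuple V,
  [&& sat L face_tab (rdl D), rdl D 3 == x & rdl D 4 == x']].

Lemma slit_sub L L' x x' : sub3 L L' -> slit L x x' -> slit L' x x'.
Proof.
by move=> h /existsP[D /and3P[hD h3 h4]]; apply/existsP; exists D; rewrite (sat_sub h hD) h3.
Qed.

Lemma slit_sym L : symmetric (slit L).
Proof.
suff h x x' : slit L x x' -> slit L x' x by move=> x x'; apply/idP/idP; apply: h.
case/existsP=> D /and3P[hD h3 h4]; pose s := [:: 0; 1; 2; 4; 3; 6; 5; 8; 7; 10; 9; 12; 11]%N.
apply/existsP; exists (lab (rdl D) s 13); apply/and3P; split; rewrite ?nth_lab //.
have : sat L (place 0 face_tab s) (rdl D).
  by rewrite (@eq_mem_sat _ _ _ face_tab) //; apply: perm_mem; vm_compute.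
rewrite sat_place; apply: etrans; apply: (@sat_eq _ 13) => // i hi.
by rewrite nth_lab.
Qed.

Lemma colouring (e : rel V) d : symmetric e -> (forall x, #|[set y | e x y]| <= d)%N ->
  exists f : V -> 'I_d.+1, forall x y, e x y -> x != y -> f x != f y.
Proof.
move=> se hd; suff [f hf] : exists f : V -> 'I_d.+1,
    {in enum V &, forall x y, e x y -> x != y -> f x != f y}.
  by exists f => x y; apply: hf; rewrite mem_enum.
elim: (enum V) (enum_uniq V) => [|x s IH] /=; first by exists (fun=> ord0).
case/andP=> xs /IH[f hf].
have [a ha] : exists a, a \notin [set f y | y in [set y | e x y]].
  have : (0 < #|~: [set f y | y in [set y | e x y]]|)%N.
    rewrite -(ltn_add2l #|[set f y | y in [set y | e x y]]|) cardsC addn0 card_ord ltnS.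
    exact: leq_trans (leq_imset_card _ _) (hd x).
  by case/card_gt0P=> a; rewrite inE => ha; exists a.
have new y : e x y -> a != f y.
  by move=> exy; apply: contra ha => /eqP ->; apply: imset_f; rewrite inE.
exists (fun y => if y == x then a else f y) => y z; rewrite !inE.
have [->|yx] := eqVneq y x; have [->|zx] := eqVneq z x => //= ys zs.
- by move=> /new.
- by rewrite se eq_sym => /new; rewrite eq_sym.
- exact: hf.
Qed.

Definition coord r (x y z : V) := if r is r'.+1 then (if r' is _.+1 then z else y) else x.

Lemma rotn_coord r L (P : pred V) a b c : (r < 3)%N ->
  rotn r (fun x y z => L x y z && P (coord r x y z)) a b c = rotn r L a b c && P a.
Proof. by case: r => [|[|[|]]]. Qed.

(** One colour class of a proper colouring of [slit] keeps the required share of the faces. Both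
    edges of a slit lie in faces of the disc and thus have the colour that is kept. The case
    [x = x'] remains, since [slit] includes octahedra that close up. *)
Lemma sparsify_coord r L d : (r < 3)%N ->
    (forall x, #|[set x' | slit (rotn r L) x x']| <= d)%N ->
  exists L', [/\ sub3 L' L, (#|faces L| <= d.+1 * #|faces L'|)%N &
    forall x x', slit (rotn r L') x x' -> x = x'].
Proof.
move=> hr /(colouring (slit_sym (rotn r L)))[f hf].
pose Lc c : rel3 V := fun x y z => L x y z && (f (coord r x y z) == c).
have [c hc] : exists c, (#|faces L| <= d.+1 * #|faces (Lc c)|)%N.
  apply/existsP; apply: contraT; rewrite negb_exists => /forallP h.
  have hsum : #|faces L| = (\sum_c #|faces (Lc c)|)%N.
    rewrite (card_fibers (fun t : V * V * V => f (coord r t.1.1 t.1.2 t.2)) (faces L)).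
    by apply: eq_bigr => c _; apply: eq_card => t; rewrite !inE.
  have : (\sum_(c < d.+1) (d.+1 * #|faces (Lc c)| + 1) <= \sum_(c < d.+1) #|faces L|)%N.
    by apply: leq_sum => c _; rewrite addn1 ltnNge.
  rewrite big_split /= -big_distrr /= -hsum !sum_nat_const card_ord muln1.
  by rewrite -[X in (_ <= X)%N]addn0 leq_add2l ltn0.
exists (Lc c); split=> // [x y z /andP[]//|x x' hs].
have hs' : slit (rotn r L) x x' by apply: slit_sub hs; apply: sub3_rotn => a b e /andP[].
apply/eqP; apply: contraT => /(hf _ _ hs') /negP[].
case/existsP: hs => D /and3P[/allP hD /eqP <- /eqP <-].
have h6 := hD (3, 7, 11)%N isT; have h7 := hD (4, 8, 12)%N isT.
move: h6 h7; rewrite /Lc !(@rotn_coord r L (fun v => f v == c)) //.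
by move=> /andP[_ /eqP ->] /andP[_ /eqP ->].
Qed.


Lemma sparsify L d : (forall r x, #|[set x' | slit (rotn r L) x x']| <= d)%N ->
  exists L', [/\ sub3 L' L, (#|faces L| <= d.+1 ^ 3 * #|faces L'|)%N &
    forall r x x', slit (rotn r L') x x' -> x = x'].
Proof.
move=> hd.
have hsub r L1 : sub3 L1 L -> (forall x, #|[set x' | slit (rotn r L1) x x']| <= d)%N.
  move=> h x; apply: leq_trans (hd r x); apply/subset_leq_card/subsetP => x'.
  by rewrite !inE; apply: slit_sub; apply: sub3_rotn.
have [L1 [s1 c1 n1]] := @sparsify_coord 0 L d isT (hd 0%N).
have [L2 [s2 c2 n2]] := @sparsify_coord 1 L1 d isT (hsub 1%N _ s1).
have [L3 [s3 c3 n3]] := @sparsify_coord 2 L2 d isT (hsub 2%N _ (sub3_trans s2 s1)).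
exists L3; split.
- exact: sub3_trans s3 (sub3_trans s2 s1).
- apply: (leq_trans c1); rewrite expnS -mulnA leq_mul2l /=.
  by apply: (leq_trans c2); rewrite expnS -mulnA leq_mul2l /= expn1.
- move=> r x x'; rewrite rotn_mod3; have : (r %% 3 < 3)%N by rewrite ltn_pmod.
  case: (r %% 3)%N => [|[|[|//]]] _ h.
  + by apply: n1; apply: slit_sub h; apply: sub3_rotn; apply: sub3_trans s3 s2.
  + by apply: n2; apply: slit_sub h; apply: sub3_rotn.
  + exact: n3.
Qed.

End Sparsify.

(** * Thinning in the three rotations *)

Section Iterate.

Variables (R : realFieldType) (V : finType) (v0 : V).
Hypothesis V_gt0 : (0 < #|V|)%N.

Implicit Types T : rel3 V.

Local Notation N := (#|V|%:R : R).
Local Notation octs := (octs v0).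
Local Notation bad_pairs := (bad_pairs v0).
Local Notation bad_stars := (bad_stars v0).

Let N_gt0 : 0 < N. Proof. by rewrite ltr0n. Qed.

Lemma bad_stars_sub T1 T1' T2 T2' (d1 d2 : R) :
  sub3 T1' T2' -> sub3 T2 T1 -> d1 <= d2 -> bad_stars T1 T1' d1 \subset bad_stars T2 T2' d2.
Proof.
move=> h' h hd; apply/subsetP => s; rewrite !inE => /andP[hs hlt]; rewrite (sat_sub h' hs) /=.
apply: le_lt_trans (lt_le_trans hlt _); last by rewrite ler_wpM2r // ltW.
rewrite ler_nat; apply/subset_leq_card/subsetP => q; rewrite !inE; exact: sat_sub.
Qed.

Lemma bad_pairs_sub T1 T1' T2 T2' (d1 d2 : R) :
  sub3 T1' T2' -> sub3 T2 T1 -> d1 <= d2 -> bad_pairs T1 T1' d1 \subset bad_pairs T2 T2' d2.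
Proof.
move=> h' h hd; apply/subsetP => s; rewrite !in_set => /andP[hs hlt]; rewrite (sat_sub h' hs) /=.
apply: le_lt_trans (lt_le_trans hlt _); last by rewrite ler_wpM2r // exprn_ge0 // ltW.
rewrite ler_nat; apply/subset_leq_card/subsetP => q; rewrite !inE; exact: sat_sub.
Qed.

(** Here 47 = 13 + 34: for [eps <= 1/2] the factor [eps ^+ 34] absorbs the constants [2 ^- 32],
    [2 ^- 33], and [2 ^- 30] together with [12 <= 2 ^+ 4]. *)
Lemma thinning_poly T (eps g : R) : partial_latin T -> 0 < eps <= 2%:R^-1 -> 0 < g ->
    eps * N ^+ 5 <= #|octs T|%:R -> 1 <= eps ^+ 47 * N ->
  exists T', [/\ sub3 T' T, eps ^+ 47 * N ^+ 5 <= #|octs T'|%:R,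
    #|bad_stars T T' (g * eps ^+ 47)|%:R <= g * N ^+ 12
    & #|bad_pairs T T' (g * eps ^+ 47)|%:R <= g * N ^+ 3].
Proof.
move=> TP /andP[e0 e2] g0 hoct hN.
have e1 : eps <= 1 by apply: (le_trans e2); rewrite invf_le1 ?ler1n.
have e2X k : eps ^+ k <= 2%:R^-1 ^+ k by rewrite lerXn2r // nnegrE ?invr_ge0 ?ler0n // ltW.
have eX k : 0 < eps ^+ k by rewrite exprn_gt0.
have small j k : eps ^+ (j + k) <= eps ^+ k / 2%:R ^+ j.
  by rewrite exprD mulrC ler_pM2l // -exprVn.
have hN' : 12%:R <= eps ^+ 13 / 2%:R ^+ 30 * N.
  apply: (@le_trans _ _ (2%:R ^+ 4 * (eps ^+ 47 * N))).
    apply: (@le_trans _ _ (2%:R ^+ 4 * 1)); last by rewrite ler_pM2l ?exprn_gt0.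
    by rewrite mulr1 -natrX ler_nat.
  rewrite mulrA ler_pM2r //.
  have := small 34%N 13%N; rewrite -[(34 + 13)%N]/47%N => h.
  apply: (@le_trans _ _ (2%:R ^+ 4 * (eps ^+ 13 / 2%:R ^+ 34))); first by rewrite ler_pM2l ?exprn_gt0.
  by rewrite (_ : 2%:R ^+ 4 * _ = eps ^+ 13 / 2%:R ^+ 30) //; field.
have d0 : 0 < g * eps ^+ 13 / 2%:R ^+ 33 by rewrite divr_gt0 ?mulr_gt0 ?exprn_gt0.
have [T' [sT oT bs bp]] := exists_thinning TP V_gt0 e0 d0 hoct hN'.
have ge : g * eps ^+ 13 / 2%:R ^+ 33 * 2%:R ^+ 33 / eps ^+ 13 = g.
  by field; rewrite gt_eqF.
rewrite ge in bs bp.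
have hd : g * eps ^+ 47 <= g * eps ^+ 13 / 2%:R ^+ 33.
  rewrite -mulrA ler_pM2l //; apply: le_trans (small 33%N 13%N).
  by rewrite -[47%N]/(1 + (33 + 13))%N exprS ler_piMl // ltW.
exists T'; split=> //.
- apply: le_trans oT; rewrite ler_pM2r ?exprn_gt0 //; apply: le_trans (small 32%N 13%N).
  by rewrite -[47%N]/(2 + (32 + 13))%N exprD ler_piMl // ?exprn_ile1 // ltW.
- by apply: le_trans bs; rewrite ler_nat subset_leq_card // bad_stars_sub.
- by apply: le_trans bp; rewrite ler_nat subset_leq_card // bad_pairs_sub.
Qed.

(** [thin] moves the first vertex only, so each rotation needs a thinning of its own. Bad sets only
    shrink when the relation of the configurations gets smaller or that of the completions larger,
    so a later thinning does not spoil an earlier one. *)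
Lemma thinning_poly3 T (eps g : R) :
    partial_latin T -> 0 < eps <= 2%:R^-1 -> 0 < g ->
    eps * N ^+ 5 <= #|octs T|%:R -> 1 <= eps ^+ (47 ^ 3) * N ->
  exists T', [/\ sub3 T' T, eps ^+ (47 ^ 3) * N ^+ 5 <= #|octs T'|%:R,
    forall r, #|bad_stars (rotn r T) (rotn r T') (g * eps ^+ (47 ^ 3))|%:R <= g * N ^+ 12
    & forall r, #|bad_pairs (rotn r T) (rotn r T') (g * eps ^+ (47 ^ 3))|%:R <= g * N ^+ 3].
Proof.
have := isT : (1 < 47)%N; move: 47%N (@thinning_poly) => m hthin m1.
move=> TP /andP[e0 e2] g0 hoct hN.
have e1 : eps <= 1 by apply: (le_trans e2); rewrite invf_le1 ?ler1n.
have eX k : 0 < eps ^+ k by rewrite exprn_gt0.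
have eXle i j : (i <= j)%N -> eps ^+ j <= eps ^+ i by move=> ?; apply: ler_wiXn2l; rewrite // ltW.
have rng i : (0 < i)%N -> 0 < eps ^+ i <= 2%:R^-1.
  by move=> hi; rewrite eX /= (le_trans _ e2) // -[X in _ <= X]expr1 eXle.
have big i : (i <= m ^ 3)%N -> 1 <= eps ^+ i * N.
  by move=> hi; apply: (le_trans hN); rewrite ler_pM2r // eXle.
have gle i : (i <= m ^ 3)%N -> g * eps ^+ (m ^ 3) <= g * eps ^+ i.
  by move=> hi; rewrite ler_pM2l // eXle.
have m2 : (m * m = m ^ 2)%N by rewrite mulnn.
have m3 : (m ^ 2 * m = m ^ 3)%N by rewrite -expnSr.
have le1 : (m <= m ^ 3)%N by rewrite -{1}[m]expn1 leq_pexp2l // ltnW.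
have le2 : (m ^ 2 <= m ^ 3)%N by rewrite leq_pexp2l // ltnW.
have [T1 [s1 o1 bs1 bp1]] := hthin T eps g TP (rng 1%N isT) g0 hoct (big _ le1).
have TP1 := partial_latin_sub s1 TP.
rewrite -(octs_rotn v0 1) in o1.
have [T2' [s2 o2 bs2 bp2]] := hthin (rotn 1 T1) (eps ^+ m) g
  (partial_latin_rotn 1 TP1) (rng _ (ltnW m1)) g0 o1 (eq_rect_r (fun i => 1 <= i * N)
  (big _ le2) (etrans (esym (exprM _ _ _)) (congr1 _ m2))).
pose T2 := rotn 2 T2'; have sT2 : sub3 T2 T1 by exact: (@sub3_rotn _ 2 _ _ s2).
have TP2 := partial_latin_sub sT2 TP1.
rewrite -exprM m2 -(octs_rotn v0 1) -[rotn 1 T2']/(rotn 2 T2) in o2.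
have [T3' [s3 o3 bs3 bp3]] := hthin (rotn 2 T2) (eps ^+ (m ^ 2)) g
  (partial_latin_rotn 2 TP2) (rng _ (leq_trans (ltnW m1) (leq_pmulr _ (ltnW m1)))) g0 o2
  (eq_rect_r (fun i => 1 <= i * N) (big _ (leqnn _)) (etrans (esym (exprM _ _ _)) (congr1 _ m3))).
pose T3 := rotn 1 T3'; have sT3 : sub3 T3 T2 by exact: (@sub3_rotn _ 1 _ _ s3).
rewrite -exprM m3 -(octs_rotn v0 1) -/T3 in o3.
have s31 := sub3_trans sT3 sT2.
have key i : (i < 3)%N -> exists U U' e, [/\ sub3 (rotn i U) (rotn i T),
    sub3 (rotn i T3) (rotn i U'), g * eps ^+ (m ^ 3) <= e,
    #|bad_stars (rotn i U) (rotn i U') e|%:R <= g * N ^+ 12 &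
    #|bad_pairs (rotn i U) (rotn i U') e|%:R <= g * N ^+ 3].
  case: i => [|[|[|//]]] _.
  - by exists T, T1, (g * eps ^+ m); split=> //; exact: gle.
  - exists T1, T2, (g * (eps ^+ m) ^+ m); split=> //; [exact: sub3_rotn|exact: sub3_rotn|].
    by rewrite -exprM m2; exact: gle.
  - exists T2, T3, (g * (eps ^+ (m ^ 2)) ^+ m); split=> //.
      by apply: (@sub3_rotn _ 2); apply: sub3_trans sT2 s1.
    by rewrite -exprM m3.
exists T3; split=> // [|r|r]; first exact: sub3_trans s31 s1.
- rewrite (rotn_mod3 r T) (rotn_mod3 r T3).
  have [|U [U' [e [h1 h2 h3 h4 _]]]] := key (r %% 3)%N; first by rewrite ltn_pmod.
  by apply: le_trans h4; rewrite ler_nat subset_leq_card // bad_stars_sub.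
- rewrite (rotn_mod3 r T) (rotn_mod3 r T3).
  have [|U [U' [e [h1 h2 h3 _ h4]]]] := key (r %% 3)%N; first by rewrite ltn_pmod.
  by apply: le_trans h4; rewrite ler_nat subset_leq_card // bad_pairs_sub.
Qed.

End Iterate.

(** * Few octahedra *)

Section PolyBound.

Variable R : realFieldType.

(** Up to [eps = 1/2] a constant factor is absorbed by a power of [eps], so the final exponent need
    not be computed. *)
Definition poly_lb (f : R -> R) :=
  exists M : nat, forall eps, 0 < eps <= 2%:R^-1 -> eps ^+ M <= f eps.

Lemma poly_lbX k : poly_lb (fun eps => eps ^+ k).
Proof. by exists k. Qed.

Lemma poly_lbM f g : poly_lb f -> poly_lb g -> poly_lb (fun eps => f eps * g eps).
Proof.
move=> [M hM] [M' hM']; exists (M + M')%N => eps he; rewrite exprD.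
have e0 : 0 <= eps by case/andP: he => /ltW.
by apply: ler_pM; rewrite ?exprn_ge0 // ?hM ?hM'.
Qed.

Lemma poly_lb_exp f k : poly_lb f -> poly_lb (fun eps => f eps ^+ k).
Proof.
move=> hf; elim: k => [|k IH]; first by exists 0%N.
by have [M hM] := poly_lbM hf IH; exists M => eps /hM; rewrite -exprS.
Qed.

Lemma poly_lb_div f k : (0 < k)%N -> poly_lb f -> poly_lb (fun eps => f eps / k%:R).
Proof.
move=> k0; apply: (fun h => @poly_lbM _ (fun=> k%:R^-1) h _).
exists k => eps /andP[e0 he]; apply: (@le_trans _ _ (2%:R^-1 ^+ k)).
  by rewrite lerXn2r // nnegrE ?invr_ge0 ?ler0n // ltW.
by rewrite exprVn lef_pV2 ?posrE ?exprn_gt0 ?ltr0n // -natrX ler_nat ltnW // ltn_expl.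
Qed.

End PolyBound.

Section Dense.

Variable R : realFieldType.

Variable k : nat.
Hypothesis k_gt0 : (0 < k)%N.
Hypothesis thinning : forall (V : finType) (v0 : V), (0 < #|V|)%N ->
  forall (T : rel3 V) (eps g : R), partial_latin T -> 0 < eps <= 2%:R^-1 -> 0 < g ->
    eps * #|V|%:R ^+ 5 <= #|octs v0 T|%:R -> 1 <= eps ^+ k * #|V|%:R ->
  exists T', [/\ sub3 T' T, eps ^+ k * #|V|%:R ^+ 5 <= #|octs v0 T'|%:R,
    forall r, #|bad_stars v0 (rotn r T) (rotn r T') (g * eps ^+ k)|%:R <= g * #|V|%:R ^+ 12
    & forall r, #|bad_pairs v0 (rotn r T) (rotn r T') (g * eps ^+ k)|%:R <= g * #|V|%:R ^+ 3].

(** [E] is the density of octahedra after two thinnings. Faces in few octahedra and bad edges cost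
    [E / 4] each, as [3 * (gb / e1) = E / 4]. In the number of fillings, [11 * e1] is half of
    [c ^+ 8] and [4 * ga] a quarter of [c ^+ 8 * db ^+ 11], so a quarter is left. The first thinning
    uses [ga], which depends on the threshold [db] of the second; all are explicit in [eps], so
    nothing is circular. *)
Let E (eps : R) := (eps ^+ k) ^+ k.
Let c eps := E eps / 4%:R.
Let e1 eps := c eps ^+ 8 / 22%:R.
Let gb eps := E eps * e1 eps / 12%:R.
Let db eps := gb eps * E eps.
Let ga eps := c eps ^+ 8 * db eps ^+ 11 / 16%:R.
Let da eps := ga eps * eps ^+ k.
Let kap eps := c eps ^+ 8 * db eps ^+ 11 / 4%:R * da eps ^+ 4.

Lemma dense_case_of_thinning : exists M : nat, forall (V : finType) (v0 : V) (T : rel3 V) (eps : R),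
    0 < eps <= 2%:R^-1 -> partial_latin T ->
    eps * #|V|%:R ^+ 5 <= #|octs v0 T|%:R -> 1 <= eps ^+ M * #|V|%:R ->
  exists L, [/\ sub3 L T, eps ^+ M * #|V|%:R ^+ 2 <= #|faces L|%:R &
    forall r x x', slit v0 (rotn r L) x x' -> x = x'].
Proof.
have pE : poly_lb E by apply: poly_lb_exp; apply: poly_lbX.
have pc : poly_lb c by apply: poly_lb_div.
have pe1 : poly_lb e1 by apply: poly_lb_div => //; apply: poly_lb_exp.
have pgb : poly_lb gb by apply: poly_lb_div => //; apply: poly_lbM.
have pdb : poly_lb db by apply: poly_lbM.
have pga : poly_lb ga by apply: poly_lb_div => //; apply: poly_lbM; apply: poly_lb_exp.
have pda : poly_lb da by apply: poly_lbM => //; apply: poly_lbX.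
have pk : poly_lb kap.
  apply: poly_lbM; last exact: poly_lb_exp.
  by apply: poly_lb_div => //; apply: poly_lbM; apply: poly_lb_exp.
have [M1 hM1] : poly_lb (fun eps => E eps * kap eps ^+ 3 / 16%:R).
  by apply: poly_lb_div => //; apply: poly_lbM => //; apply: poly_lb_exp.
exists (M1 + (k + k * k))%N => V v0 T eps he TP hoct hN.
have /andP[e0 e2] := he.
have pos f : poly_lb f -> 0 < f eps.
  by case=> M hM; apply: lt_le_trans (hM _ he); rewrite exprn_gt0.
have [E0 c0 e10 gb0] : [/\ 0 < E eps, 0 < c eps, 0 < e1 eps & 0 < gb eps] by split; apply: pos.
have [db0 ga0 da0 kap0] : [/\ 0 < db eps, 0 < ga eps, 0 < da eps & 0 < kap eps] by split; apply: pos.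
have N1 : 0 < #|V|%:R :> R.
  by rewrite ltr0n lt0n; apply/negP => /eqP V0; move: hN; rewrite V0 mulr0 ler10.
have V0 : (0 < #|V|)%N by rewrite -(ltr0n R).
have ele1 : eps <= 1 by apply: (le_trans e2); rewrite invf_le1 ?ler1n.
have eXle i j : (i <= j)%N -> eps ^+ j <= eps ^+ i by move=> ?; apply: ler_wiXn2l; rewrite // ltW.
have hNle i : (i <= M1 + (k + k * k))%N -> 1 <= eps ^+ i * #|V|%:R.
  by move=> hi; apply: (le_trans hN); rewrite ler_pM2r // eXle.
have hk : (k <= M1 + (k + k * k))%N by rewrite addnCA leq_addr.
have hkk : (k * k <= M1 + (k + k * k))%N by rewrite addnA leq_addl.
have [Ta [sTa oTa bsa _]] := thinning V0 TP he ga0 hoct (hNle _ hk).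
have TaP := partial_latin_sub sTa TP.
have hek : 0 < eps ^+ k <= 2%:R^-1.
  by rewrite exprn_gt0 //= (le_trans _ e2) // -[X in _ <= X]expr1 eXle.
have hN2 : 1 <= (eps ^+ k) ^+ k * #|V|%:R by rewrite -exprM hNle.
have [Tb [sTb oTb _ bpb]] := thinning V0 TaP hek gb0 oTa hN2.
have TbP := partial_latin_sub sTb TaP.
pose L := select v0 Ta Tb (c eps) (db eps) (e1 eps).
have sL : sub3 L T by move=> x y z /and5P[/sTb/sTa].
have hL : E eps / 2%:R * #|V|%:R ^+ 2 <= #|faces L|%:R.
  have := card_octs_select V0 TbP (ltW c0) e10 bpb.
  rewrite -/L => hsel; have := le_trans oTb hsel.
  have -> : gb eps / e1 eps = E eps / 12%:R by rewrite /gb; field; rewrite gt_eqF.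
  have N3 : 0 < #|V|%:R ^+ 3 :> R by rewrite exprn_gt0.
  have l0 : 0 <= #|faces L|%:R * (c eps * #|V|%:R ^+ 3) 
    by apply: mulr_ge0; [rewrite ler0n|apply: mulr_ge0; apply: ltW].
  move=> h; rewrite -(ler_pM2r N3).
  have hE : E eps * #|V|%:R ^+ 5 = 4%:R * (c eps * #|V|%:R ^+ 5) by rewrite /c; field.
  move: h l0; rewrite -[(eps ^+ _) ^+ _]/(E eps).
  rewrite (_ : _ + 3%:R * _ * _ = #|faces L|%:R * #|V|%:R ^+ 3 - #|faces L|%:R * (c eps * #|V|%:R ^+ 3)
      + E eps / 2%:R * #|V|%:R ^+ 5); last by rewrite /c; field.
  rewrite (_ : E eps / 2%:R * _ * _ = E eps / 2%:R * #|V|%:R ^+ 5); last by rewrite -mulrA -exprD.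
  move: (#|faces L|%:R * _) (#|faces L|%:R * (_ * _)) (#|V|%:R ^+ 5) => a b d.
  by move=> h l0; lra.
have kapE : ((c eps ^+ 8 - 11%:R * e1 eps) * db eps ^+ 11 - 4%:R * ga eps) * da eps ^+ 4 = kap eps.
  by rewrite /kap /e1 /ga; field.
have hslit r x : #|[set x' | slit v0 (rotn r L) x x']|%:R * kap eps <= 1.
  rewrite -kapE; apply: (@card_slit R V v0 (rotn r T) (rotn r Ta) (rotn r Tb) (rotn r L)
     _ _ _ _ _ _ _ _ _ _ _ _ _ _ x) => //; rewrite ?ltW //.
  - exact: partial_latin_rotn.
  - exact: sub3_rotn.
  - exact: sub3_rotn.
  - by apply: face_octs_rotn => a b d /and5P[].
  - move=> r' a b d; rewrite !rotnD; exact: select_edge.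
  - by move=> r'; rewrite !rotnD.
  - move=> x'; rewrite inE => /existsP[D /and3P[h1 /eqP h2 /eqP h3]].
    by exists D.
pose F (p : 'I_3 * V) := #|[set x' | slit v0 (rotn p.1 L) p.2 x']|.
pose d := (\max_p F p)%N.
have hd r x : (#|[set x' | slit v0 (rotn r L) x x']| <= d)%N.
  rewrite (rotn_mod3 r); have hr : (r %% 3 < 3)%N by rewrite ltn_pmod.
  exact: (@bigop.leq_bigmax _ F (Ordinal hr, x)).
have dk : d%:R * kap eps <= 1.
  have [|p hp] := @bigop.eq_bigmax _ F; first by rewrite card_prod card_ord muln_gt0.
  by rewrite /d hp; apply: hslit.
have [L' [sL' cL' nL']] := sparsify hd.
exists L'; split=> //; first exact: sub3_trans sL' sL.
apply: (@le_trans _ _ (E eps * kap eps ^+ 3 / 16%:R * #|V|%:R ^+ 2)).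
  by rewrite ler_pM2r ?exprn_gt0 //; apply: le_trans (hM1 _ he); apply: eXle; rewrite leq_addr.
have kap1 : kap eps <= 1.
  have dv (a : R) j : 0 <= a <= 1 -> 0 <= a / j.+1%:R <= 1.
    case/andP=> a0 a1; apply/andP; split; first by rewrite divr_ge0 ?ler0n.
    rewrite ler_pdivrMr ?ltr0n // mul1r.
    by apply: (le_trans a1); rewrite ler1n.
  have ml (a b : R) : 0 <= a <= 1 -> 0 <= b <= 1 -> 0 <= a * b <= 1.
    by move=> /andP[a0 a1] /andP[b0 b1]; rewrite mulr_ge0 //= mulr_ile1.
  have pw (a : R) j : 0 <= a <= 1 -> 0 <= a ^+ j <= 1.
    by move=> /andP[a0 a1]; rewrite exprn_ge0 //= exprn_ile1.
  have he01 : 0 <= eps <= 1 by rewrite ltW.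
  have hE01 : 0 <= E eps <= 1 by apply: (pw); apply: (pw).
  have hc01 : 0 <= c eps <= 1 by apply: (dv).
  have hdb01 : 0 <= db eps <= 1.
    by apply: (ml) => //; apply: (dv); apply: (ml) => //; apply: (dv); apply: pw.
  have hcd : 0 <= c eps ^+ 8 * db eps ^+ 11 <= 1 by apply: (ml); apply: pw.
  have /andP[_ //] : 0 <= kap eps <= 1.
  apply: (ml); first exact: dv.
  by apply: (pw); apply: (ml); [exact: dv|exact: pw].
have d2 : d.+1%:R * kap eps <= 2%:R by rewrite -natr1 mulrDl mul1r; lra.
have h8 : (d.+1%:R * kap eps) ^+ 3 <= 2%:R ^+ 3.
  have dk0 : 0 <= d.+1%:R * kap eps by rewrite mulr_ge0 ?ler0n // ltW.
  by rewrite lerXn2r // nnegrE // ler0n.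
rewrite exprMn in h8.
have cR : #|faces L|%:R <= d.+1%:R ^+ 3 * #|faces L'|%:R :> R by rewrite -natrX -natrM ler_nat.
have k3 : 0 <= kap eps ^+ 3 by rewrite exprn_ge0 // ltW.
have h1 := ler_wpM2r k3 (le_trans hL cR).
have h2 := ler_wpM2r (ler0n R #|faces L'|) h8.
have h3 : d.+1%:R ^+ 3 * #|faces L'|%:R * kap eps ^+ 3 = d.+1%:R ^+ 3 * kap eps ^+ 3 * #|faces L'|%:R by ring.
have h4 : E eps / 2%:R * #|V|%:R ^+ 2 * kap eps ^+ 3 = 8%:R * (E eps * kap eps ^+ 3 / 16%:R * #|V|%:R ^+ 2) by field.
rewrite h3 h4 in h1.
have := le_trans h1 h2; rewrite -natrX; lra.
Qed.

End Dense.

Lemma dense_case (R : realFieldType) :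
  exists M : nat, forall (V : finType) (v0 : V) (T : rel3 V) (eps : R),
    0 < eps <= 2%:R^-1 -> partial_latin T ->
    eps * #|V|%:R ^+ 5 <= #|octs v0 T|%:R -> 1 <= eps ^+ M * #|V|%:R ->
  exists L, [/\ sub3 L T, eps ^+ M * #|V|%:R ^+ 2 <= #|faces L|%:R &
    forall r x x', slit v0 (rotn r L) x x' -> x = x'].
Proof.
apply: (@dense_case_of_thinning R (47 ^ 3)); first by rewrite expn_gt0.
by move=> V v0 V0 T eps g; apply: thinning_poly3.
Qed.

(** * Almost all octahedra *)

Section NearOne.

Variables (R : realFieldType) (V : finType) (v0 : V).
Hypothesis V_gt0 : (0 < #|V|)%N.

Local Notation N := (#|V|%:R : R).
Local Notation rdl := (readl v0).
Local Notation octs := (octs v0).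

Let N_gt0 : 0 < N. Proof. by rewrite ltr0n. Qed.

Section Counts.

Variables (T : rel3 V) (tau kap : R).
Hypotheses (TP : partial_latin T) (kap_gt0 : 0 < kap).
Hypothesis octs_ge : (1 - tau) * N ^+ 5 <= #|octs T|%:R.

Lemma card_pair_octs_le (p : 5.-tuple V) : #|pair_octs v0 T p|%:R <= N ^+ 2.
Proof.
have sp := size_tuple p; rewrite -natrX ler_nat.
apply: (@card_determined V _ _ (fun q : 7.-tuple V => rdl (p ++ q)) T pair_pat
   (iota 0 5) [:: 5; 6]%N (iota 0 12)) => //.
- by move=> q; rewrite inE.
- move=> q q' _ _ i; rewrite mem_iota => /andP[_ hi].
  by rewrite /readl !nth_cat sp hi.
- move=> q q' _ _ h; apply: eq_from_tnth => i; rewrite !(tnth_nth v0).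
  have hi : (5 + i)%N \in iota 0 12 by rewrite mem_iota; have := ltn_ord i; lia.
  by have := h _ hi; rewrite /readl !nth_cat sp ltnNge leq_addr /= addKn.
Qed.

(** At most [N ^+ 3] pairs lie in at most [N ^+ 2] octahedra each. The total falls short of [N ^+ 5]
    by at most [tau * N ^+ 5], and every bad pair accounts for a deficit of [kap * N ^+ 2]. *)
Lemma bad_pairs_near : #|bad_pairs v0 T T (1 - kap)|%:R <= tau / kap * N ^+ 3.
Proof.
pose Pp := [set p : 5.-tuple V | sat T [:: (0, 1, 2); (0, 3, 4)]%N (rdl p)].
pose bad := bad_pairs v0 T T (1 - kap).
pose idx := [:: 0; 1; 2; 6; 9]%N.
pose f (o : 12.-tuple V) := lab (rdl o) idx 5.
have fib p : (#|[set o in octs T | f o == p]| <= #|pair_octs v0 T p|)%N.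
  pose s := [:: 3; 4; 5; 7; 8; 10; 11]%N.
  rewrite -(@card_in_imset _ _ (fun o : 12.-tuple V => lab (rdl o) s 7)).
    apply/subset_leq_card/subsetP => _ /imsetP[o /setIdP[ho /eqP <-] ->]; rewrite inE.
    have : sat T (place 0 pair_pat (idx ++ s)) (rdl o).
      apply/allP => u hu; move: ho; rewrite inE => /allP; apply.
      by move: u hu; apply/allP; vm_compute.
    rewrite sat_place; apply: etrans; apply: (@sat_eq _ 12) => // i hi.
    rewrite [LHS]/readl nth_cat size_tuple [in RHS]nth_cat; case: ltnP => hi5.
      by rewrite -[LHS]/(rdl _ _) nth_lab.
    by rewrite -[LHS]/(rdl _ _) nth_lab //; lia.
  move=> o o' /setIdP[_ /eqP h] /setIdP[_ /eqP h'] e.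
  apply: eq_from_tnth => i; rewrite !(tnth_nth v0).
  have : (i : nat) \in idx ++ s.
    have /allP h12 : all (mem (idx ++ s)) (iota 0 12) by [].
    by apply: h12; rewrite mem_iota ltn_ord.
  rewrite mem_cat => /orP[].
    exact: (nth_mem_lab v0 (erefl : size idx = 5%N) (etrans h (esym h'))).
  exact: (nth_mem_lab v0 (erefl : size s = 7%N) e).
have fP o : o \in octs T -> f o \in Pp.
  rewrite !inE => ho; have : sat T (place 0 [:: (0, 1, 2); (0, 3, 4)]%N idx) (rdl o).
    by apply/allP => u hu; apply: (allP ho); move: u hu; apply/allP; vm_compute.
  rewrite sat_place; apply: etrans; apply: (@sat_eq _ 5) => // i hi.
  by rewrite nth_lab.
have hb : #|[set o in octs T | f o \in bad]|%:R <= #|bad|%:R * ((1 - kap) * N ^+ 2).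
  apply: (@card_le_fibers R _ _ f) => [o /setIdP[]//|p /setIdP[_ /ltW]].
  apply: le_trans; rewrite ler_nat.
  apply: leq_trans (fib p); apply/subset_leq_card/subsetP => o /setIdP[/setIdP[h _] e].
  by apply/setIdP.
have hg : #|[set o in octs T | f o \notin bad]|%:R <= #|Pp :\: bad|%:R * N ^+ 2.
  apply: (@card_le_fibers R _ _ f) => [o /setIdP[ho hn]|p _].
    by rewrite in_setD hn fP.
  apply: le_trans (card_pair_octs_le p); rewrite ler_nat.
  apply: leq_trans (fib p); apply/subset_leq_card/subsetP => o /setIdP[/setIdP[h _] e].
  by apply/setIdP.
have hsplit : #|octs T|%:R <= #|bad|%:R * ((1 - kap) * N ^+ 2) + #|Pp :\: bad|%:R * N ^+ 2.
  apply: le_trans (lerD hb hg); rewrite -natrD ler_nat.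
  rewrite -(cardsID [set o | f o \in bad] (octs T)).
  by apply: leq_add; apply/subset_leq_card/subsetP => o; rewrite !inE; [|rewrite andbC].
have hP : #|bad|%:R + #|Pp :\: bad|%:R <= N ^+ 3.
  apply: le_trans (card_pairs R v0 TP); rewrite -natrD ler_nat -/Pp.
  have hsub : bad \subset Pp by apply/subsetP => p; rewrite !inE => /andP[].
  by rewrite -(cardsID bad Pp) (setIidPr hsub).
have N2 : 0 < N ^+ 2 by rewrite exprn_gt0.
rewrite mulrAC ler_pdivlMr // -(ler_pM2r N2) -/bad.
have h1 := le_trans octs_ge hsplit; have h2 := ler_wpM2r (ltW N2) hP.
have e5 : N ^+ 5 = N ^+ 3 * N ^+ 2 by rewrite -exprD.
rewrite e5 in h1; move: h1 h2; move: (#|bad|%:R) (#|Pp :\: bad|%:R) (N ^+ 3) (N ^+ 2).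
by move=> a b n3 n2 h1 h2; lra.
Qed.

Definition fill5 := [:: 0; 3; 2; 9; 10]%N.
(** Two x-edges and two z-edges at one apex and one z-edge at the other determine an octahedron, so
    nearly all 5-tuples of labels arise in this way. *)
Definition good5 := [set lab (rdl o) fill5 5 | o : 12.-tuple V in octs T].

Lemma card_bad5 : #|~: good5|%:R <= tau * N ^+ 5.
Proof.
have hg : #|good5| = #|octs T|.
  apply: card_in_imset => o o'; rewrite !inE => ho ho' e.
  apply: eq_from_tnth => i; rewrite !(tnth_nth v0).
  have hi : (i : nat) \in iota 0 12 by rewrite mem_iota ltn_ord.
  apply: (@determinesP V T oct_pat fill5 (iota 0 12)) hi => //.
  by move=> k hk; apply: (nth_mem_lab v0 (erefl : size fill5 = 5%N) e).
have := cardsC good5; rewrite card_tuple => /(congr1 (fun n => n%:R : R)).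
rewrite natrD natrX hg => e; have := octs_ge; rewrite -e.
move: (#|octs T|%:R) (#|~: good5|%:R) => a b; lra.
Qed.

Lemma good5_fill x x' zs z zt u w : [tuple x; x'; zs; z; zt] \in good5 ->
    T x u z -> T x' w z ->
  exists a b xh xh' zh, [/\ T x a zs, T x' b zs, T xh a zt, T xh' b zt & T xh u zh /\ T xh' w zh].
Proof.
move=> /imsetP[o]; rewrite inE => ho e hu hw; have [hz hy hx] := TP.
have E k : (k < 5)%N -> rdl [tuple x; x'; zs; z; zt] k = rdl o (nth 0%N fill5 k).
  by move=> hk; rewrite e nth_lab.
have ex : x = rdl o 0 := E 0%N isT; have ex' : x' = rdl o 3 := E 1%N isT.
have ezs : zs = rdl o 2 := E 2%N isT; have ez : z = rdl o 9 := E 3%N isT.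
have ezt : zt = rdl o 10 := E 4%N isT.
have h p : p \in oct_pat -> T (rdl o p.1.1) (rdl o p.1.2) (rdl o p.2) by move: p; apply/allP.
have eu : rdl o 6 = u.
  by apply: (hy x _ _ z _ hu); rewrite ex ez; exact: (h (0, 6, 9)%N).
have ew : rdl o 8 = w.
  by apply: (hy x' _ _ z _ hw); rewrite ex' ez; exact: (h (3, 8, 9)%N).
exists (rdl o 1), (rdl o 7), (rdl o 4), (rdl o 5), (rdl o 11); rewrite -eu -ew ex ex' ezs ezt.
split; [exact: (h (0, 1, 2)%N)|exact: (h (3, 7, 2)%N)|exact: (h (4, 1, 10)%N)|exact: (h (5, 7, 10)%N)|].
by split; [exact: (h (4, 6, 11)%N)|exact: (h (5, 8, 11)%N)].
Qed.

(** The rim is divided into a fan of five quadrilaterals with a common corner at the outer end of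
    edge 11. A good tuple gives an octahedron over each. Neighbouring ones share a y-edge of the
    fan, which together with the common [zt] forces the same new x-edge, so all five have the same
    new apex. *)
Lemma star_fill (l : nat -> V) zt : sat T star_pat l ->
    (forall i, (i < 5)%N -> [tuple l (2 * i)%N; l (2 * i + 2)%N; l 11%N; l (2 * i + 1)%N; zt] \in good5) ->
  exists q : 12.-tuple V, rdl q 11 = zt /\
    sat T star_pat (fun i => if (i < 12)%N then rdl q i else l i).
Proof.
move=> hs hg; have [hz hy hx] := TP.
have h p : p \in star_pat -> T (l p.1.1) (l p.1.2) (l p.2) by move: p; apply/allP.
have [a0 [b0 [x0 [x0' [z0 [A0 B0 C0 D0 [E0 F0]]]]]]] :=
  good5_fill (hg 0%N isT) (h (0, 12, 1)%N isT) (h (2, 13, 1)%N isT).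
have [a1 [b1 [x1 [x1' [z1 [A1 B1 C1 D1 [E1 F1]]]]]]] :=
  good5_fill (hg 1%N isT) (h (2, 14, 3)%N isT) (h (4, 15, 3)%N isT).
have [a2 [b2 [x2 [x2' [z2 [A2 B2 C2 D2 [E2 F2]]]]]]] :=
  good5_fill (hg 2%N isT) (h (4, 16, 5)%N isT) (h (6, 17, 5)%N isT).
have [a3 [b3 [x3 [x3' [z3 [A3 B3 C3 D3 [E3 F3]]]]]]] :=
  good5_fill (hg 3%N isT) (h (6, 18, 7)%N isT) (h (8, 19, 7)%N isT).
have [a4 [b4 [x4 [x4' [z4 [A4 B4 C4 D4 [E4 F4]]]]]]] :=
  good5_fill (hg 4%N isT) (h (8, 20, 9)%N isT) (h (10, 21, 9)%N isT).
have e1 : x0' = x1 by have eb := hy _ _ _ _ A1 B0; rewrite eb in C1; exact: hx D0 C1.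
have e2 : x1' = x2 by have eb := hy _ _ _ _ A2 B1; rewrite eb in C2; exact: hx D1 C2.
have e3 : x2' = x3 by have eb := hy _ _ _ _ A3 B2; rewrite eb in C3; exact: hx D2 C3.
have e4 : x3' = x4 by have eb := hy _ _ _ _ A4 B3; rewrite eb in C4; exact: hx D3 C4.
have ea : a0 = l 23%N := hy _ _ _ _ A0 (h (0, 23, 11)%N isT).
have eb : b4 = l 22%N := hy _ _ _ _ B4 (h (10, 22, 11)%N isT).
exists [tuple x0; z0; x1; z1; x2; z2; x3; z3; x4; z4; x4'; zt]; split=> //.
rewrite /sat /= E0 E1 E2 E3 E4 -{1}e1 F0 -{1}e2 F1 -{1}e3 F2 -{1}e4 F3 F4.
by rewrite -ea -eb C0 D4.
Qed.

Definition starK i := [:: 2 * i; 2 * i + 2; 11; 2 * i + 1]%N.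
Definition starG i := [seq j <- iota 0 12 | j \notin starK i].

(** A bad star misses more than [kap * N] values of [zt], and for each of them one of the five
    tuples is not good. *)
Lemma bad_stars_near : #|bad_stars v0 T T (1 - kap)|%:R <= 5%:R * tau / kap * N ^+ 12.
Proof.
pose st := [set s : 24.-tuple V | sat T star_pat (rdl s)].
pose lb (u : 24.-tuple V * V) i : 5.-tuple V := [tuple rdl u.1 (2 * i)%N;
   rdl u.1 (2 * i + 2)%N; rdl u.1 11%N; rdl u.1 (2 * i + 1)%N; u.2].
pose F (i : 'I_5) := [set u : 24.-tuple V * V | (u.1 \in st) && (lb u i \notin good5)].
have hF i : #|F i|%:R <= tau * N ^+ 13.
  apply: (@le_trans _ _ (#|~: good5|%:R * N ^+ 8)); last first.
    rewrite -[13%N]/(5 + 8)%N exprD mulrA; apply: ler_wpM2r card_bad5.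
    by rewrite exprn_ge0 // ltW.
  apply: (@card_le_fibers R _ _ (fun u => lb u i)) => [u|p _].
    by rewrite !inE => /andP[].
  have /allP /(_ i) := isT : all (fun i => (size (starG i) == 8%N) &&
    determines star_pat (starK i ++ starG i) (iota 0 24)) (iota 0 5).
  rewrite mem_iota ltn_ord => /(_ isT) /andP[/eqP sG hdet].
  rewrite -natrX ler_nat -[X in (_ <= _ ^ X)%N]sG.
  have keq u u' : lb u i = p -> lb u' i = p -> u.2 = u'.2 /\ forall j, j \in starK i -> rdl u.1 j = rdl u'.1 j.
    move=> e e'; have := congr1 (@tval _ _) (etrans e (esym e')); rewrite /lb /= => -[k1 k2 k3 k4 k5].
    by split=> // j; rewrite !inE => /or4P[] /eqP ->.
  apply: (@card_determined V _ _ (fun u : 24.-tuple V * V => rdl u.1) T star_pat (starK i) (starG i) (iota 0 24)) => //.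
  - by move=> u /setIdP[]; rewrite inE => /andP[]; rewrite inE.
  - move=> u u' /setIdP[_ /eqP hu] /setIdP[_ /eqP hu'] j.
    by case: (keq _ _ hu hu') => _; apply.
  - move=> u u' /setIdP[_ /eqP hu] /setIdP[_ /eqP hu'] h.
    rewrite [u]surjective_pairing [u']surjective_pairing; congr pair; last by case: (keq _ _ hu hu').
    apply: eq_from_tnth => j; rewrite !(tnth_nth v0); apply: h.
    by rewrite mem_iota ltn_ord.
pose F0 := \bigcup_i F i.
have lo : #|bad_stars v0 T T (1 - kap)|%:R * (kap * N) <= #|F0|%:R.
  apply: (@card_ge_fibers R _ _ fst) => s; rewrite inE => /andP[hs hlt].
  pose hit := [set rdl q 11 | q : 12.-tuple V in centres v0 T (drop 12 s)].
  apply: (@le_trans _ _ #|~: hit|%:R).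
    have := cardsC hit => /(congr1 (fun n => n%:R : R)); rewrite natrD.
    have : #|hit|%:R <= #|centres v0 T (drop 12 s)|%:R :> R by rewrite ler_nat leq_imset_card.
    move: hlt; move: (#|hit|%:R) (#|~: hit|%:R) (#|centres v0 T _|%:R) => a b d; lra.
  rewrite ler_nat -(card_imset _ (fun B B' (e : (s, B) = (s, B')) => congr1 snd e : B = B')).
  apply/subset_leq_card/subsetP => _ /imsetP[zt hzt ->]; rewrite in_set eqxx andbT.
  apply: contraT => hn; have := hzt; rewrite inE => /negP[].
  have [i hi|q [hq hqs]] := @star_fill (rdl s) zt hs.
    apply: contraT => hb; case/negP: hn; apply/bigcupP; exists (Ordinal hi) => //.
    by rewrite inE inE hs.
  apply/imsetP; exists q => //; rewrite inE; move: hqs; apply: etrans.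
  apply: (@sat_eq _ 24) => [|i hi]; first by vm_compute.
  rewrite /readl nth_cat size_tuple; case: ltnP => // h12.
  by rewrite nth_drop subnKC.
have up : #|F0|%:R <= 5%:R * (tau * N ^+ 13).
  apply: (@le_trans _ _ (\sum_i #|F i|%:R)).
    rewrite -natr_sum ler_nat /F0.
    apply: (big_ind2 (fun (A : {set 24.-tuple V * V}) n => (#|A| <= n)%N)); rewrite ?cards0 // => A m B n hA hB.
    by apply: leq_trans (leq_add hA hB); rewrite cardsU leq_subr.
  rewrite -[5%:R in X in _ <= X](_ : #|'I_5|%:R = _); last by rewrite card_ord.
  by rewrite mulr_natl -sumr_const; apply: ler_sum.
rewrite mulrAC ler_pdivlMr // -(ler_pM2r N_gt0) -mulrA; apply: (le_trans lo).
by apply: (le_trans up); rewrite -mulrA -exprSr mulrA.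
Qed.

End Counts.

(** With [T] in all three roles and thresholds [1 - 1/128] the proportion of fillings exceeds 1/2,
    so [x'] is unique. In [2 ^+ 23], bad edges account for [3 * 2 ^+ 14], rounded up to [2 ^+ 16] by
    the further loss [tau], and the threshold for a factor 128. *)
Lemma near_case (T : rel3 V) (tau : R) : partial_latin T -> 0 <= tau <= 2%:R ^- 14 ->
    (1 - tau) * N ^+ 5 <= #|octs T|%:R ->
  exists L, [/\ sub3 L T, (1 - 2%:R ^+ 23 * tau) * N ^+ 2 <= #|faces L|%:R &
    forall r x x', slit v0 (rotn r L) x x' -> x = x'].
Proof.
move=> TP /andP[t0 ht] hoct; pose k : R := 128%:R^-1.
have k0 : 0 < k by rewrite invr_gt0 ltr0n.
have k1 : 0 <= 1 - k by rewrite subr_ge0 invf_le1 ?ltr0n ?ler1n.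
have hoctr r : (1 - tau) * N ^+ 5 <= #|octs (rotn r T)|%:R by rewrite octs_rotn.
have bp r := bad_pairs_near (partial_latin_rotn r TP) k0 (hoctr r).
have bs r := bad_stars_near (partial_latin_rotn r TP) k0 (hoctr r).
pose L := select v0 T T (1 - k) (1 - k) k.
have sL : sub3 L T by move=> x y z /and5P[].
exists L; split=> //.
  have := le_trans hoct (card_octs_select V_gt0 TP k1 k0 bp); rewrite -/L.
  have N3 : 0 < N ^+ 3 by rewrite exprn_gt0.
  have e14 : 3%:R * (tau / k / k) * N ^+ 5 = (3%:R * 2%:R ^+ 14) * tau * N ^+ 2 * N ^+ 3.
    by rewrite /k; field.
  have e23 : 2%:R ^+ 23 = 2%:R ^+ 14 * 512%:R :> R by ring.
  have p1 : 1 <= 2%:R ^+ 14 :> R by rewrite exprn_ege1 ?ler1n.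
  have tN : tau <= 2%:R ^+ 14 * tau by rewrite ler_peMl.
  rewrite e14 e23 -[5%N]/(2 + 3)%N exprD => h; rewrite -(ler_pM2r N3).
  have N23 : 0 <= N ^+ 2 * N ^+ 3 by rewrite mulr_ge0 ?exprn_ge0 ?ler0n.
  have tNN := ler_wpM2r N23 tN; have tNN0 := mulr_ge0 t0 N23.
  move: h tNN tNN0; rewrite /k.
  move: (#|faces L|%:R) (N ^+ 2) (N ^+ 3) (2%:R ^+ 14) => l n2 n3 p.
  by move=> h1 h2 h3; lra.
have hslit r x : #|[set x' | slit v0 (rotn r L) x x']|%:R *
    ((((1 - k) ^+ 8 - 11%:R * k) * (1 - k) ^+ 11 - 4%:R * (5%:R * tau / k)) * (1 - k) ^+ 4) <= 1.
  apply: (@card_slit R V v0 (rotn r T) (rotn r T) (rotn r T) (rotn r L)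
     _ _ _ _ _ _ _ _ _ _ _ _ _ _ x) => //.
  - exact: partial_latin_rotn.
  - by apply: face_octs_rotn => a b d /and5P[].
  - move=> r' a b d; rewrite !rotnD; exact: select_edge.
  - by move=> r'; rewrite !rotnD.
  - move=> x'; rewrite inE => /existsP[D /and3P[h1 /eqP h2 /eqP h3]].
    by exists D.
move=> r x x' hs; apply/eqP; apply: contraT => nx.
(* Eight copies of one face show that [x] is itself a possible value, so [x' != x] would be a second
   one. *)
have hxx : slit v0 (rotn r L) x x.
  case/existsP: hs => D /and3P[/allP hD /eqP h3 _].
  have hf : rotn r L (rdl D 3) (rdl D 7) (rdl D 11) := hD (3, 7, 11)%N isT.
  rewrite h3 in hf.
  apply/existsP; exists [tuple x; x; x; x; x; rdl D 7; rdl D 7; rdl D 7; rdl D 7;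
    rdl D 11; rdl D 11; rdl D 11; rdl D 11].
  by apply/and3P; split; [apply/and5P; split=> //; apply/and5P; split|exact: eqxx|exact: eqxx].
have h2 : 2%:R <= #|[set x' | slit v0 (rotn r L) x x']|%:R :> R.
  rewrite ler_nat -[2%N](_ : #|[set x; x']| = _); last by rewrite cards2 nx.
  by apply/subset_leq_card/subsetP => y; rewrite !inE => /orP[] /eqP ->.
have := hslit r x; set kk := (X in _ * X <= 1).
have hk : 2%:R^-1 < kk.
  have bern j : 1 - j%:R * k <= (1 - k) ^+ j.
    elim: j => [|j IH]; first by rewrite mul0r subr0.
    rewrite exprS; apply: le_trans (ler_wpM2l k1 IH).
    have kk2 : 0 <= j%:R * k * k by rewrite !mulr_ge0 ?ler0n // ltW.
    by rewrite -natr1; move: (j%:R) kk2 => a kk2; lra.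
  have t20 : 4%:R * (5%:R * tau / k) <= 5%:R / 32%:R.
    apply: (@le_trans _ _ (2560%:R * 2%:R ^- 14)); first by rewrite /k; lra.
    by rewrite le_eqVlt; apply/orP; left; apply/eqP; field.
  have h8 := bern 8%N; have h11 := bern 11%N; have h4 := bern 4%N.
  have pq : 3%:R / 4%:R <= ((1 - k) ^+ 8 - 11%:R * k) * (1 - k) ^+ 11.
    apply: (@le_trans _ _ (109%:R / 128%:R * (117%:R / 128%:R))); first lra.
    by apply: ler_pM; move: h8 h11; rewrite /k; lra.
  rewrite /kk; apply: (@lt_le_trans _ _ (19%:R / 32%:R * (31%:R / 32%:R))); first lra.
  by apply: ler_pM; move: h4; rewrite /k; lra.
have kk0 : 0 <= kk by apply: ltW; apply: lt_trans hk; rewrite invr_gt0 ltr0n.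
have := ler_wpM2r kk0 h2; move: (#|_|%:R * kk) => a; lra.
Qed.

End NearOne.

(** * From complexes to relations *)

Section Transport.

Variables (n : nat) (X Y Z : finType).
Hypotheses (hX : #|X| = n) (hY : #|Y| = n) (hZ : #|Z| = n).
Variables (v0 : 'I_n) (K : {set face X Y Z}).

Local Notation rdl := (readl v0).

Let toV (A : finType) (h : #|A| = n) (x : A) : 'I_n := cast_ord h (enum_rank x).
Let ofV (A : finType) (h : #|A| = n) (i : 'I_n) : A := enum_val (cast_ord (esym h) i).

Let toVK (A : finType) (h : #|A| = n) : cancel (toV h) (ofV h).
Proof. by move=> x; rewrite /ofV /toV cast_ordK enum_rankK. Qed.

Let ofVK (A : finType) (h : #|A| = n) : cancel (ofV h) (toV h).
Proof. by move=> i; rewrite /ofV /toV enum_valK cast_ordKV. Qed.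

Definition rel_of_complex : rel3 'I_n := fun a b c => (ofV hX a, ofV hY b, ofV hZ c) \in K.
Definition complex_of_rel (L : rel3 'I_n) : {set face X Y Z} :=
  [set f | L (toV hX f.1.1) (toV hY f.1.2) (toV hZ f.2)].

Local Notation T := rel_of_complex.

Let in_T f : f \in K -> T (toV hX f.1.1) (toV hY f.1.2) (toV hZ f.2).
Proof. by case: f => [[x y] z] /= h; rewrite /T !toVK. Qed.

Lemma complex_of_rel_sub L : sub3 L T -> complex_of_rel L \subset K.
Proof. by move=> h; apply/subsetP => -[[x y] z]; rewrite inE => /h; rewrite /T !toVK. Qed.

Lemma card_complex_of_rel L : (#|faces L| <= #|complex_of_rel L|)%N.
Proof.
pose g (t : 'I_n * 'I_n * 'I_n) : face X Y Z := (ofV hX t.1.1, ofV hY t.1.2, ofV hZ t.2).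
have ginj : injective g.
  move=> [[a b] c] [[a' b'] c'] [/(can_inj (ofVK hX)) -> /(can_inj (ofVK hY)) ->].
  by move=> /(can_inj (ofVK hZ)) ->.
rewrite -(card_imset _ ginj); apply/subset_leq_card/subsetP => _ /imsetP[t ht ->].
by rewrite inE /= !ofVK; rewrite inE in ht.
Qed.

Lemma partial_latin_complex : linear_complex K -> partial_latin T.
Proof.
move=> hK.
have two (e1 e2 : edge X Y Z) f f' : e1 != e2 -> f \in K -> f' \in K ->
    lies_in e1 f -> lies_in e2 f -> lies_in e1 f' -> lies_in e2 f' -> f = f'.
  move=> ne fK fK' h1 h2 h1' h2'; have /card_le1P h := hK _ _ ne.
  have hf : f \in [set f in K | lies_in e1 f && lies_in e2 f] by rewrite inE fK h1 h2.
  have hf' : f' \in [set f in K | lies_in e1 f && lies_in e2 f] by rewrite inE fK' h1' h2'.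
  by have := h f hf f'; rewrite hf' => /esym /eqP.
have lx f : lies_in (inl (inl f.1.1) : edge X Y Z) f by apply/existsP; exists (@Ordinal 3 0 isT); exact: eqxx.
have ly f : lies_in (inl (inr f.1.2) : edge X Y Z) f by apply/existsP; exists (@Ordinal 3 1 isT); exact: eqxx.
have lz f : lies_in (inr f.2 : edge X Y Z) f by apply/existsP; exists (@Ordinal 3 2 isT); exact: eqxx.
split=> [x y z z' h h'|x y y' z h h'|x x' y z h h'].
- apply: (can_inj (ofVK hZ)).
  have := two (inl (inl (ofV hX x))) (inl (inr (ofV hY y))) _ _ isT h h' (lx _) (ly _) (lx _) (ly _).
  by case.
- apply: (can_inj (ofVK hY)).
  have := two (inl (inl (ofV hX x))) (inr (ofV hZ z)) _ _ isT h h' (lx _) (lz _) (lx _) (lz _).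
  by case.
- apply: (can_inj (ofVK hX)).
  have := two (inl (inr (ofV hY y))) (inr (ofV hZ z)) _ _ isT h h' (ly _) (lz _) (ly _) (lz _).
  by case.
Qed.

(** Coordinates of the cube with origin [w], so that a slit may be assumed to lie at the origin. *)
Definition corner (w : cube) a b c : cube := [ffun q : 'I_3 => w q (+) nth false [:: a; b; c] q].

Let o0 : 'I_3 := @Ordinal 3 0 isT.
Let o1 : 'I_3 := @Ordinal 3 1 isT.
Let o2 : 'I_3 := @Ordinal 3 2 isT.

Let ord3P (P : 'I_3 -> Prop) : P o0 -> P o1 -> P o2 -> forall j, P j.
Proof.
move=> h0 h1 h2 [[|[|[|j]]] hj] //; [have -> : Ordinal hj = o0|have -> : Ordinal hj = o1
  |have -> : Ordinal hj = o2] => //; exact: val_inj.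
Qed.

Lemma flip_corner0 w a b c : flip o0 (corner w a b c) = corner w (~~ a) b c.
Proof. by apply/ffunP; apply: ord3P; rewrite !ffunE -val_eqE /=; case: (w _) a b c => [] [] [] []. Qed.
Lemma flip_corner1 w a b c : flip o1 (corner w a b c) = corner w a (~~ b) c.
Proof. by apply/ffunP; apply: ord3P; rewrite !ffunE -val_eqE /=; case: (w _) a b c => [] [] [] []. Qed.
Lemma flip_corner2 w a b c : flip o2 (corner w a b c) = corner w a b (~~ c).
Proof. by apply/ffunP; apply: ord3P; rewrite !ffunE -val_eqE /=; case: (w _) a b c => [] [] [] []. Qed.

Lemma corner_id w : corner w false false false = w.
Proof. by apply/ffunP; apply: ord3P; rewrite ffunE /= addbF. Qed.

Lemma cube_corner (w0 w : cube) : exists a b c, w = corner w0 a b c.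
Proof.
exists (w0 o0 (+) w o0), (w0 o1 (+) w o1), (w0 o2 (+) w o2).
by apply/ffunP; apply: ord3P; rewrite ffunE /= addKb.
Qed.

Lemma coincide0 (t : {ffun cube -> face X Y Z}) w :
  coincide t o0 w = ((t w).1.1 == (t (flip o0 w)).1.1).
Proof. by []. Qed.
Lemma coincide1 (t : {ffun cube -> face X Y Z}) w :
  coincide t o1 w = ((t w).1.2 == (t (flip o1 w)).1.2).
Proof. by []. Qed.
Lemma coincide2 (t : {ffun cube -> face X Y Z}) w :
  coincide t o2 w = ((t w).2 == (t (flip o2 w)).2).
Proof. by []. Qed.

Lemma card_octahedra : (#|octahedra K| <= #|octs v0 T|)%N.
Proof.
pose w0 : cube := [ffun=> false].
pose cb a b c := corner w0 a b c.
(* Flipping the first coordinate preserves the x-edge and hence its ends a and b, so this coordinate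
   [k] is the index of c; likewise the second, [i], is that of a and the third, [j], that of b. *)
pose x (t : {ffun cube -> face X Y Z}) i j := toV hX (t (cb false i j)).1.1.
pose y (t : {ffun cube -> face X Y Z}) j k := toV hY (t (cb k false j)).1.2.
pose z (t : {ffun cube -> face X Y Z}) i k := toV hZ (t (cb k i false)).2.
pose g t : 12.-tuple 'I_n := [tuple x t false false; y t false false; z t false false;
   x t false true; x t true false; x t true true; y t false true; y t true false; y t true true;
   z t false true; z t true false; z t true true].
have co (t : {ffun cube -> face X Y Z}) : octahedron K t -> forall i j k,
   [/\ t (cb k i j) \in K, toV hX (t (cb k i j)).1.1 = x t i j,
       toV hY (t (cb k i j)).1.2 = y t j k & toV hZ (t (cb k i j)).2 = z t i k].
  case/andP=> /forallP hin /forallP hco i j k; split=> //.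
  - case: k => //; rewrite /x; congr toV; apply/eqP.
    by have /forallP /(_ (cb true i j)) := hco o0; rewrite coincide0 flip_corner0.
  - case: i => //; rewrite /y; congr toV; apply/eqP.
    by have /forallP /(_ (cb k true j)) := hco o1; rewrite coincide1 flip_corner1.
  - case: j => //; rewrite /z; congr toV; apply/eqP.
    by have /forallP /(_ (cb k i true)) := hco o2; rewrite coincide2 flip_corner2.
have ginj : {in octahedra K &, injective g}.
  move=> t t'; rewrite !inE => /co ht /co ht' e.
  have E q : rdl (g t) q = rdl (g t') q by rewrite e.
  have Ex i j : x t i j = x t' i j.
    by case: i; case: j; [exact: (E 5%N)|exact: (E 4%N)|exact: (E 3%N)|exact: (E 0%N)].
  have Ey i j : y t i j = y t' i j.
    by case: i; case: j; [exact: (E 8%N)|exact: (E 7%N)|exact: (E 6%N)|exact: (E 1%N)].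
  have Ez i j : z t i j = z t' i j.
    by case: i; case: j; [exact: (E 11%N)|exact: (E 10%N)|exact: (E 9%N)|exact: (E 2%N)].
  apply/ffunP => w; have [k [i [j ->]]] := cube_corner w0 w.
  have [_ hx hy hz] := ht i j k; have [_ hx' hy' hz'] := ht' i j k.
  have ex : (t (cb k i j)).1.1 = (t' (cb k i j)).1.1.
    by apply: (can_inj (toVK hX)); rewrite hx hx'.
  have ey : (t (cb k i j)).1.2 = (t' (cb k i j)).1.2.
    by apply: (can_inj (toVK hY)); rewrite hy hy'.
  have ez : (t (cb k i j)).2 = (t' (cb k i j)).2.
    by apply: (can_inj (toVK hZ)); rewrite hz hz'.
  by case: (t _) (t' _) ex ey ez => [[? ?] ?] [[? ?] ?] /= -> -> ->.
rewrite -(card_in_imset ginj); apply/subset_leq_card/subsetP => _ /imsetP[t + ->].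
rewrite !inE => /co ht.
have f i j k : T (x t i j) (y t j k) (z t i k).
  by have [h <- <- <-] := ht i j k; apply: in_T.
rewrite /sat /=; apply/and5P; split; [exact: f|exact: f|exact: f|exact: f|].
by apply/and5P; split; try exact: f.
Qed.

Lemma slit_of_corners (L : rel3 'I_n) (u : bool -> bool -> bool -> 'I_n * 'I_n * 'I_n) :
    (forall k i j, L (u k i j).1.1 (u k i j).1.2 (u k i j).2) ->
    (forall k i j, i || j -> (u k i j).1.1 = (u (~~ k) i j).1.1) ->
    (forall k i j, (u k i j).1.2 = (u k (~~ i) j).1.2) ->
    (forall k i j, (u k i j).2 = (u k i (~~ j)).2) ->
  slit v0 L (u false false false).1.1 (u true false false).1.1.
Proof.
move=> hL hx hy hz; apply/existsP.
pose x i j := (u false i j).1.1; pose y j k := (u k false j).1.2; pose z i k := (u k i false).2.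
(* The slit lies at [i = j = false], whereas [face_tab] splits x11; both indices are therefore
   complemented. *)
exists [tuple x true true; x true false; x false true; x false false; (u true false false).1.1;
  y true false; y true true; y false false; y false true;
  z true false; z true true; z false false; z false true].
have ey k i j : (u k i j).1.2 = y j k by case: i => //; rewrite hy.
have ez k i j : (u k i j).2 = z i k by case: j => //; rewrite hz.
have ex k i j : i || j -> (u k i j).1.1 = x i j by case: k => // h; rewrite hx.
have f k i j : L (u k i j).1.1 (y j k) (z i k) by rewrite -(ey k i j) -(ez k i j).
have f' k i j : i || j -> L (x i j) (y j k) (z i k) by move=> h; rewrite -(ex k i j h).
apply/and3P; split; [|exact: eqxx|exact: eqxx].
apply/and5P; split; [exact: f'|exact: f'|exact: f'|exact: f'|].
by apply/and5P; split; [exact: f'|exact: f'|exact: f|exact: f|].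
Qed.

Lemma slit_of_octahedron (L : rel3 'I_n) t : slit_octahedron (complex_of_rel L) t ->
  exists r x x', slit v0 (rotn r L) x x' /\ x != x'.
Proof.
case=> hin [j [w [hne hco]]].
have hL a b c : L (toV hX (t (corner w a b c)).1.1) (toV hY (t (corner w a b c)).1.2)
    (toV hZ (t (corner w a b c)).2) by have := hin (corner w a b c); rewrite inE.
have cinj a b c a' b' c' : corner w a b c = corner w a' b' c' -> [/\ a = a', b = b' & c = c'].
  move=> e; have h q : w q (+) nth false [:: a; b; c] q = w q (+) nth false [:: a'; b'; c'] q.
    by have := congr1 (fun v : cube => v q) e; rewrite !ffunE.
  have := (h o0, h o1, h o2); rewrite /= => -[[/addbI -> /addbI ->] /addbI ->].
  by [].
have fl0 a b c : coincide t o0 (corner w a b c) ->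
    toV hX (t (corner w a b c)).1.1 = toV hX (t (corner w (~~ a) b c)).1.1.
  by rewrite coincide0 flip_corner0 => /eqP ->.
have fl1 a b c : coincide t o1 (corner w a b c) ->
    toV hY (t (corner w a b c)).1.2 = toV hY (t (corner w a (~~ b) c)).1.2.
  by rewrite coincide1 flip_corner1 => /eqP ->.
have fl2 a b c : coincide t o2 (corner w a b c) ->
    toV hZ (t (corner w a b c)).2 = toV hZ (t (corner w a b (~~ c))).2.
  by rewrite coincide2 flip_corner2 => /eqP ->.
have wE := corner_id w; move: hne hco; rewrite -wE {wE}.
move: j; apply: ord3P => hne hco.
- pose u k i j := (toV hX (t (corner w k i j)).1.1, toV hY (t (corner w k i j)).1.2,
    toV hZ (t (corner w k i j)).2).
  exists 0%N, (u false false false).1.1, (u true false false).1.1; split.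
    apply: (@slit_of_corners _ u) => [k i j|k i j hij|k i j|k i j]; first exact: hL.
    + apply: (fl0 k i j); apply: hco => -[_]; rewrite flip_corner0.
      by move: hij => /[swap] -[] /cinj[_ -> ->].
    + by apply: (fl1 k i j); apply: hco => -[/(congr1 val)].
    + by apply: (fl2 k i j); apply: hco => -[/(congr1 val)].
  apply: contra hne => /eqP /(can_inj (toVK hX)) e; rewrite coincide0 flip_corner0.
  by apply/eqP.
- pose u k i j := (toV hY (t (corner w j k i)).1.2, toV hZ (t (corner w j k i)).2,
    toV hX (t (corner w j k i)).1.1).
  exists 1%N, (u false false false).1.1, (u true false false).1.1; split.
    apply: (@slit_of_corners _ u) => [k i j|k i j hij|k i j|k i j]; first exact: hL.
    + apply: (fl1 j k i); apply: hco => -[_]; rewrite flip_corner1.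
      by move: hij => /[swap] -[] /cinj[-> _ ->].
    + by apply: (fl2 j k i); apply: hco => -[/(congr1 val)].
    + by apply: (fl0 j k i); apply: hco => -[/(congr1 val)].
  apply: contra hne => /eqP /(can_inj (toVK hY)) e; rewrite coincide1 flip_corner1.
  by apply/eqP.
- pose u k i j := (toV hZ (t (corner w i j k)).2, toV hX (t (corner w i j k)).1.1,
    toV hY (t (corner w i j k)).1.2).
  exists 2%N, (u false false false).1.1, (u true false false).1.1; split.
    apply: (@slit_of_corners _ u) => [k i j|k i j hij|k i j|k i j]; first exact: hL.
    + apply: (fl2 i j k); apply: hco => -[_]; rewrite flip_corner2.
      by move: hij => /[swap] -[] /cinj[-> -> _].
    + by apply: (fl0 i j k); apply: hco => -[/(congr1 val)].
    + by apply: (fl1 i j k); apply: hco => -[/(congr1 val)].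
  apply: contra hne => /eqP /(can_inj (toVK hZ)) e; rewrite coincide2 flip_corner2.
  by apply/eqP.
Qed.

End Transport.

(** * The exponent and the ranges of the parameters *)

Lemma slit_free_set1 (X Y Z : finType) (f : face X Y Z) t : ~ slit_octahedron [set f] t.
Proof.
case=> hin [j [w [/negP hne _]]]; apply: hne; rewrite /coincide.
by have /set1P -> := hin w; have /set1P -> := hin (flip j w).
Qed.

(** With [t = 1 - eps] this gives [eps ^+ m < 1/2] when [m * t > 1], and [eps ^+ m <= 1 - m * t / 2]
    otherwise. *)
Lemma expr_le_inv (R : realFieldType) (t : R) m : 0 <= t <= 1 ->
  (1 - t) ^+ m * (1 + m%:R * t) <= 1.
Proof.
case/andP=> t0 t1; have u0 : 0 <= 1 - t by rewrite subr_ge0.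
apply: (@le_trans _ _ ((1 - t) ^+ m * (1 + t) ^+ m)).
  apply: ler_wpM2l; first by rewrite exprn_ge0.
  elim: m => [|m IH]; first by rewrite mul0r addr0.
  rewrite exprS; apply: le_trans (ler_wpM2l _ IH); last by rewrite addr_ge0.
  have : 0 <= m%:R * t * t by rewrite !mulr_ge0.
  by rewrite -natr1; move: (m%:R) => a; lra.
have tt := mulr_ge0 t0 t0; rewrite -exprMn; apply: exprn_ile1; last by lra.
by apply: mulr_ge0 => //; rewrite addr_ge0.
Qed.

Theorem theorem5p6 (R : realType) :
  exists C : R, 0 < C /\
    forall (eps : R) (n : nat) (X Y Z : finType) (K : {set face X Y Z}),
      0 < eps ->
      #|X| = n -> #|Y| = n -> #|Z| = n ->
      linear_complex K ->
      eps * n%:R ^+ 5 <= #|octahedra K|%:R ->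
      exists L : {set face X Y Z},
        [/\ L \subset K,
            eps `^ C * n%:R ^+ 2 <= #|L|%:R
          & forall t, ~ slit_octahedron L t].
Proof.
have [M hM] := dense_case R.
have [j hj] : exists j : nat, j%:R = 2%:R ^+ 24 :> R by exists (2 ^ 24)%N; rewrite natrX.
(* For [eps] near 1 the summand [j] suffices. Otherwise [eps ^+ j <= 1/2], and the first two
   summands put [eps ^+ m] below [((eps / 2) ^+ M) ^+ 2]; the square serves the case of small
   [n]. *)
pose m := (2 * M + 2 * M * j + j)%N; exists m%:R.
have j0 : 0 < j%:R :> R by rewrite hj exprn_gt0 ?ltr0n.
have m0 : 0 < m%:R :> R by apply: lt_le_trans j0 _; rewrite ler_nat leq_addl.
split=> // eps n X Y Z K e0 hX hY hZ hK hoct; rewrite powR_mulrn ?ltW //.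
have [n0|n0] := posnP n.
  exists set0; rewrite sub0set n0 expr0n mulr0 ler0n; split=> // t [h _].
  by have := h [ffun=> false]; rewrite inE.
pose v0 : 'I_n := Ordinal n0.
have V0 : (0 < #|'I_n|)%N by rewrite card_ord.
pose T := rel_of_complex hX hY hZ K; have TP : partial_latin T := partial_latin_complex hX hY hZ hK.
have N0 : 0 < n%:R :> R by rewrite ltr0n.
have NX k : 0 < n%:R ^+ k :> R by rewrite exprn_gt0.
have octT : eps * #|'I_n|%:R ^+ 5 <= #|octs v0 T|%:R.
  by rewrite card_ord; apply: le_trans hoct _; rewrite ler_nat card_octahedra.
have e1 : eps <= 1.
  have := le_trans octT (card_octs_le R v0 TP).
  by rewrite card_ord -{2}[_ ^+ 5]mul1r ler_pM2r.
have finish L0 : sub3 L0 T -> eps ^+ m * n%:R ^+ 2 <= #|faces L0|%:R ->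
    (forall r x x', slit v0 (rotn r L0) x x' -> x = x') ->
    exists L : {set face X Y Z}, [/\ L \subset K, eps ^+ m * n%:R ^+ 2 <= #|L|%:R
      & forall t, ~ slit_octahedron L t].
  move=> sL cL nL; exists (complex_of_rel hX hY hZ L0); split.
  - exact: complex_of_rel_sub.
  - by apply: le_trans cL _; rewrite ler_nat card_complex_of_rel.
  - by move=> t /(slit_of_octahedron v0)[r [x [x' [/nL -> /eqP]]]].
have eXle i k : (i <= k)%N -> eps ^+ k <= eps ^+ i by move=> ?; apply: ler_wiXn2l; rewrite // ltW.
pose tau := 1 - eps.
have t0 : 0 <= tau <= 1 by rewrite subr_ge0 e1 gerBl ltW.
have [near|far] := lerP tau (2%:R ^- 24).
  have /andP[t00 _] := t0.
  have [||L0 [sL cL nL]] := @near_case R _ v0 V0 T tau TP.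
  - rewrite t00 (le_trans near) // lef_pV2 ?posrE ?exprn_gt0 ?ltr0n //.
    by rewrite ler_weXn2l // ler1n.
  - by rewrite subKr.
  apply: finish nL => //; apply: le_trans cL; rewrite card_ord ler_pM2r //.
  apply: (le_trans (eXle _ _ (leq_addl _ _))).
  have := expr_le_inv j t0; rewrite subKr hj.
  have h24 : 2%:R ^+ 24 = 2%:R * 2%:R ^+ 23 :> R by rewrite exprS.
  have jt : 2%:R ^+ 24 * tau <= 1.
    by rewrite -ler_pdivlMl ?exprn_gt0 ?ltr0n // mulr1.
  have a0 : 0 <= 2%:R ^+ 23 * tau by rewrite mulr_ge0 ?exprn_ge0 ?ler0n.
  have key (q s p : R) : 0 <= q * s -> 2%:R * q * s <= 1 -> p * (1 + 2%:R * q * s) <= 1 ->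
      p <= 1 - q * s.
    rewrite -[2%:R * q * s]mulrA; move: (q * s) => a {}a0 {}jt h.
    have q0 : 0 < 1 + 2%:R * a by lra.
    rewrite -(ler_pM2r q0); apply: (le_trans h).
    have : 0 <= a * (1 - 2%:R * a) by rewrite mulr_ge0 // subr_ge0.
    by lra.
  by move=> h; apply: key => //; rewrite -h24.
have half : eps ^+ j <= 2%:R^-1.
  have := expr_le_inv j t0; rewrite subKr hj => h.
  have : 1 < 2%:R ^+ 24 * tau by rewrite -ltr_pdivrMl ?exprn_gt0 ?ltr0n // mulr1.
  have p0 : 0 <= eps ^+ j by rewrite exprn_ge0 // ltW.
  move=> h1; have h2 : eps ^+ j * 2%:R <= 1.
    by apply: le_trans h; apply: ler_wpM2l => //; lra.
  by rewrite -ler_pdivlMr ?ltr0n // mul1r in h2.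
have e2 : 0 < eps / 2%:R <= 2%:R^-1.
  by rewrite divr_gt0 ?ltr0n //= ler_pdivrMr ?ltr0n // mulVf ?pnatr_eq0.
have hpow : eps ^+ m <= ((eps / 2%:R) ^+ M) ^+ 2.
  rewrite -exprM expr_div_n mulnC; apply: (le_trans (eXle _ _ (leq_addr _ _))).
  rewrite exprD ler_pM2l ?exprn_gt0 // mulnC exprM -exprVn.
  by rewrite lerXn2r // nnegrE ?exprn_ge0 ?invr_ge0 ?ler0n // ltW.
have eM1 : (eps / 2%:R) ^+ M <= 1.
  case/andP: e2 => h1 h2; apply: exprn_ile1; first exact: ltW.
  by apply: (le_trans h2); rewrite invf_le1 ?ltr0n ?ler1n.
have eM0 : 0 < (eps / 2%:R) ^+ M by case/andP: e2 => h1 _; rewrite exprn_gt0.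
(* If [n] is too small for the dense case, the number of faces required is at most 1 and a single
   face will do. *)
have [large|small] := lerP 1 ((eps / 2%:R) ^+ M * n%:R).
  have [||L0 [sL cL nL]] := hM _ v0 T (eps / 2%:R) e2 TP.
  - apply: le_trans octT; rewrite ler_wpM2r ?exprn_ge0 ?ler0n //.
    by rewrite ler_pdivrMr ?ltr0n // ler_peMr ?ler1n // ltW.
  - by rewrite card_ord.
  apply: finish nL => //; apply: le_trans cL; rewrite card_ord ler_pM2r //.
  by apply: (le_trans hpow); rewrite expr2 ler_piMl // ltW.
have [t ht] : exists t, t \in octahedra K.
  apply/card_gt0P; rewrite -(ltr0n R); apply: lt_le_trans hoct.
  by rewrite mulr_gt0.
have [f fK] : exists f, f \in K.
  by move: ht; rewrite inE => /andP[/forallP h _]; exists (t [ffun=> false]).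
exists [set f]; split; first by rewrite sub1set.
  rewrite cards1; apply: (@le_trans _ _ (((eps / 2%:R) ^+ M * n%:R) ^+ 2)).
    by rewrite exprMn ler_pM2r.
  by rewrite exprn_ile1 ?mulr_ge0 ?ltW.
exact: slit_free_set1.
Qed.
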